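(* Let $n\ge1$ be an integer and $\mu>0$. Let $\mathbb S(t)$ and $\mathbb E(t)$, $t\ge0$, be the solution operator and the energy operator of the Cauchy problem $$v_{tt}-\Delta v+\frac{\mu}{1+t}v_t=0,\qquad v(0,\cdot)=v_1,\qquad v_t(0,\cdot)=v_2,\qquad x\in\mathbb R^n,\ t\ge 0,$$ that is, $$\mathbb S(t):(v_1,\langle D\rangle^{-1}v_2)\mapsto v(t,\cdot),\qquad \mathbb E(t):(\langle D\rangle v_1,v_2)\mapsto(\partial_tv(t,\cdot),|D|v(t,\cdot)).$$ Then, with constants independent of $t\ge0$: 1. The solution operator satisfies the norm estimate $$\|\mathbb S(t)\|_{L_2(\mathbb R^n,\mathbb R^2)\to L_2(\mathbb R^n)}\lesssim\begin{cases}(1+t)^{1-\mu},&\mu\in(0,1),\\ \log(e+t),&\mu=1,\\ 1,&\mu>1.\end{cases}$$ 2. The energy operator satisfies $$\|\mathbb E(t)\|_{L_2(\mathbb R^n,\mathbb R^2)\to L_2(\mathbb R^n,\mathbb R^2)}\lesssim\begin{cases}(1+t)^{-\frac\mu2},&\mu\in(0,2],\\ (1+t)^{-1},&\mu>2.\end{cases}$$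
   Context: $\langle D\rangle$ and $|D|$ are the Fourier multiplier operators with symbols $\langle\xi\rangle=\sqrt{1+|\xi|^2}$ and $|\xi|$. The operators $\mathbb S(t)$ and $\mathbb E(t)$ are defined via solutions $v$ to data $v_1,v_2\in\mathcal S(\mathbb R^n)$ (Schwartz space) and extended by density; the operator norms are taken with respect to the indicated $L_2$ spaces. $A\lesssim B$ means $A\le CB$ with a constant $C>0$ independent of $t$ (and of the data), possibly depending on $n$ and $\mu$. *)

(* Defs.v *)
From HB Require Import structures.
From mathcomp Require Import all_boot all_order all_algebra.
From mathcomp Require Import complex.
From mathcomp Require Import all_classical all_reals all_analysis.

Set Implicit Arguments.
Unset Strict Implicit.
Unset Printing Implicit Defensive.

Import Order.TTheory GRing.Theory Num.Theory.
Import numFieldNormedType.Exports.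

Local Open Scope classical_set_scope.
Local Open Scope ring_scope.

(* R^n is the type 'rV[R]_n of row vectors. Its library norm `|x| is the max
   norm; the Euclidean norm is enorm. *)

Section euclidean.
Context {R : realType} {n : nat}.

Definition dot (x y : 'rV[R]_n) : R := \sum_(i < n) x ord0 i * y ord0 i.

Definition enorm (x : 'rV[R]_n) : R := Num.sqrt (dot x x).

End euclidean.

(* The sigma-algebra of R^n is generated by the coordinate maps, as the library
   does for n.-tuple. *)
Section measurable_rV.
Context {d : measure_display} {T : sigmaRingType d} {n : nat}.

Let coor (i : 'I_n) (x : 'rV[T]_n) : T := x ord0 i.

Let rV_set0 : g_sigma_preimage coor set0.
Proof. exact: sigma_algebra0. Qed.

Let rV_setC A : g_sigma_preimage coor A -> g_sigma_preimage coor (~` A).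
Proof. exact: sigma_algebraC. Qed.

Let rV_bigcup (F : _^nat) : (forall i, g_sigma_preimage coor (F i)) ->
  g_sigma_preimage coor (\bigcup_i (F i)).
Proof. exact: sigma_algebra_bigcup. Qed.

HB.instance Definition _ := @isMeasurable.Build (measure_tuple_display d)
  'rV[T]_n (g_sigma_preimage coor) rV_set0 rV_setC rV_bigcup.

End measurable_rV.

Section lebesgue_rV.
Context {R : realType}.

Lemma measurable_coord n (i : 'I_n) :
  measurable_fun [set: 'rV[R]_n] (fun x => x ord0 i).
Proof.
move=> _ Y mY; rewrite setTI; apply: sub_sigma_algebra => /=.
rewrite -bigcup_seq/=; exists i => /=; first by rewrite mem_index_enum.
by exists Y => //; rewrite setTI.
Qed.

Lemma measurable_rV d (T : measurableType d) n (f : T -> 'rV[R]_n) :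
  (forall i, measurable_fun [set: T] (fun x => f x ord0 i)) ->
  measurable_fun [set: T] f.
Proof.
move=> mf; suff H : g_sigma_preimage (fun (i : 'I_n) x => f x ord0 i) `<=` measurable.
  move=> _ A mA; rewrite setTI; apply: H.
  rewrite (g_sigma_preimage_comp (fun (i : 'I_n) (x : 'rV[R]_n) => x ord0 i) f).
  by exists A => //; rewrite setTI.
apply: smallest_sub; first exact: sigma_algebra_measurable.
case: n => [|n] in f mf *; first by rewrite big_ord0.
rewrite -bigcup_mkord_ord; apply: bigcup_sub => i Ii.
by move=> A [B mB <-]; exact: mf.
Qed.

Definition rV_cons n (p : R * 'rV[R]_n) : 'rV[R]_n.+1 :=
  row_mx p.1%:M p.2 : 'rV[R]_(1 + n).

Lemma rV_cons0 n (p : R * 'rV[R]_n) : rV_cons p ord0 ord0 = p.1.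
Proof.
rewrite /rV_cons (_ : ord0 = lshift n (ord0 : 'I_1)); last exact/val_inj.
by rewrite [LHS](row_mxEl p.1%:M p.2 ord0) mxE eqxx mulr1n.
Qed.

Lemma rV_consS n (p : R * 'rV[R]_n) (i : 'I_n) :
  rV_cons p ord0 (lift ord0 i) = p.2 ord0 i.
Proof.
rewrite /rV_cons (_ : lift ord0 i = rshift 1 i); last exact/val_inj.
by rewrite [LHS](row_mxEr p.1%:M p.2 ord0).
Qed.

Lemma measurable_rV_cons n : measurable_fun [set: R * 'rV[R]_n] (@rV_cons n).
Proof.
apply: measurable_rV => i; case: (unliftP ord0 i) => [j ->|->].
- under eq_fun do rewrite rV_consS.
  exact: (measurableT_comp (measurable_coord j) measurable_snd).
- under eq_fun do rewrite rV_cons0.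
  exact: measurable_fst.
Qed.

Section lebesgue_rV_succ.
Context {n : nat} (m : {sigma_finite_measure set 'rV[R]_n -> \bar R}).

Definition lebesgue_rV_succ : set 'rV[R]_n.+1 -> \bar R :=
  pushforward (@lebesgue_measure R \x m)%E (@rV_cons n).

Let lebesgue_rV_succ0 : lebesgue_rV_succ set0 = 0%E.
Proof. by rewrite /lebesgue_rV_succ /pushforward preimage_set0 measure0. Qed.

Let lebesgue_rV_succ_ge0 A : (0 <= lebesgue_rV_succ A)%E.
Proof. by rewrite /lebesgue_rV_succ /pushforward; exact: measure_ge0. Qed.

Let lebesgue_rV_succ_sigma_additive : semi_sigma_additive lebesgue_rV_succ.
Proof.
exact: (@measure_semi_sigma_additive _ _ _
  (measure_function_pushforward__canonical__measure_function_Measure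
    (@lebesgue_measure R \x m)%E (@measurable_rV_cons n))).
Qed.

HB.instance Definition _ := isMeasure.Build _ _ _ lebesgue_rV_succ
  lebesgue_rV_succ0 lebesgue_rV_succ_ge0 lebesgue_rV_succ_sigma_additive.

Let lebesgue_rV_succ_sigma_finite : sigma_finite setT lebesgue_rV_succ.
Proof.
have /sigma_finiteP[F [TF ndF Foo]] := sigma_finiteT (@lebesgue_measure R).
have /sigma_finiteP[G [TG ndG Goo]] := sigma_finiteT m.
pose uncons (x : 'rV[R]_n.+1) : R * 'rV[R]_n :=
  (x ord0 ord0, \row_j x ord0 (lift ord0 j)).
have consK : cancel (@rV_cons n) uncons.
  move=> p; rewrite /uncons rV_cons0; case: p => a b /=; congr pair.
  by apply/rowP => j; rewrite mxE rV_consS.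
have m_uncons : measurable_fun setT uncons.
  apply: measurable_fun_pair; first exact: measurable_coord.
  apply: measurable_rV => i; under eq_fun do rewrite mxE.
  exact: measurable_coord.
exists (fun i => uncons @^-1` (F i `*` G i)).
  apply/esym; rewrite -preimage_bigcup -subTset => x _ /=.
  have [i _ Fi] : (\bigcup_i F i) (uncons x).1 by rewrite -TF.
  have [j _ Gj] : (\bigcup_i G i) (uncons x).2 by rewrite -TG.
  exists (maxn i j) => //; split.
  - by move: Fi; exact/subsetPset/ndF/leq_maxl.
  - by move: Gj; exact/subsetPset/ndG/leq_maxr.
move=> i; have [mF Fi] := Foo i; have [mG Gi] := Goo i; split.
  by rewrite -[X in measurable X]setTI; apply: m_uncons => //; exact: measurableX.
rewrite /lebesgue_rV_succ /pushforward -comp_preimage.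
rewrite (_ : uncons \o _ = id); last by apply/funext => p; exact: consK.
by rewrite preimage_id product_measure1E// lte_mul_pinfty// ge0_fin_numE.
Qed.

HB.instance Definition _ := Measure_isSigmaFinite.Build _ _ _ lebesgue_rV_succ
  lebesgue_rV_succ_sigma_finite.

End lebesgue_rV_succ.

(* Lebesgue measure on R^n, as the iterated product of the one on R. *)
Fixpoint lebesgue_rV (n : nat) : {sigma_finite_measure set 'rV[R]_n -> \bar R} :=
  match n with
  | 0%N => \d_(0 : 'rV[R]_0)
  | n'.+1 => lebesgue_rV_succ (lebesgue_rV n')
  end.

End lebesgue_rV.

Section fourier.
Context {R : realType} {n : nat}.
Implicit Types (f m : 'rV[R]_n -> R).

(* Lebesgue integral over R^n of a complex-valued function. *)
Definition cintegral (g : 'rV[R]_n -> R[i]) : R[i] :=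
  ((\int[lebesgue_rV n]_x complex.Re (g x))
    +i* (\int[lebesgue_rV n]_x complex.Im (g x)))%C.

Definition expi (a : R) : R[i] := (cos a +i* sin a)%C.

Definition fourier (g : 'rV[R]_n -> R[i]) (xi : 'rV[R]_n) : R[i] :=
  (Num.sqrt (2 * pi) ^- n)%:C%C * cintegral (fun x => expi (- dot x xi) * g x).

Definition inv_fourier (g : 'rV[R]_n -> R[i]) (x : 'rV[R]_n) : R[i] :=
  (Num.sqrt (2 * pi) ^- n)%:C%C * cintegral (fun xi => expi (dot x xi) * g xi).

(* m(D) f for a real-valued f and a real symbol m. Only even symbols are used:
   for those the inverse transform is real-valued, and Re is a mere cast. *)
Definition fourier_multiplier m f (x : 'rV[R]_n) : R :=
  complex.Re (inv_fourier
    (fun xi => (m xi)%:C%C * fourier (fun y => (f y)%:C%C) xi) x).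

Definition japanese (xi : 'rV[R]_n) : R := Num.sqrt (1 + enorm xi ^+ 2).

Definition japaneseD f := fourier_multiplier japanese f.
Definition inv_japaneseD f := fourier_multiplier (fun xi => (japanese xi)^-1) f.
Definition absD f := fourier_multiplier enorm f.

End fourier.

Section schwartz.
Context {R : realType} {n : nat}.
Implicit Types (f g : 'rV[R]_n -> R) (s : seq 'I_n).

(* Iterated partial derivatives; a multi-index is given as the sequence of the
   directions of differentiation. *)
Definition pderiv s f : 'rV[R]_n -> R :=
  foldr (fun i g => 'D_(delta_mx ord0 i) g) f s.

Definition laplacian f (x : 'rV[R]_n) : R := \sum_(i < n) pderiv [:: i; i] f x.

Definition schwartz_seminorm (k : nat) s f : \bar R :=
  ereal_sup [set ((1 + enorm x) ^+ k * `|pderiv s f x|)%:E | x in [set: 'rV[R]_n]].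

Definition schwartz f : Prop :=
  (forall s x, differentiable (pderiv s f) x) /\
  (forall k s, (schwartz_seminorm k s f < +oo)%E).

(* Convergence along a filter in the Frechet topology of the Schwartz space. *)
Definition schwartz_cvg {T : Type} (F : set_system T)
    (u : T -> 'rV[R]_n -> R) g : Prop :=
  forall k s, schwartz_seminorm k s (u t \- g) @[t --> F] --> 0%E.

(* u is continuous on [0, oo[ with values in the Schwartz space. *)
Definition schwartz_continuous (u : R -> 'rV[R]_n -> R) : Prop :=
  forall t, 0 <= t -> schwartz (u t) /\
    schwartz_cvg (within [set r | 0 <= r] (nbhs t)) u (u t).

(* u' is the derivative of u on [0, oo[ (one-sided at 0) in that topology. *)
Definition schwartz_derive (u u' : R -> 'rV[R]_n -> R) : Prop :=
  forall t, 0 <= t ->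
    schwartz_cvg (within [set h | 0 <= t + h] (0 : R)^')
      (fun h x => h^-1 * (u (t + h) x - u t x)) (u' t).

End schwartz.

Section damped_wave.
Context {R : realType} {n : nat}.

(* v, of class C^2 on [0, oo[ with values in the Schwartz space and with first
   time derivative vt, solves
     v_tt - Delta v + mu / (1 + t) v_t = 0,  v(0) = v1,  v_t(0) = v2. *)
Definition cauchy_solution (mu : R) (v1 v2 : 'rV[R]_n -> R)
    (v vt : R -> 'rV[R]_n -> R) : Prop :=
  exists vtt,
    [/\ schwartz_continuous v, schwartz_continuous vt & schwartz_continuous vtt]
    /\ [/\ schwartz_derive v vt, schwartz_derive vt vtt,
           (forall t x, 0 <= t ->
              vtt t x - laplacian (v t) x + mu / (1 + t) * vt t x = 0),
           v 0 = v1 & vt 0 = v2].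

End damped_wave.

Section operators.
Context {R : realType} {n : nat}.

(* L_2(R^n, R^k), as functions with values in 'rV[R]_k. *)
Definition L2 {k : nat} (f : 'rV[R]_n -> 'rV[R]_k) : Prop :=
  forall i, (fun x => f x ord0 i) \in Lfun (lebesgue_rV n) 2%:E.

Definition L2norm {k : nat} (f : 'rV[R]_n -> 'rV[R]_k) : \bar R :=
  Lnorm (lebesgue_rV n) 2%:E (fun x => (enorm (f x))%:E).

(* Operators from L_2(R^n, R^k) to L_2(R^n, R^l) are given by their graphs. *)
Definition graph k l := set (('rV[R]_n -> 'rV[R]_k) * ('rV[R]_n -> 'rV[R]_l)).

(* Extension by density: the L_2-closure of the graph. *)
Definition L2_extension {k l} (G : graph k l) : graph k l :=
  [set p | [/\ L2 p.1, L2 p.2 &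
    exists q : nat -> ('rV[R]_n -> 'rV[R]_k) * ('rV[R]_n -> 'rV[R]_l),
      [/\ (forall j, G (q j)),
          L2norm ((q j).1 \- p.1) @[j --> \oo] --> 0%E &
          L2norm ((q j).2 \- p.2) @[j --> \oo] --> 0%E]]].

Definition L2_opnorm {k l} (G : graph k l) : \bar R :=
  ereal_sup [set L2norm p.2 | p in [set p | G p /\ (L2norm p.1 <= 1)%E]].

Definition row1 (f : 'rV[R]_n -> R) : 'rV[R]_n -> 'rV[R]_1 :=
  fun x => (f x)%:M.
Definition row2 (f g : 'rV[R]_n -> R) : 'rV[R]_n -> 'rV[R]_2 :=
  fun x => row_mx (f x)%:M (g x)%:M : 'rV[R]_(1 + 1).

Definition solution_operator (mu t : R) : graph 2 1 :=
  L2_extension [set p | exists v1 v2 v vt,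
    [/\ schwartz v1, schwartz v2, cauchy_solution mu v1 v2 v vt &
        p = (row2 v1 (inv_japaneseD v2), row1 (v t))]].

Definition energy_operator (mu t : R) : graph 2 2 :=
  L2_extension [set p | exists v1 v2 v vt,
    [/\ schwartz v1, schwartz v2, cauchy_solution mu v1 v2 v vt &
        p = (row2 (japaneseD v1) v2, row2 (vt t) (absD (v t)))]].

End operators.

(* Main.v *)
(** The proof works on the Fourier side, where the equation becomes a family of
    damped oscillators [y'' + mu / (1 + t) y' + |xi|^2 y = 0].

    All data are real, so the Fourier transform is replaced by the real Hartley
    transform [H h xi = int (cos + sin) (x . xi) h x dx].  For continuous [h]
    dominated by [prod_i 1 / (1 + x_i^2)], Plancherel's identity is obtained by
    inserting the weight [prod_i exp (- e |xi_i|)] into the integral of [(H h)^2]: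
    Fubini turns it into the integral of [h x * h (x + e z)] against a fixed
    integrable function of [z], and [e -> 0] gives a multiple of the integral of
    [h^2].  An even multiplier [m(D)] is, up to a constant, [f |-> H (m * H f)].

    For the oscillator with [s = 1 + t], the quantities
    [s^mu (y'^2 + |xi|^2 y^2 + mu y y' / s + mu y^2 / (2 s^2))] if [mu <= 2], and
    [(s y' + y)^2 + (mu - 2) y^2 + |xi|^2 s^2 y^2] if [2 <= mu], are nonincreasing,
    which gives the energy estimate.  For the solution itself, [|xi| >= 1] is
    handled by the plain energy; for [|xi| < 1] a comparison argument bounds [y]
    as long as [|xi| s <= 1], and the energy takes over from there. *)

Require Import Defs.
From HB Require Import structures.
From mathcomp Require Import all_boot all_order all_algebra.
From mathcomp Require Import complex.
From mathcomp Require Import all_classical all_reals all_analysis.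
From mathcomp Require Import measurable_realfun lebesgue_measure.
From mathcomp Require Import ring lra.

Set Implicit Arguments.
Unset Strict Implicit.
Unset Printing Implicit Defensive.

Import Order.TTheory GRing.Theory Num.Theory.
Import numFieldNormedType.Exports.

Local Open Scope classical_set_scope.
Local Open Scope ring_scope.

(** * Lebesgue measure on R^n under affine maps *)

(** A multiplier is itself a transform, that of [m * H f], so Plancherel's identity can be applied
    to this function directly. This dictates the class [rapid] on which the identity is proved: it
    has to contain the Schwartz functions and also [m * H f], where [m] may have a conical point at
    the origin like |xi|, so only continuity and decay can be asked for.

    The two decreasing functionals are energies of transformed oscillators: of [w = s^(mu/2) y],
    which removes the damping, when mu <= 2, and of [w = s y], corrected by a multiple of y^2, when
    mu >= 2. The first loses its control of y / s at mu = 2, so that borderline is proved with the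
    second.

    The low frequencies are the obstacle for the solution itself: |xi|^2 y^2 says little about y
    when |xi| is small. There y has to be recovered by integrating y', which decays only like
    s^(-mu). The integral of s^(-mu) is the origin of the three rates s^(1-mu), log and 1. *)

Lemma ge0_integral_affine (R : realType) (c b : R) (F : R -> \bar R) :
  c != 0 -> measurable_fun [set: R] F -> (forall x, 0 <= F x)%E ->
  (\int[lebesgue_measure]_x F (c * x + b)%R
   = (`|c|^-1)%:E * \int[lebesgue_measure]_x F x)%E.
Proof.
move=> c0 mF F0.
pose phi : measurableTypeR R -> measurableTypeR R := fun x : R => (c * x + b : R).
have mphi : measurable_fun setT phi.
  exact: (@measurable_funD _ (measurableTypeR R) R setT (fun x : R => c * x)
    (cst b) (measurable_funM (measurable_cst c) (@measurable_id _ _ _))).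
pose k : {nonneg R} := NngNum (normr_ge0 c).
pose m' := measure_function_pushforward__canonical__measure_function_Measure
    (@lebesgue_measure R) mphi.
pose nu := [the measure (measurableTypeR R) R of mscale k m'].
(* By uniqueness of Lebesgue measure, [nu], which is |c| times the image measure, only has to be
   compared with it on half-open intervals. *)
have H A : measurable A -> lebesgue_measure A = nu A.
  apply: lebesgue_measure_unique => X [[u v] /= _ <-].
  rewrite /nu /= /mscale/= /m' /= /pushforward lebesgue_measure_itv/=.
  (* For negative [c] the map reverses the order, and the preimage is closed at the other end. *)
  have -> : phi @^-1` `]u, v] =
      if 0 < c then `](u - b) / c, (v - b) / c]%classic
      else `[(v - b) / c, (u - b) / c[%classic.
    apply/seteqP; split => x /=; case: ifPn => cp;
      rewrite /phi /= !in_itv/=.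
    - by rewrite ltr_pdivrMr// ler_pdivlMr// ltrBlDr lerBrDr mulrC.
    - have cn : c < 0 by rewrite lt_neqAle c0 leNgt.
      rewrite ler_ndivrMr// ltr_ndivlMr// ltrBlDr lerBrDr mulrC => /andP[-> ->]//.
    - by rewrite ltr_pdivrMr// ler_pdivlMr// ltrBlDr lerBrDr mulrC.
    - have cn : c < 0 by rewrite lt_neqAle c0 leNgt.
      rewrite ler_ndivrMr// ltr_ndivlMr// ltrBlDr lerBrDr mulrC => /andP[-> ->]//.
  rewrite lte_fin; case: (ltP 0 c) => cp; rewrite lebesgue_measure_itv/= !lte_fin.
    rewrite ltr_pM2r ?invr_gt0// ltrD2r; case: ifP => _; last by rewrite mule0.
    by rewrite -!EFinD -EFinM gtr0_norm//; congr (_%:E); field.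
  have cn : c < 0 by rewrite lt_neqAle c0.
  rewrite ltr_nM2r ?invr_lt0// ltrD2r; case: ifP => _; last by rewrite mule0.
  by rewrite -!EFinD -EFinM ltr0_norm//; congr (_%:E); field.
have E1 : (\int[lebesgue_measure]_x F x = \int[nu]_x F x)%E.
  by apply: eq_measure_integral => A mA _; exact: H.
have E2 : (\int[nu]_x F x = `|c|%:E * \int[m']_x F x)%E.
  exact: ge0_integral_mscale.
have E3 : (\int[m']_x F x = \int[lebesgue_measure]_x F (c * x + b)%R)%E.
  have := ge0_integral_pushforward mphi (@lebesgue_measure R) measurableT mF
    (fun x _ => F0 x).
  by rewrite preimage_setT; exact.
by rewrite E1 E2 E3 muleA -EFinM mulVf ?normr_eq0// mul1e.
Qed.

Section rV.
Context {R : realType}.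
Implicit Types n : nat.

Lemma ge0_integral_rV_cons n (F : 'rV[R]_n.+1 -> \bar R) :
  measurable_fun setT F -> (forall x, 0 <= F x)%E ->
  (\int[lebesgue_rV n.+1]_x F x =
   \int[lebesgue_measure]_s \int[lebesgue_rV n]_y F (rV_cons (s, y)))%E.
Proof.
move=> mF F0.
have E := @ge0_integral_pushforward _ _ (measurableTypeR R * 'rV[R]_n)%type _ R
  (@rV_cons R n) (@measurable_rV_cons R n)
  (@lebesgue_measure R \x lebesgue_rV n)%E setT F measurableT mF (fun x _ => F0 x).
rewrite preimage_setT in E; apply: etrans; first exact: E.
rewrite fubini_tonelli1//.
  by apply: measurableT_comp => //; exact: measurable_rV_cons.
by move=> p; exact: F0.
Qed.

Lemma ge0_integral_rV0 (F : 'rV[R]_0 -> \bar R) :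
  measurable_fun setT F -> (\int[lebesgue_rV 0]_x F x = F 0%R)%E.
Proof. by move=> mF; rewrite /= integral_dirac// diracT mul1e. Qed.

Lemma measurable_rV_affine n (c : R) (b : 'rV[R]_n) :
  measurable_fun setT (fun x : 'rV[R]_n => c *: x + b).
Proof.
apply: measurable_rV => i; under eq_fun do rewrite !mxE.
by apply: measurable_funD => //; apply: measurable_funM => //; exact: measurable_coord.
Qed.

Lemma rV_cons_affine n c (b : 'rV[R]_n.+1) (p : R * 'rV[R]_n) :
  c *: rV_cons p + b = rV_cons (c * p.1 + b ord0 ord0,
    c *: p.2 + \row_j b ord0 (lift ord0 j)).
Proof.
apply/rowP => i; rewrite [LHS]mxE [X in X + _ = _]mxE.
case: (unliftP ord0 i) => [j ->|->]; last by rewrite !rV_cons0.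
by rewrite !rV_consS !mxE.
Qed.

(** The map acts on each coordinate separately, so Tonelli reduces it to the line; every coordinate
    contributes one factor [|c|^-1]. *)
Lemma ge0_integral_rV_affine n (c : R) (b : 'rV[R]_n) (F : 'rV[R]_n -> \bar R) :
  c != 0 -> measurable_fun setT F -> (forall x, 0 <= F x)%E ->
  (\int[lebesgue_rV n]_x F (c *: x + b)%R
   = (`|c| ^- n)%:E * \int[lebesgue_rV n]_x F x)%E.
Proof.
move=> c0; elim: n b F => [|n IH] b F mF F0.
  rewrite !ge0_integral_rV0//; last first.
    by apply: measurableT_comp => //; exact: measurable_rV_affine.
  by rewrite expr0 invr1 mul1e; congr F; apply/rowP; case.
have mFc (d : measure_display) (T : measurableType d) (f : T -> R * 'rV[R]_n) :
    measurable_fun setT f -> measurable_fun setT (fun x => F (rV_cons (f x))).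
  move=> mf; apply: measurableT_comp => //; apply: measurableT_comp => //.
  exact: measurable_rV_cons.
rewrite !ge0_integral_rV_cons//; last first.
  by apply: measurableT_comp => //; exact: measurable_rV_affine.
pose G s : \bar R := (\int[lebesgue_rV n]_y F (rV_cons (s, y)))%E.
have G0 s : (0 <= G s)%E by exact: integral_ge0.
have mG : measurable_fun setT G.
  exact: (@measurable_fun_fubini_tonelli_F _ _ _ _ _ (lebesgue_rV n)
    (fun p => F (rV_cons p)) (mFc _ _ _ (@measurable_id _ _ _))).
have E s : (\int[lebesgue_rV n]_y F (c *: rV_cons (s, y) + b)%R =
    (`|c| ^- n)%:E * G (c * s + b ord0 ord0)%R)%E.
  under eq_integral do rewrite rV_cons_affine/=.
  rewrite (IH _ (fun y => F (rV_cons ((c * s + b ord0 ord0)%R, y))))//.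
  exact: mFc.
under eq_integral do rewrite E.
have mG' : measurable_fun setT (fun s : R => G (c * s + b ord0 ord0)%R).
  apply: measurableT_comp => //.
  by apply: measurable_funD => //; exact: measurable_funM.
have k0 : (0 <= `|c| ^- n)%R by rewrite invr_ge0 exprn_ge0.
rewrite (@ge0_integralZl_EFin _ _ R lebesgue_measure setT measurableT
  (fun s : R => G (c * s + b ord0 ord0)%R) (fun x _ => G0 _) mG' _ k0).
rewrite (ge0_integral_affine _ c0 mG G0) muleA -EFinM.
by rewrite -invfM -exprSr.
Qed.

End rV.

(** * Measurability of continuous functions on R^n *)

Lemma cvg_rV (R : realType) n (T : Type) (F : set_system T) {FF : Filter F}
    (u : T -> 'rV[R]_n) (x : 'rV[R]_n) :
  (forall i, u t ord0 i @[t --> F] --> x ord0 i) -> u t @[t --> F] --> x.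
Proof.
move=> ux; apply/cvg_ballP => e e0.
have H : \forall t \near F, forall i, ball (x ord0 i) e (u t ord0 i).
  by apply: filter_forall => i; apply: (cvg_ballP _ _).1 e e0; exact: ux.
near=> t; split => // i j; rewrite (ord1 i).
by move: j; near: t.
Unshelve. all: end_near. Qed.

Definition rV_round {R : realType} {n} (k : nat) (x : 'rV[R]_n) : 'rV[R]_n :=
  \row_j ((Num.floor (k.+1%:R * x ord0 j))%:~R / k.+1%:R).

Lemma cvg_rV_round (R : realType) n (x : 'rV[R]_n) :
  rV_round k x @[k --> \oo] --> x.
Proof.
apply: cvg_rV => i.
have H k : x ord0 i - harmonic k <= rV_round k x ord0 i <= x ord0 i.
  rewrite mxE /harmonic ler_pdivlMr// ler_pdivrMr//.
  have /andP[h1 h2] := floor_itv (k.+1%:R * x ord0 i).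
  rewrite mulrBl mulVf ?pnatr_eq0// -[x ord0 i * _]mulrC h1 andbT lerBlDr ltW//.
  by rewrite intrD in h2.
apply: (@squeeze_cvgr _ _ _ _ (fun k => x ord0 i - harmonic k) (cst (x ord0 i))).
- by apply: nearW.
- by rewrite -[X in _ --> X]subr0; apply: cvgB; [exact: cvg_cst|exact: cvg_harmonic].
- exact: cvg_cst.
Qed.

Lemma measurable_rV_round (R : realType) n k :
  measurable_fun setT (@rV_round R n k).
Proof.
apply: measurable_rV => i; under eq_fun do rewrite mxE.
apply: measurable_funM => //.
apply: (@measurableT_comp _ _ _ _ _ _ (fun y : R => (Num.floor (k.+1%:R * y))%:~R : R)).
  apply: nondecreasing_measurable => // y z yz.
  by rewrite ler_int le_floor// ler_wpM2l.
exact: measurable_coord.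
Qed.

Lemma measurable_rV_set1 (R : realType) n (y : 'rV[R]_n) : measurable [set y].
Proof.
have -> : [set y] = \bigcap_(i in [set: 'I_n]) ((fun x : 'rV[R]_n => x ord0 i) @^-1` [set y ord0 i]).
  apply/seteqP; split => [x -> //|x H]; apply/rowP => i; exact: H.
apply: fin_bigcap_measurable => // i _.
by rewrite -[X in measurable X]setTI; exact: measurable_coord.
Qed.

(** The sigma-algebra is generated by the coordinates, not by the open sets. Rounding down to the
    grid of mesh 1/(k+1) takes countably many values, so preimages under [f \o rV_round k] are
    countable unions of measurable fibres; continuity gives convergence to [f] as [k] grows. *)
Lemma continuous_measurable_rV (R : realType) n (f : 'rV[R]_n -> R) :
  continuous f -> measurable_fun setT f.
Proof.
move=> cf; apply: (@measurable_fun_cvg _ _ _ _ (fun k => f \o rV_round k)).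
- move=> k _ Y mY; rewrite setTI.
  have -> : (f \o rV_round k) @^-1` Y = \bigcup_(z : 'rV[int]_n)
      (if f (\row_j ((z ord0 j)%:~R / k.+1%:R)) \in Y
       then rV_round k @^-1` [set \row_j ((z ord0 j)%:~R / k.+1%:R)] else set0).
    apply/seteqP; split => x /=.
      move=> Yx; exists (\row_j Num.floor (k.+1%:R * x ord0 j)) => //.
      have E : \row_j (((\row_j Num.floor (k.+1%:R * x ord0 j)) ord0 j)%:~R
          / k.+1%:R) = rV_round k x :> 'rV[R]_n.
        by apply/rowP => j; rewrite !mxE.
      by rewrite E mem_set.
    by move=> [z _]; case: ifPn => // /set_mem Yz /= ->.
  apply: countable_bigcupT_measurable; first exact: countableP.
  move=> z; case: ifPn => _; last exact: measurable0.
  rewrite -[X in measurable X]setTI; apply: measurable_rV_round => //.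
  exact: measurable_rV_set1.
- by move=> x _; apply: continuous_cvg; [exact: cf|exact: cvg_rV_round].
Qed.

Lemma measurable_dot (R : realType) n : measurable_fun setT
  (fun p : 'rV[R]_n * 'rV[R]_n => dot p.1 p.2).
Proof.
apply: measurable_sum => i; apply: measurable_funM.
  exact: measurableT_comp (measurable_coord i) measurable_fst.
exact: measurableT_comp (measurable_coord i) measurable_snd.
Qed.

(** * Product functions *)

Lemma integral_rV_cons (R : realType) n (F : 'rV[R]_n.+1 -> \bar R) :
  (lebesgue_rV n.+1).-integrable setT F ->
  (\int[lebesgue_rV n.+1]_x F x =
   \int[lebesgue_measure]_s \int[lebesgue_rV n]_y F (rV_cons (s, y)))%E.
Proof.
move=> iF; have mF := measurable_int _ iF.
have mG : measurable_fun setT (F \o @rV_cons R n).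
  by apply: measurableT_comp => //; exact: measurable_rV_cons.
have iG : (@lebesgue_measure R \x lebesgue_rV n)%E.-integrable setT (F \o @rV_cons R n).
  apply/integrable12ltyP => //.
  rewrite -(ge0_integral_rV_cons (F := fun x => `|F x|%E))//.
    by move/integrableP : iF => [].
  exact: measurableT_comp.
have E := @integral_pushforward _ _ (measurableTypeR R * 'rV[R]_n)%type _ R
  (@rV_cons R n) (@measurable_rV_cons R n) (@lebesgue_measure R \x lebesgue_rV n)%E setT F mF iG measurableT.
rewrite preimage_setT in E; apply: etrans; first exact: E.
by rewrite -integral12_prod_meas1.
Qed.

Lemma integral_rV_prod (R : realType) n (g : R -> R) :
  (forall s, 0 <= g s) -> lebesgue_measure.-integrable setT (EFin \o g) ->
  (\int[lebesgue_rV n]_x (\prod_(i < n) g (x ord0 i))%:E =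
   ((\int[lebesgue_measure]_s g s) ^+ n)%:E)%E.
Proof.
move=> g0 ig.
have mg : measurable_fun setT g by apply/measurable_EFinP; exact: measurable_int ig.
have mp m : measurable_fun setT (fun x : 'rV[R]_m => (\prod_(i < m) g (x ord0 i))%:E).
  apply/measurable_EFinP.
  by apply: measurable_prod => i _; apply: measurableT_comp => //; exact: measurable_coord.
have Ig : (\int[lebesgue_measure]_s (g s)%:E = (\int[lebesgue_measure]_s g s)%:E)%E.
  by rewrite /Rintegral fineK//; exact: integrable_fin_num.
elim: n => [|n IH].
  rewrite ge0_integral_rV0; last exact: mp.
  by rewrite big_ord0 expr0.
rewrite (@ge0_integral_rV_cons _ _ (fun x => (\prod_(i < n.+1) g (x ord0 i))%:E)); first last.
- by move=> x; rewrite lee_fin prodr_ge0.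
- exact: mp.
have E (s : R) : (\int[lebesgue_rV n]_y
    (\prod_(i < n.+1) g (rV_cons (s, y) ord0 i))%:E =
    ((\int[lebesgue_measure]_s g s) ^+ n)%:E * (g s)%:E)%E.
  rewrite muleC -IH -(@ge0_integralZl_EFin _ _ _ (lebesgue_rV n) _ measurableT
    (fun x : 'rV[R]_n => (\prod_(i < n) g (x ord0 i))%:E))//; first last.
  - exact: mp.
  - by move=> x _; rewrite lee_fin prodr_ge0.
  apply: eq_integral => y _; rewrite big_ord_recl rV_cons0 -EFinM; congr (_ * _)%:E.
  by apply: eq_bigr => i _; rewrite rV_consS.
under eq_integral do rewrite E.
rewrite (@ge0_integralZl_EFin _ _ R lebesgue_measure _ measurableT (EFin \o g))//.
- by rewrite Ig -EFinM exprSr.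
- by move=> x _; rewrite lee_fin.
- exact/measurable_EFinP.
- by rewrite exprn_ge0// Rintegral_ge0.
Qed.

Lemma integrable_rV_prod (R : realType) n (g : R -> R) :
  (forall s, 0 <= g s) -> lebesgue_measure.-integrable setT (EFin \o g) ->
  (lebesgue_rV n).-integrable setT
    (EFin \o fun x : 'rV[R]_n => \prod_(i < n) g (x ord0 i)).
Proof.
move=> g0 ig; apply/integrableP; split.
  apply/measurable_EFinP; apply: measurable_prod => i _.
  apply: measurableT_comp; last exact: measurable_coord.
  by apply/measurable_EFinP; exact: measurable_int ig.
under eq_integral do rewrite /= ger0_norm ?prodr_ge0//.
by rewrite integral_rV_prod// ltry.
Qed.

(** Up to the factor 2^n this is [pkernel] at [e = 1]. The same function thus serves as the kernel
    of an approximate identity and as the majorant that measures decay. *)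
Definition decay {R : realType} {n} (x : 'rV[R]_n) : R :=
  \prod_(i < n) (1 + x ord0 i ^+ 2)^-1.

Lemma decay_gt0 (R : realType) n (x : 'rV[R]_n) : 0 < decay x.
Proof. by apply: prodr_gt0 => i _; rewrite invr_gt0 ltr_pwDl// sqr_ge0. Qed.

Lemma decay_le1 (R : realType) n (x : 'rV[R]_n) : decay x <= 1.
Proof.
apply: prodr_ile1 => i _; rewrite invr_ge0 addr_ge0 ?sqr_ge0//=.
by rewrite invf_le1 ?lerDl ?sqr_ge0// ltr_pwDl// sqr_ge0.
Qed.

Lemma integrable_decay (R : realType) n :
  (lebesgue_rV n).-integrable setT (EFin \o @decay R n).
Proof.
have g0 (s : R) : 0 <= (oneDsqr s)^-1 by rewrite invr_ge0.
apply: (@integrable_rV_prod _ _ (fun s => (oneDsqr s)^-1)) => //.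
have cg : continuous (fun s : R => (oneDsqr s)^-1) by exact: continuous_oneDsqrV.
apply/integrableP; split.
  by apply/measurable_EFinP; exact: continuous_measurable_fun.
under eq_integral do rewrite /= ger0_norm//.
rewrite (@ge0_symfun_integralT _ (fun s => (oneDsqr s)^-1))//; last first.
  by move=> s; rewrite /oneDsqr/= sqrrN.
by rewrite -set_itvcy integral0y_oneDsqr -EFinM ltry.
Qed.

(** * Fubini and affine changes of variables for real integrals *)

Lemma integrable_dominated d (T : measurableType d) (R : realType)
    (mu : {measure set T -> \bar R}) (f g : T -> R) :
  measurable_fun setT f -> (forall x, `|f x| <= `|g x|) ->
  mu.-integrable setT (EFin \o g) -> mu.-integrable setT (EFin \o f).
Proof.
move=> mf fg; apply: le_integrable => //; first exact/measurable_EFinP.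
by move=> x _; rewrite lee_fin.
Qed.

Lemma EFin_Rintegral d (T : measurableType d) (R : realType)
    (mu : {measure set T -> \bar R}) (f : T -> R) :
  mu.-integrable setT (EFin \o f) ->
  (\int[mu]_x f x)%:E = (\int[mu]_x (f x)%:E)%E.
Proof. by move=> fi; rewrite /Rintegral fineK//; exact: integrable_fin_num. Qed.

Section integrable_real.
Context d (T : measurableType d) (R : realType).
Variable mu : {measure set T -> \bar R}.
Implicit Types f g : T -> R.

Lemma integrable_RZl (k : R) f : mu.-integrable setT (EFin \o f) ->
  mu.-integrable setT (EFin \o fun x => k * f x).
Proof. exact: integrableZl. Qed.

Lemma integrable_RD f g : mu.-integrable setT (EFin \o f) ->
  mu.-integrable setT (EFin \o g) ->
  mu.-integrable setT (EFin \o fun x => f x + g x).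
Proof. exact: integrableD. Qed.

Lemma integrable_RB f g : mu.-integrable setT (EFin \o f) ->
  mu.-integrable setT (EFin \o g) ->
  mu.-integrable setT (EFin \o fun x => f x - g x).
Proof. exact: integrableB. Qed.

End integrable_real.

Section fubini.
Context d1 d2 (T1 : measurableType d1) (T2 : measurableType d2) (R : realType).
Variables (m1 : {sigma_finite_measure set T1 -> \bar R}).
Variables (m2 : {sigma_finite_measure set T2 -> \bar R}).
Variables (F : T1 * T2 -> R) (f1 : T1 -> R) (f2 : T2 -> R).
Hypothesis mF : measurable_fun setT F.
Hypothesis if1 : m1.-integrable setT (EFin \o f1).
Hypothesis if2 : m2.-integrable setT (EFin \o f2).
Hypothesis Ff : forall x y, `|F (x, y)| <= `|f1 x| * `|f2 y|.

Lemma integrable_prod_dominated :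
  (m1 \x m2)%E.-integrable setT (EFin \o F).
Proof.
have mf1 := measurable_int _ if1; have mf2 := measurable_int _ if2.
apply/integrable12ltyP; first exact/measurable_EFinP.
have A1 : (\int[m1]_x `|(f1 x)%:E| < +oo)%E by move/integrableP : if1 => [].
have A2 : (\int[m2]_x `|(f2 x)%:E| < +oo)%E by move/integrableP : if2 => [].
have n2 : (\int[m2]_x `|(f2 x)%:E|)%E \is a fin_num.
  by rewrite ge0_fin_numE// integral_ge0.
have n1 : (\int[m1]_x `|(f1 x)%:E|)%E \is a fin_num.
  by rewrite ge0_fin_numE// integral_ge0.
have mE : measurable_fun setT (fun p => `|(F p)%:E|%E).
  by apply: measurableT_comp => //; exact/measurable_EFinP.
apply: (@le_lt_trans _ _
    (\int[m1]_x (\int[m2]_y `|(f2 y)%:E| * `|(f1 x)%:E|))%E).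
  apply: ge0_le_integral => //.
  - by move=> x _; exact: integral_ge0.
  - exact: (measurable_fun_fubini_tonelli_F (fun p => `|(F p)%:E|%E)).
  - apply: emeasurable_funM => //.
    exact: measurableT_comp.
  - move=> x _; rewrite muleC -ge0_integralZl//.
    + apply: ge0_le_integral => //.
      * by apply: (measurableT_comp mE); exact: measurable_pair1.
      * apply: emeasurable_funM => //; exact: measurableT_comp.
      * by move=> y _; rewrite /= -EFinM lee_fin.
    + exact: measurableT_comp.
rewrite -(fineK n2) ge0_integralZl//.
- by rewrite -(fineK n1) -EFinM ltry.
- exact: measurableT_comp.
- by rewrite lee_fin fine_ge0// integral_ge0.
Qed.

Let mFx x : measurable_fun setT (fun y => F (x, y)).
Proof. by apply: (measurableT_comp mF); exact: measurable_pair1. Qed.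

Let mFy y : measurable_fun setT (fun x => F (x, y)).
Proof. by apply: (measurableT_comp mF); exact: measurable_pair2. Qed.

Let iFx x : m2.-integrable setT (EFin \o fun y => F (x, y)).
Proof.
apply: (@integrable_dominated _ _ _ _ _ (fun y => `|f1 x| * f2 y)) => //.
  by move=> y; rewrite normrM normr_id.
have -> : EFin \o (fun y => `|f1 x| * f2 y) =
  (fun y => `|f1 x|%:E * (EFin \o f2) y)%E by apply/funext.
exact: integrableZl.
Qed.

Let iFy y : m1.-integrable setT (EFin \o fun x => F (x, y)).
Proof.
apply: (@integrable_dominated _ _ _ _ _ (fun x => `|f2 y| * f1 x)) => //.
  by move=> x; rewrite normrM normr_id mulrC.
have -> : EFin \o (fun x => `|f2 y| * f1 x) =
  (fun x => `|f2 y|%:E * (EFin \o f1) x)%E by apply/funext.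
exact: integrableZl.
Qed.

Lemma integrable_Rintegral1 :
  m1.-integrable setT (EFin \o fun x => \int[m2]_y F (x, y)).
Proof.
have := integrable_fubini_F integrable_prod_dominated.
rewrite (_ : fubini_F _ _ = EFin \o fun x => \int[m2]_y F (x, y))//.
by apply/funext => x; rewrite /= EFin_Rintegral.
Qed.

Lemma Rintegral_prod1 :
  \int[(m1 \x m2)%E]_p F p = \int[m1]_x \int[m2]_y F (x, y).
Proof.
rewrite /Rintegral -(integral12_prod_meas1 integrable_prod_dominated).
congr fine; apply: eq_integral => x _.
by rewrite fineK//; exact: (integrable_fin_num measurableT (iFx x)).
Qed.

Lemma Rintegral_prod2 :
  \int[(m1 \x m2)%E]_p F p = \int[m2]_y \int[m1]_x F (x, y).
Proof.
rewrite /Rintegral -(integral21_prod_meas1 integrable_prod_dominated).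
congr fine; apply: eq_integral => y _.
by rewrite fineK//; exact: (integrable_fin_num measurableT (iFy y)).
Qed.

Lemma Rintegral_exchange :
  \int[m1]_x \int[m2]_y F (x, y) = \int[m2]_y \int[m1]_x F (x, y).
Proof. by rewrite -Rintegral_prod1 Rintegral_prod2. Qed.

End fubini.

Section affine.
Context {R : realType} {n : nat}.
Implicit Types f : 'rV[R]_n -> R.

Lemma integrable_rV_affine (c : R) (b : 'rV[R]_n) f : c != 0 ->
  (lebesgue_rV n).-integrable setT (EFin \o f) ->
  (lebesgue_rV n).-integrable setT (EFin \o fun x => f (c *: x + b)).
Proof.
move=> c0 /integrableP[/measurable_EFinP mf fi]; apply/integrableP; split.
  apply/measurable_EFinP; apply: measurableT_comp => //.
  exact: measurable_rV_affine.
rewrite (@ge0_integral_rV_affine _ _ _ _ (fun x => `|(f x)%:E|%E))//.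
  rewrite -(@fineK _ (\int[_]_x _)%E) -?EFinM ?ltry// ge0_fin_numE ?integral_ge0//.
by apply: measurableT_comp => //; exact/measurable_EFinP.
Qed.

Lemma Rintegral_rV_affine (c : R) (b : 'rV[R]_n) f : c != 0 ->
  (lebesgue_rV n).-integrable setT (EFin \o f) ->
  \int[lebesgue_rV n]_x f (c *: x + b) = `|c| ^- n * \int[lebesgue_rV n]_x f x.
Proof.
move=> c0 fi; have mf := measurable_int _ fi.
apply: EFin_inj; rewrite EFinM !EFin_Rintegral//; last exact: integrable_rV_affine.
have mp := measurable_funepos mf; have mn := measurable_funeneg mf.
have Ep := @ge0_integral_rV_affine _ _ _ b _ c0 mp (funepos_ge0 _).
have En := @ge0_integral_rV_affine _ _ _ b _ c0 mn (funeneg_ge0 _).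
rewrite [LHS]integralE [X in (_ * X)%E]integralE.
rewrite muleBr//; last exact: integrable_add_def.
congr (_ - _)%E; [apply: etrans Ep|apply: etrans En]; apply: eq_integral => x _.
  by rewrite !funeposE.
by rewrite !funenegE.
Qed.

Lemma Rintegral_rV_odd f : (forall x, f (- x) = - f x) ->
  (lebesgue_rV n).-integrable setT (EFin \o f) -> \int[lebesgue_rV n]_x f x = 0.
Proof.
move=> of1 fi.
have := @Rintegral_rV_affine (-1) 0 f (ltac:(by rewrite oppr_eq0 oner_eq0)) fi.
rewrite normrN1 expr1n invr1 mul1r.
under eq_Rintegral do rewrite scaleN1r addr0 of1.
have -> : \int[lebesgue_rV n]_x (- f x) = - \int[lebesgue_rV n]_x f x.
  under eq_Rintegral do rewrite -mulN1r.
  by rewrite RintegralZl// mulN1r.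
by move=> H; lra.
Qed.

End affine.

(** * The Poisson weight *)

(** The fundamental theorem on a half-line is used for nonnegative integrands, whereas the cosine
    changes sign; adding 1 repairs this. The cosine integral is later the difference of the cases
    [b = 1] and [b = 0]. *)
Lemma poisson_half (R : realType) (e x b : R) : 0 < e -> 0 <= b <= 1 ->
  (\int[lebesgue_measure]_(s in `[0%R, +oo[)
     (expR (- (e * s)) * (1 + b * cos (x * s)))%:E =
   (e^-1 + b * (e / (e ^+ 2 + x ^+ 2)))%:E)%E.
Proof.
move=> e0 /andP[b0 b1].
have ex0 : e ^+ 2 + x ^+ 2 != 0 by rewrite gt_eqF// ltr_pwDl ?exprn_gt0// sqr_ge0.
pose F (s : R) := expR (- (e * s)) *
  (- e^-1 + b * ((- (e * cos (x * s)) + x * sin (x * s)) / (e ^+ 2 + x ^+ 2))).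
pose f (s : R) := expR (- (e * s)) * (1 + b * cos (x * s)).
have dF (s : R) : is_derive s 1 F (f s).
  rewrite /F /f; apply: is_derive_eq.
  rewrite /GRing.scale/=; field.
  by rewrite ex0 gt_eqF.
have df (s : R) : derivable f s 1.
  by apply: ex_derive.
have dF' (s : R) : derivable F s 1 by apply: ex_derive.
have cE : expR (- (e * s)) @[s --> +oo] --> (0 : R).
  apply: (@cvg_comp _ _ _ ( *%R e) (fun s => expR (- s)) +oo%R +oo%R).
    exact: gt0_cvgMry.
  exact: cvgr_expR.
rewrite (@ge0_continuous_FTC2y _ f F 0 0).
- rewrite -EFinD /F !mulr0 cos0 sin0 oppr0 expR0; congr (_%:E); field.
  by rewrite ex0 gt_eqF.
- move=> s s0; rewrite mulr_ge0 ?expR_ge0//.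
  rewrite -lerBlDl sub0r (@le_trans _ _ (- b))// ?lerN2//.
  by rewrite -mulrN1 ler_wpM2l// cos_geN1.
- apply: continuous_subspaceT => s.
  by apply: differentiable_continuous; exact/derivable1_diffP.
(* The primitive is a bounded trigonometric factor times a decaying exponential; [M] bounds the
   former, so the boundary term at infinity vanishes. *)
- pose M := e^-1 + `|b / (e ^+ 2 + x ^+ 2)| * (e + `|x|).
  have cM c : c * expR (- (e * s)) @[s --> +oo] --> (0 : R).
    by rewrite -(mulr0 c); apply: cvgMr.
  have FM s : `|F s| <= M * expR (- (e * s)).
    rewrite /F normrM ger0_norm ?expR_ge0// mulrC ler_wpM2r ?expR_ge0//.
    rewrite (le_trans (ler_normD _ _))// normrN (@gtr0_norm _ e^-1) ?invr_gt0//.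
    rewrite /M lerD2l mulrA -mulrAC normrM ler_wpM2l//.
    rewrite (le_trans (ler_normD _ _))// normrN !normrM (gtr0_norm e0) lerD//.
      by rewrite ler_piMr ?(ltW e0)// ler_norml cos_geN1 cos_le1.
    by rewrite ler_piMr// ler_norml sin_geN1 sin_le1.
  apply: (@squeeze_cvgr _ _ _ _ (fun s => - M * expR (- (e * s)))
    (fun s => M * expR (- (e * s)))) => //.
  by apply: nearW => s; rewrite mulNr -ler_norml.
- by move=> s _.
- apply: cvg_at_right_filter; apply: differentiable_continuous; exact/derivable1_diffP.
- by move=> s _; rewrite derive1E; apply: derive_val.
Qed.

Section poisson.
Context {R : realType}.
Implicit Types (e : R) (n : nat).

(** The two-sided exponential is chosen because its product with a cosine has an elementary
    primitive and its transform is rational. *)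
Definition pweight1 e (s : R) : R := expR (- (e * `|s|)).

Lemma pweight1_gt0 e s : 0 < pweight1 e s.
Proof. exact: expR_gt0. Qed.

Lemma continuous_pweight1 e : continuous (pweight1 e).
Proof.
move=> s; rewrite /pweight1.
apply: continuous_cvg; first exact: continuous_expR.
by apply: cvgN; apply: cvgM; [exact: cvg_cst|exact: norm_continuous].
Qed.

Lemma continuous_pweight1_cos e x b :
  continuous (fun s => pweight1 e s * (1 + b * cos (x * s))).
Proof.
move=> s; apply: cvgM; first exact: continuous_pweight1.
apply: cvgD; [exact: cvg_cst|apply: cvgM; first exact: cvg_cst].
apply: continuous_cvg; first exact: continuous_cos.
by apply: cvgM; [exact: cvg_cst|exact: cvg_id].
Qed.

Lemma integral_pweight1_cos_ge0 e x b : 0 < e -> 0 <= b <= 1 ->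
  (\int[lebesgue_measure]_s (pweight1 e s * (1 + b * cos (x * s)))%:E =
   (2 * (e^-1 + b * (e / (e ^+ 2 + x ^+ 2))))%:E)%E.
Proof.
move=> e0 /andP[b0 b1].
rewrite (@ge0_symfun_integralT _ (fun s => pweight1 e s * (1 + b * cos (x * s)))).
- rewrite EFinM -poisson_half ?b0//; congr (_ * _)%E.
  rewrite -set_itvcy; apply: eq_integral => s.
  by rewrite inE/= in_itv/= andbT => s0; rewrite /pweight1 ger0_norm.
- move=> s; rewrite mulr_ge0 ?(ltW (pweight1_gt0 _ _))//.
  rewrite -lerBlDl sub0r (@le_trans _ _ (- b))// ?lerN2//.
  by rewrite -mulrN1 ler_wpM2l// cos_geN1.
- exact: continuous_pweight1_cos.
- by move=> s; rewrite /= /pweight1 normrN mulrN cosN.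
Qed.

Lemma integral_pweight1 e : 0 < e ->
  (\int[lebesgue_measure]_s (pweight1 e s)%:E = (2 * e^-1)%:E)%E.
Proof.
move=> e0; have := @integral_pweight1_cos_ge0 e 0 0 e0 (ltac:(by rewrite lexx ler01)).
rewrite mul0r addr0 => <-.
by apply: eq_integral => s _; rewrite mul0r addr0 mulr1.
Qed.

Lemma integrable_pweight1 e : 0 < e ->
  lebesgue_measure.-integrable setT (EFin \o pweight1 e).
Proof.
move=> e0; apply/integrableP; split.
  by apply/measurable_EFinP; apply: continuous_measurable_fun; exact: continuous_pweight1.
under eq_integral do rewrite /= (gtr0_norm (pweight1_gt0 _ _)).
by rewrite integral_pweight1// ltry.
Qed.

Lemma Rintegral_pweight1_cos e x : 0 < e ->
  \int[lebesgue_measure]_s (pweight1 e s * cos (x * s)) =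
  2 * e / (e ^+ 2 + x ^+ 2).
Proof.
move=> e0.
have i1 := integrable_pweight1 e0.
have i2 : lebesgue_measure.-integrable setT
    (EFin \o (fun s => pweight1 e s * (1 + 1 * cos (x * s)))).
  apply: (@integrable_dominated _ (measurableTypeR R) _ _ _ (fun s => 2 * pweight1 e s)).
  - by apply: continuous_measurable_fun; exact: continuous_pweight1_cos.
  - move=> s; rewrite !normrM mulrC ler_wpM2r// mul1r.
    rewrite (le_trans (ler_normD _ _))// normr1 [leRHS]ger0_norm//.
    by rewrite -[leRHS]/(1 + 1) lerD2l ler_norml cos_geN1 cos_le1.
  - exact: integrable_RZl.
under eq_Rintegral => s _.
  rewrite (_ : _ * _ = pweight1 e s * (1 + 1 * cos (x * s)) - pweight1 e s); last by ring.
  over.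
rewrite RintegralB// /Rintegral.
rewrite integral_pweight1// integral_pweight1_cos_ge0 ?ler01 ?lexx//=.
by ring.
Qed.

Definition pweight e n (x : 'rV[R]_n) : R := \prod_(i < n) pweight1 e (x ord0 i).

(** The transform of [pweight]: in each coordinate an unnormalised Poisson kernel, concentrating at
    0 as [e] tends to 0. *)
Definition pkernel e n (z : 'rV[R]_n) : R :=
  \prod_(i < n) (2 * e / (e ^+ 2 + z ord0 i ^+ 2)).

Lemma pweight_ge0 e n (x : 'rV[R]_n) : 0 <= pweight e x.
Proof. by apply: prodr_ge0 => i _; exact/ltW/pweight1_gt0. Qed.

Lemma integrable_pweight e n : 0 < e ->
  (lebesgue_rV n).-integrable setT (EFin \o @pweight e n).
Proof.
move=> e0; apply: integrable_rV_prod; last exact: integrable_pweight1.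
by move=> s; exact/ltW/pweight1_gt0.
Qed.

Lemma measurable_dotl n (z : 'rV[R]_n) : measurable_fun setT (dot z).
Proof. exact: (measurableT_comp (@measurable_dot R n) (measurable_pair1 z)). Qed.

Lemma dotNr n (z x : 'rV[R]_n) : dot z (- x) = - dot z x.
Proof. by rewrite /dot -sumrN; apply: eq_bigr => i _; rewrite mxE mulrN. Qed.

Lemma dot_rV_cons n (z : 'rV[R]_n.+1) (s : R) (y : 'rV[R]_n) :
  dot z (rV_cons (s, y)) =
  z ord0 ord0 * s + dot (\row_j z ord0 (lift ord0 j)) y.
Proof.
rewrite /dot big_ord_recl rV_cons0; congr (_ + _).
by apply: eq_bigr => i _; rewrite rV_consS mxE.
Qed.

Lemma pweight_rV_cons e n (s : R) (y : 'rV[R]_n) :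
  pweight e (rV_cons (s, y)) = pweight1 e s * pweight e y.
Proof.
rewrite /pweight big_ord_recl rV_cons0; congr (_ * _).
by apply: eq_bigr => i _; rewrite rV_consS.
Qed.

Lemma integrable_pweightM e n (g : 'rV[R]_n -> R) : 0 < e ->
  measurable_fun setT g -> (forall x, `|g x| <= 1) ->
  (lebesgue_rV n).-integrable setT (EFin \o fun x => pweight e x * g x).
Proof.
move=> e0 mg g1; have iw := integrable_pweight n e0.
apply: (integrable_dominated _ _ iw).
  apply: measurable_funM => //.
  by apply/measurable_EFinP; exact: measurable_int iw.
by move=> x; rewrite normrM ler_piMr.
Qed.

Lemma norm_cos_le1 (t : R) : `|cos t| <= 1.
Proof. by rewrite ler_norml cos_geN1 cos_le1. Qed.

Lemma norm_sin_le1 (t : R) : `|sin t| <= 1.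
Proof. by rewrite ler_norml sin_geN1 sin_le1. Qed.

Lemma measurable_cos (d : measure_display) (T : measurableType d) (f : T -> R) :
  measurable_fun setT f -> measurable_fun setT (fun x => cos (f x)).
Proof.
move=> mf; apply: (measurableT_comp (f := @cos R)) => //.
by apply: continuous_measurable_fun; exact: continuous_cos.
Qed.

Lemma measurable_sin (d : measure_display) (T : measurableType d) (f : T -> R) :
  measurable_fun setT f -> measurable_fun setT (fun x => sin (f x)).
Proof.
move=> mf; apply: (measurableT_comp (f := @sin R)) => //.
by apply: continuous_measurable_fun; exact: continuous_sin.
Qed.

Lemma Rintegral_pweight_sin e n (z : 'rV[R]_n) : 0 < e ->
  \int[lebesgue_rV n]_x (pweight e x * sin (dot z x)) = 0.
Proof.
move=> e0; apply: Rintegral_rV_odd.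
  move=> x; rewrite dotNr sinN mulrN; congr (- (_ * _)).
  by apply: eq_bigr => i _; rewrite mxE /pweight1 normrN.
apply: integrable_pweightM => //; last by move=> x; exact: norm_sin_le1.
by apply: measurable_sin; exact: measurable_dotl.
Qed.

(** Induction by the addition formula for the cosine: the product of the two sines integrates to 0
    because the weight is even, and the product of the cosines factorises. *)
Lemma Rintegral_pweight_cos e n (z : 'rV[R]_n) : 0 < e ->
  \int[lebesgue_rV n]_x (pweight e x * cos (dot z x)) = pkernel e z.
Proof.
move=> e0; elim: n z => [|n IH] z.
  rewrite /Rintegral ge0_integral_rV0.
    by rewrite /pweight /pkernel /dot !big_ord0 cos0 mulr1.
  apply/measurable_EFinP; apply: measurable_funM.
    apply/measurable_EFinP; exact: measurable_int (integrable_pweight 0 e0).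
  by apply: measurable_cos; exact: measurable_dotl.
have mc m (u : 'rV[R]_m) : (lebesgue_rV m).-integrable setT
    (EFin \o (fun x => pweight e x * cos (dot u x))).
  apply: integrable_pweightM => //; last by move=> x; exact: norm_cos_le1.
  by apply: measurable_cos; exact: measurable_dotl.
have ms m (u : 'rV[R]_m) : (lebesgue_rV m).-integrable setT
    (EFin \o (fun x => pweight e x * sin (dot u x))).
  apply: integrable_pweightM => //; last by move=> x; exact: norm_sin_le1.
  by apply: measurable_sin; exact: measurable_dotl.
pose z' := \row_j z ord0 (lift ord0 j).
pose z0 := z ord0 ord0.
rewrite /Rintegral (integral_rV_cons (mc _ z)).
have E s : (\int[lebesgue_rV n]_y
    (pweight e (rV_cons (s, y)) * cos (dot z (rV_cons (s, y))))%:E =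
    (pkernel e z' * (pweight1 e s * cos (z0 * s)))%:E)%E.
  transitivity ((\int[lebesgue_rV n]_y
      (pweight1 e s * cos (z0 * s) * (pweight e y * cos (dot z' y)) -
       pweight1 e s * sin (z0 * s) * (pweight e y * sin (dot z' y))))%:E).
    rewrite EFin_Rintegral; last first.
      apply: integrable_RB.
        exact: integrable_RZl (mc n z').
      exact: integrable_RZl (ms n z').
    apply: eq_integral => y _ /=.
    by rewrite pweight_rV_cons dot_rV_cons cosD; congr (_%:E); rewrite -/z' -/z0; ring.
  congr (_%:E); rewrite RintegralB//; last first.
  - exact: integrable_RZl (ms n z').
  - exact: integrable_RZl (mc n z').
  rewrite !RintegralZl// IH Rintegral_pweight_sin//.
  by ring.
transitivity (\int[lebesgue_measure]_s
    (pkernel e z' * (pweight1 e s * cos (z0 * s)))).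
  by rewrite /Rintegral; congr fine; apply: eq_integral => s _; exact: E.
rewrite RintegralZl//; last first.
  apply: (integrable_dominated _ _ (integrable_pweight1 e0)).
  - apply: measurable_funM.
      by apply: continuous_measurable_fun; exact: continuous_pweight1.
    by apply: measurable_cos; exact: measurable_funM.
  - by move=> s; rewrite normrM ler_piMr// norm_cos_le1.
rewrite Rintegral_pweight1_cos// [in RHS]/pkernel big_ord_recl mulrC; congr (_ * _).
by apply: eq_bigr => i _; rewrite mxE.
Qed.

End poisson.

(** * The Hartley transform *)

Section hartley.
Context {R : realType} {n : nat}.
Implicit Types h : 'rV[R]_n -> R.
Local Notation mu := (lebesgue_rV n).
Local Notation intg h := (mu.-integrable setT (EFin \o h)).

Definition cas (a : R) : R := cos a + sin a.

Lemma norm_cas (a : R) : `|cas a| <= 2.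
Proof.
by rewrite (le_trans (ler_normD _ _))// -[leRHS]/(1 + 1) lerD ?norm_cos_le1 ?norm_sin_le1.
Qed.

(** This identity is what makes the kernel work: against an even weight the sine of the sum
    integrates to 0, and a function of the difference remains, as for complex exponentials. *)
Lemma casM (a b : R) : cas a * cas b = cos (a - b) + sin (a + b).
Proof. by rewrite cosB sinD /cas; ring. Qed.

Lemma dotC (x y : 'rV[R]_n) : dot x y = dot y x.
Proof. by apply: eq_bigr => i _; rewrite mulrC. Qed.

Lemma dotDl (x y z : 'rV[R]_n) : dot (x + y) z = dot x z + dot y z.
Proof. by rewrite /dot -big_split; apply: eq_bigr => i _; rewrite mxE mulrDl. Qed.

Lemma dotNl (x z : 'rV[R]_n) : dot (- x) z = - dot x z.
Proof. by rewrite dotC dotNr dotC. Qed.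

Definition hartley h (xi : 'rV[R]_n) : R :=
  \int[mu]_x (cas (dot x xi) * h x).

Lemma measurable_cas (d : measure_display) (T : measurableType d) (f : T -> R) :
  measurable_fun setT f -> measurable_fun setT (fun x => cas (f x)).
Proof.
by move=> mf; apply: measurable_funD; [exact: measurable_cos|exact: measurable_sin].
Qed.

Lemma measurable_cas_dot : measurable_fun setT
  (fun p : 'rV[R]_n * 'rV[R]_n => cas (dot p.1 p.2)).
Proof. by apply: measurable_cas; exact: measurable_dot. Qed.

Lemma measurable_intg h : intg h -> measurable_fun setT h.
Proof. by move=> ih; apply/measurable_EFinP; exact: measurable_int ih. Qed.

Lemma intg_cas h (xi : 'rV[R]_n) : intg h -> intg (fun x => cas (dot x xi) * h x).
Proof.
move=> ih; apply: (integrable_dominated (g := fun x => 2 * h x)).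
- apply: measurable_funM; last exact: measurable_intg.
  by apply: measurable_cas; under eq_fun do rewrite dotC; exact: measurable_dotl.
- by move=> x; rewrite !normrM [`|2|]ger0_norm// ler_wpM2r// norm_cas.
- exact: integrable_RZl.
Qed.

Lemma norm_hartley h (xi : 'rV[R]_n) : intg h ->
  `|hartley h xi| <= 2 * \int[mu]_x `|h x|.
Proof.
move=> ih; have ic := intg_cas xi ih.
apply: (le_trans (le_normr_Rintegral measurableT ic)).
rewrite -RintegralZl//; last exact: integrable_norm.
apply: le_Rintegral => //.
- exact: (integrable_norm ic).
- apply: integrable_RZl; exact: (integrable_norm ih).
- by move=> x _; rewrite normrM ler_wpM2r// norm_cas.
Qed.

Lemma measurable_pweight e : measurable_fun setT (@pweight R e n).
Proof.
apply: measurable_prod => i _; apply: measurableT_comp; last exact: measurable_coord.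
by apply: continuous_measurable_fun; exact: continuous_pweight1.
Qed.

Lemma pweightN e (x : 'rV[R]_n) : pweight (- e) x * pweight e x = 1.
Proof.
rewrite -big_split big1// => i _ /=.
by rewrite /pweight1 mulNr opprK expRN divff// gt_eqF// expR_gt0.
Qed.

(** Fubini yields measurability of a parametrised integral once the integrand is integrable on the
    product. The weight [pweight 1] in the frequency makes it so and is divided out afterwards, its
    inverse being [pweight (- 1)]. *)
Lemma measurable_hartley h : intg h -> measurable_fun setT (hartley h).
Proof.
move=> ih; have mh := measurable_intg ih.
pose F (p : 'rV[R]_n * 'rV[R]_n) := pweight 1 p.1 * (cas (dot p.2 p.1) * h p.2).
have mF : measurable_fun setT F.
  apply: measurable_funM.
    exact: measurableT_comp (measurable_pweight _) measurable_fst.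
  apply: measurable_funM; last exact: measurableT_comp mh measurable_snd.
  by under eq_fun do rewrite dotC; exact: measurable_cas_dot.
have iF : (mu \x mu)%E.-integrable setT (EFin \o F).
  apply: (integrable_prod_dominated mF (integrable_pweight n ltr01) (integrable_RZl 2 ih)).
  move=> x y; rewrite /F/= !normrM [`|2|]ger0_norm// ler_wpM2l//.
  by rewrite ler_wpM2r// norm_cas.
have := measurable_fubini_F iF.
rewrite (_ : fubini_F _ _ = EFin \o (fun xi => pweight 1 xi * hartley h xi)); last first.
  apply/funext => xi; rewrite /fubini_F/= /hartley -RintegralZl//; last exact: intg_cas.
  by rewrite EFin_Rintegral//; apply: integrable_RZl; exact: intg_cas.
move=> /measurable_EFinP mH.
rewrite (_ : hartley h = fun xi => pweight (- 1) xi * (pweight 1 xi * hartley h xi)).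
  by apply: measurable_funM => //; exact: measurable_pweight.
by apply/funext => xi; rewrite mulrA pweightN mul1r.
Qed.

Lemma Rintegral_pweight_cas e (x y : 'rV[R]_n) : 0 < e ->
  \int[mu]_xi (pweight e xi * (cas (dot x xi) * cas (dot y xi))) = pkernel e (x - y).
Proof.
move=> e0; under eq_Rintegral do rewrite casM -dotNl -!dotDl mulrDr.
rewrite RintegralD//.
- by rewrite Rintegral_pweight_cos// Rintegral_pweight_sin// addr0.
- apply: integrable_pweightM => //; last by move=> z; exact: norm_cos_le1.
  by apply: measurable_cos; exact: measurable_dotl.
- apply: integrable_pweightM => //; last by move=> z; exact: norm_sin_le1.
  by apply: measurable_sin; exact: measurable_dotl.
Qed.

Lemma intg_pweight_hartley e h : 0 < e -> intg h ->
  intg (fun xi => pweight e xi * hartley h xi).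
Proof.
move=> e0 ih; set B := 2 * \int[mu]_x `|h x|.
apply: (integrable_dominated (g := fun xi => B * pweight e xi)).
- by apply: measurable_funM; [exact: measurable_pweight|exact: measurable_hartley].
- move=> x; rewrite mulrC !normrM ler_wpM2r//.
  apply: (le_trans (norm_hartley x ih)).
  by rewrite -normrM ler_norm.
- by apply: integrable_RZl; exact: integrable_pweight.
Qed.

(** Abel-summed inversion: the weight makes the double integral absolutely convergent, and the inner
    frequency integral is then [Rintegral_pweight_cas]. *)
Lemma pweight_hartley_kernel e h (x : 'rV[R]_n) : 0 < e -> intg h ->
  \int[mu]_xi (pweight e xi * cas (dot x xi) * hartley h xi) =
  \int[mu]_y (h y * pkernel e (x - y)).
Proof.
move=> e0 ih; have mh := measurable_intg ih.
pose F (p : 'rV[R]_n * 'rV[R]_n) :=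
  pweight e p.1 * cas (dot x p.1) * (cas (dot p.2 p.1) * h p.2).
transitivity (\int[mu]_xi \int[mu]_y F (xi, y)).
  apply: eq_Rintegral => xi _; rewrite -RintegralZl//; exact: intg_cas.
rewrite (Rintegral_exchange (f1 := fun xi => 2 * pweight e xi) (f2 := fun y => 2 * h y)).
- apply: eq_Rintegral => y _; rewrite -Rintegral_pweight_cas// -RintegralZl//.
    by apply: eq_Rintegral => xi _; rewrite /F/=; ring.
  apply: (integrable_dominated (g := fun xi => 4 * pweight e xi)).
  + apply: measurable_funM; first exact: measurable_pweight.
    by apply: measurable_funM; apply: measurable_cas; exact: measurable_dotl.
  + move=> xi; rewrite mulrC !normrM ler_wpM2r// [leRHS]ger0_norm//.
    by rewrite (_ : 4 = 2 * 2 :> R) ?ler_pM ?norm_cas//; ring.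
  + by apply: integrable_RZl; exact: integrable_pweight.
- apply: measurable_funM.
    apply: measurable_funM.
      exact: measurableT_comp (measurable_pweight _) measurable_fst.
    by apply: measurable_cas; exact: measurableT_comp (measurable_dotl x) measurable_fst.
  apply: measurable_funM; last exact: measurableT_comp mh measurable_snd.
  by under eq_fun do rewrite dotC; exact: measurable_cas_dot.
- by apply: integrable_RZl; exact: integrable_pweight.
- exact: integrable_RZl.
- move=> xi y; rewrite /F/= !normrM ler_pM ?mulr_ge0//.
    by rewrite mulrC ler_wpM2r// [leRHS]ger0_norm// norm_cas.
  by rewrite ler_wpM2r// [leRHS]ger0_norm// norm_cas.
Qed.

Lemma pweight_hartley_sqr e h : 0 < e -> intg h ->
  \int[mu]_xi (pweight e xi * hartley h xi ^+ 2) =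
  \int[mu]_x (h x * \int[mu]_y (h y * pkernel e (x - y))).
Proof.
move=> e0 ih; have mh := measurable_intg ih.
have iw := intg_pweight_hartley e0 ih.
pose F (p : 'rV[R]_n * 'rV[R]_n) :=
  pweight e p.1 * hartley h p.1 * (cas (dot p.2 p.1) * h p.2).
transitivity (\int[mu]_xi \int[mu]_y F (xi, y)).
  apply: eq_Rintegral => xi _; rewrite expr2 mulrA {2}/hartley -RintegralZl//.
  exact: intg_cas.
rewrite (Rintegral_exchange (f1 := fun xi => pweight e xi * hartley h xi)
  (f2 := fun y => 2 * h y)) => //.
- apply: eq_Rintegral => y _; rewrite -pweight_hartley_kernel// -RintegralZl//.
    by apply: eq_Rintegral => xi _; rewrite /F/=; ring.
  apply: (integrable_dominated (g := fun xi => 2 * (pweight e xi * hartley h xi))).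
  + apply: measurable_funM; last exact: measurable_hartley.
    apply: measurable_funM; first exact: measurable_pweight.
    by apply: measurable_cas; exact: measurable_dotl.
  + move=> xi; rewrite mulrAC mulrC !normrM ler_wpM2r ?mulr_ge0// [leRHS]ger0_norm//.
    exact: norm_cas.
  + exact: integrable_RZl.
- apply: measurable_funM.
    exact: measurableT_comp (measurable_intg iw) measurable_fst.
  apply: measurable_funM; last exact: measurableT_comp mh measurable_snd.
  by under eq_fun do rewrite dotC; exact: measurable_cas_dot.
- exact: integrable_RZl.
- move=> xi y; rewrite /F/= !normrM ler_pM ?mulr_ge0//.
  by rewrite ler_wpM2r// [leRHS]ger0_norm// norm_cas.
Qed.

End hartley.

(** * Plancherel's identity *)

Section plancherel.
Context {R : realType} {n : nat}.
Implicit Types (h : 'rV[R]_n -> R) (e : R).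
Local Notation mu := (lebesgue_rV n).
Local Notation intg h := (mu.-integrable setT (EFin \o h)).

Lemma pkernel_scale e (z : 'rV[R]_n) : 0 < e ->
  pkernel e (- (e *: z)) = 2 ^+ n * e ^- n * decay z.
Proof.
move=> e0; have -> : 2 ^+ n * e ^- n = \prod_(i < n) (2 * e^-1).
  by rewrite prodr_const card_ord exprMn exprVn.
rewrite -big_split.
apply: eq_bigr => i _; rewrite !mxE /=.
have z0 : 1 + z ord0 i ^+ 2 != 0 by rewrite gt_eqF// ltr_pwDl// sqr_ge0.
have z1 : e ^+ 2 + (- (e * z ord0 i)) ^+ 2 != 0.
  by rewrite gt_eqF// ltr_pwDl ?exprn_gt0// sqr_ge0.
by field; apply/and3P; split=> //; rewrite gt_eqF.
Qed.

Lemma pkernel_ge0 e (z : 'rV[R]_n) : 0 < e -> 0 <= pkernel e z.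
Proof.
move=> e0; apply: prodr_ge0 => i _.
by rewrite divr_ge0 ?mulr_ge0 ?(ltW e0)// addr_ge0 ?sqr_ge0.
Qed.

Lemma pkernelE e (z : 'rV[R]_n) : 0 < e ->
  pkernel e z = 2 ^+ n * e ^- n * decay (- (e^-1 *: z)).
Proof.
move=> e0; rewrite -pkernel_scale// scalerN opprK scalerA mulfV ?scale1r//.
by rewrite gt_eqF.
Qed.

Lemma pkernel_le e (z : 'rV[R]_n) : 0 < e -> pkernel e z <= 2 ^+ n * e ^- n.
Proof.
move=> e0; rewrite pkernelE// ler_piMr ?decay_le1//.
by rewrite mulr_ge0 ?invr_ge0 ?exprn_ge0// ltW.
Qed.

Lemma measurable_decay : measurable_fun setT (@decay R n).
Proof. by apply/measurable_EFinP; exact: measurable_int (integrable_decay R n). Qed.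

Lemma measurable_pkernel e (x : 'rV[R]_n) : 0 < e ->
  measurable_fun setT (fun y : 'rV[R]_n => pkernel e (x - y)).
Proof.
move=> e0; under eq_fun do rewrite pkernelE//.
apply: measurable_funM => //; apply: measurableT_comp; first exact: measurable_decay.
under eq_fun do rewrite scalerBr opprB.
exact: (measurable_rV_affine e^-1 (- (e^-1 *: x))).
Qed.

(** Substitute [y = e *: z + x]. The Jacobian cancels the factor [e ^- n] of [pkernel_scale], so [e]
    survives only inside [h], where continuity can deal with the limit. *)
Lemma pkernel_convolution e h (x : 'rV[R]_n) : 0 < e -> intg h ->
  \int[mu]_y (h y * pkernel e (x - y)) =
  2 ^+ n * \int[mu]_z (h (e *: z + x) * decay z).
Proof.
move=> e0 ih.
have e1 : e ^+ n != 0 by rewrite expf_neq0// gt_eqF.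
have ik : intg (fun y => h y * pkernel e (x - y)).
  apply: (integrable_dominated (g := fun y => 2 ^+ n * e ^- n * h y)).
  - by apply: measurable_funM; [exact: measurable_intg|exact: measurable_pkernel].
  - move=> y; rewrite mulrC [leLHS]normrM [leRHS]normrM ler_wpM2r//.
    rewrite !ger0_norm ?pkernel_le ?pkernel_ge0//.
    by rewrite mulr_ge0 ?invr_ge0 ?exprn_ge0// ltW.
  - exact: integrable_RZl.
have := @Rintegral_rV_affine _ _ e x _ (lt0r_neq0 e0) ik.
rewrite (gtr0_norm e0) => /(congr1 (fun t => e ^+ n * t)).
rewrite mulrA mulfV// mul1r => <-.
have E z : h (e *: z + x) * pkernel e (x - (e *: z + x)) =
    (2 ^+ n * e ^- n) * (h (e *: z + x) * decay z).
  by rewrite opprD addrCA subrr addr0 pkernel_scale//; ring.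
under eq_Rintegral do rewrite E.
rewrite RintegralZl//; first by field.
apply: (integrable_dominated (g := fun z : 'rV[R]_n => h (e *: z + x))).
- apply: measurable_funM; last exact: measurable_decay.
  by apply: measurableT_comp; [exact: measurable_intg|exact: measurable_rV_affine].
- move=> z; rewrite normrM ler_piMr// ger0_norm ?decay_le1//.
  exact/ltW/decay_gt0.
- by apply: integrable_rV_affine => //; rewrite gt_eqF.
Qed.

(** This class contains the Schwartz functions ([schwartz_rapid]) and the products of a symbol with
    a transform ([rapid_symbol_hartley]), so Plancherel's identity is available both before and
    after a multiplier. *)
Definition rapid h := continuous h /\ exists C : R, forall x, `|h x| <= C * decay x.

Lemma rapid_measurable h : rapid h -> measurable_fun setT h.
Proof. by move=> [ch _]; exact: continuous_measurable_rV. Qed.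

Lemma rapid_bound h : rapid h -> exists2 C : R, 0 < C & forall x, `|h x| <= C * decay x.
Proof.
move=> [_ [C hC]]; exists (`|C| + 1) => [|x]; first by rewrite ltr_wpDl.
rewrite (le_trans (hC x))// ler_wpM2r ?(ltW (decay_gt0 x))//.
by rewrite (le_trans (ler_norm C))// lerDl.
Qed.

Lemma rapid_integrable h : rapid h -> intg h.
Proof.
move=> rh; have [C C0 hC] := rapid_bound rh.
apply: (integrable_dominated (g := fun x => C * decay x)).
- exact: rapid_measurable.
- by move=> x; rewrite (le_trans (hC x))// ler_norm.
- by apply: integrable_RZl; exact: integrable_decay.
Qed.

Lemma rapid_sqr_integrable h : rapid h -> intg (fun x => h x ^+ 2).
Proof.
move=> rh; have [C C0 hC] := rapid_bound rh.
apply: (integrable_dominated (g := fun x => C * h x)).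
- by apply: measurable_funX; exact: rapid_measurable.
- move=> x; rewrite expr2 !normrM ler_wpM2r// (gtr0_norm C0) (le_trans (hC x))//.
  by rewrite ler_piMr ?decay_le1// ltW.
- by apply: integrable_RZl; exact: rapid_integrable.
Qed.

Definition decay_mass : R := \int[mu]_x decay x.

Lemma measurable_translation_prod e h : measurable_fun setT h ->
  measurable_fun setT (fun p : 'rV[R]_n * 'rV[R]_n =>
    h p.1 * (h (e *: p.2 + p.1) * decay p.2)).
Proof.
move=> mh; apply: measurable_funM; first exact: measurableT_comp mh measurable_fst.
apply: measurable_funM; last exact: measurableT_comp measurable_decay measurable_snd.
apply: measurableT_comp => //; apply: measurable_rV => i.
under eq_fun do rewrite !mxE.
apply: measurable_funD; last exact: measurableT_comp (measurable_coord i) measurable_fst.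
by apply: measurable_funM => //; exact: measurableT_comp (measurable_coord i) measurable_snd.
Qed.

Lemma translation_prod_dominated e h C (x y : 'rV[R]_n) : (forall x, `|h x| <= C) ->
  `|h x * (h (e *: y + x) * decay y)| <= `|h x| * `|C * decay y|.
Proof.
move=> hC; rewrite !normrM ler_wpM2l// ler_wpM2r// (@ger0_norm _ C) ?hC//.
exact: le_trans (hC x).
Qed.

Lemma rapid_bounded h : rapid h -> exists C : R, forall x, `|h x| <= C.
Proof.
move=> rh; have [C C0 hC] := rapid_bound rh; exists C => x.
by rewrite (le_trans (hC x))// ler_piMr ?decay_le1// ltW.
Qed.

Lemma pweight_hartley_sqr_prod e h : 0 < e -> rapid h ->
  \int[mu]_xi (pweight e xi * hartley h xi ^+ 2) =
  2 ^+ n * \int[(mu \x mu)%E]_p (h p.1 * (h (e *: p.2 + p.1) * decay p.2)).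
Proof.
move=> e0 rh; have ih := rapid_integrable rh; have mh := rapid_measurable rh.
have [C C0 hC] := rapid_bound rh.
have hC' x : `|h x| <= C by rewrite (le_trans (hC x))// ler_piMr ?decay_le1// ltW.
have mF := measurable_translation_prod e mh.
have Fb (x y : 'rV[R]_n) : `|h x * (h (e *: y + x) * decay y)| <=
    `|h x| * `|C * decay y|.
  rewrite !normrM ler_wpM2l// ler_wpM2r// (gtr0_norm C0); exact: hC'.
rewrite pweight_hartley_sqr//.
rewrite (Rintegral_prod1 mF ih (integrable_RZl C (integrable_decay R n)) Fb)/=.
rewrite -RintegralZl//; last first.
  exact: (integrable_Rintegral1 mF ih (integrable_RZl C (integrable_decay R n)) Fb).
apply: eq_Rintegral => x _; rewrite pkernel_convolution//= RintegralZl//.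
  by rewrite mulrCA.
apply: (integrable_dominated (g := fun y => C * decay y)).
- apply: measurable_funM; last exact: measurable_decay.
  by apply: measurableT_comp => //; exact: measurable_rV_affine.
- by move=> y; rewrite !normrM ler_wpM2r// (gtr0_norm C0).
- by apply: integrable_RZl; exact: integrable_decay.
Qed.

Lemma pweightE e (x : 'rV[R]_n) :
  pweight e x = expR (- (e * \sum_(i < n) `|x ord0 i|)).
Proof.
rewrite mulr_sumr -sumrN (big_morph _ (@expRD R) (@expR0 R)).
exact: eq_bigr.
Qed.

(** Monotone convergence is the right tool, since square integrability of [hartley h] is not known
    yet; it is a consequence of [plancherel]. *)
Lemma cvg_hartley_sqr h : rapid h ->
  (\int[mu]_xi (pweight (harmonic k) xi * hartley h xi ^+ 2)%:E @[k --> \oo]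
   --> \int[mu]_xi (hartley h xi ^+ 2)%:E)%E.
Proof.
move=> rh; have mH := measurable_hartley (rapid_integrable rh).
have cw (xi : 'rV[R]_n) : pweight (harmonic k) xi @[k --> \oo] --> (1 : R).
  rewrite (eq_cvg _ _ (fun k => pweightE (harmonic k) xi)).
  rewrite -(@expR0 R).
  apply: continuous_cvg; first exact: continuous_expR.
  set S := \sum_(i < n) _; rewrite -(@oppr0 R) -(mul0r S).
  by apply: cvgN; apply: cvgM; [exact: cvg_harmonic|exact: cvg_cst].
have := @cvg_monotone_convergence _ _ _ mu setT measurableT
  (fun k xi => (pweight (harmonic k) xi * hartley h xi ^+ 2)%:E) _ _ _.
have -> : (\int[mu]_xi (hartley h xi ^+ 2)%:E =
    \int[mu]_xi limn (fun k => (pweight (harmonic k) xi * hartley h xi ^+ 2)%:E))%E.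
  apply: eq_integral => xi _; apply/esym/cvg_lim => //.
  apply: cvg_EFin; first exact: nearW.
  have := cvgM (cw xi) (cvg_cst (hartley h xi ^+ 2)); rewrite mul1r; exact.
apply.
- move=> k; apply/measurable_EFinP; apply: measurable_funM.
    exact: measurable_pweight.
  exact: measurable_funX.
- by move=> k xi _; rewrite lee_fin mulr_ge0 ?pweight_ge0 ?sqr_ge0.
- move=> xi _ k l kl; rewrite lee_fin ler_wpM2r ?sqr_ge0//.
  rewrite !pweightE ler_expR lerN2 ler_wpM2r ?sumr_ge0//.
  by rewrite /harmonic lef_pV2 ?posrE// ler_nat.
Qed.

(** Dominated convergence: one factor [h] is integrable and the translated one is merely bounded,
    which gives a majorant independent of [k]. *)
Lemma cvg_translation_prod h : rapid h ->
  (\int[(mu \x mu)%E]_p (h p.1 * (h (harmonic k *: p.2 + p.1) * decay p.2))%:E @[k --> \oo]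
   --> \int[(mu \x mu)%E]_p (h p.1 * (h p.1 * decay p.2))%:E)%E.
Proof.
move=> rh; have ih := rapid_integrable rh; have mh := rapid_measurable rh.
have [C C0 hC] := rapid_bound rh.
have hC' x : `|h x| <= C by rewrite (le_trans (hC x))// ler_piMr ?decay_le1// ltW.
have mF e := measurable_translation_prod e mh.
have mG : measurable_fun setT (fun p : 'rV[R]_n * 'rV[R]_n =>
    `|h p.1| * `|C * decay p.2|).
  apply: measurable_funM; apply: measurableT_comp => //.
    exact: measurableT_comp mh measurable_fst.
  apply: measurable_funM => //.
  exact: measurableT_comp measurable_decay measurable_snd.
have iG := integrable_prod_dominated mG ih (integrable_RZl C (integrable_decay R n))
  (fun x y => (ltac:(by rewrite /= normrM !normr_id))).
have [|||||_ _] := @dominated_convergence _ _ _ (mu \x mu)%E setT measurableT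
  (fun k p => (h p.1 * (h (harmonic k *: p.2 + p.1) * decay p.2))%:E)
  (fun p => (h p.1 * (h p.1 * decay p.2))%:E)
  (fun p => (`|h p.1| * `|C * decay p.2|)%:E) => //.
- by move=> k; apply/measurable_EFinP; exact: mF.
- apply/measurable_EFinP; have := mF 0.
  by under eq_fun do rewrite scale0r add0r.
- apply: aeW => p _; apply: cvg_EFin; first exact: nearW.
  apply: cvgM; first exact: cvg_cst.
  apply: cvgM; last exact: cvg_cst.
  apply: continuous_cvg; first exact: (proj1 rh).
  apply: cvg_rV => i; rewrite (eq_cvg _ (g := fun k => harmonic k * p.2 ord0 i + p.1 ord0 i)); last by move=> k; rewrite !mxE.
  have := cvgD (cvgM (@cvg_harmonic R) (cvg_cst (p.2 ord0 i))) (cvg_cst (p.1 ord0 i)).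
  by rewrite mul0r add0r; exact.
- apply: aeW => p k _; rewrite lee_fin !normrM ler_wpM2l// ler_wpM2r//.
  by rewrite (gtr0_norm C0).
Qed.

(* Both sides are limits, as [e -> 0], of the integral of
   [pweight e xi * hartley h xi ^+ 2]. *)
Lemma plancherel h : rapid h ->
  (\int[mu]_xi (hartley h xi ^+ 2)%:E =
   (2 ^+ n * decay_mass * \int[mu]_x (h x ^+ 2))%:E)%E.
Proof.
move=> rh; have ih := rapid_integrable rh; have mh := rapid_measurable rh.
have [C hC] := rapid_bounded rh.
have iC := integrable_RZl C (integrable_decay R n).
have mF e := measurable_translation_prod e mh.
have iF e := integrable_prod_dominated (mF e) ih iC
  (fun x y => translation_prod_dominated e x y hC).
have E k : ((2 ^+ n)%:E * \int[(mu \x mu)%E]_p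
      (h p.1 * (h (harmonic k *: p.2 + p.1) * decay p.2))%:E =
    \int[mu]_xi (pweight (harmonic k) xi * hartley h xi ^+ 2)%:E)%E.
  have k0 : 0 < harmonic k :> R by rewrite /harmonic invr_gt0.
  rewrite -[X in (_ * X)%E](EFin_Rintegral (iF (harmonic k))) -EFinM.
  rewrite -(pweight_hartley_sqr_prod k0 rh) EFin_Rintegral//.
  apply: (integrable_dominated (g := fun xi => 2 * (\int[mu]_x `|h x|) *
      (pweight (harmonic k) xi * hartley h xi))).
  - apply: measurable_funM; first exact: measurable_pweight.
    by apply: measurable_funX; exact: measurable_hartley.
  - move=> xi; rewrite expr2 mulrA mulrC normrM [leRHS]normrM ler_wpM2r//.
    by rewrite (le_trans (norm_hartley xi ih))// ler_norm.
  - by apply: integrable_RZl; exact: intg_pweight_hartley.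
have H1 := cvg_hartley_sqr rh.
have fin2 : (2 ^+ n : R)%:E \is a fin_num by [].
have H2 := cvgeZl fin2 (cvg_translation_prod rh).
have H3 : (\int[mu]_xi (pweight (harmonic k) xi * hartley h xi ^+ 2)%:E @[k --> \oo]
   --> (2 ^+ n)%:E * \int[(mu \x mu)%E]_p (h p.1 * (h p.1 * decay p.2))%:E)%E.
  by move: H2; rewrite (eq_cvg _ _ E).
rewrite (cvg_unique _ H1 H3)//.
(* The limit integrand is the translated one at [e = 0], so the integrability already shown for
   every [e] and the same Fubini lemma apply to it. *)
have i0 := iF 0.
have -> : (\int[(mu \x mu)%E]_p (h p.1 * (h p.1 * decay p.2))%:E =
    \int[(mu \x mu)%E]_p (h p.1 * (h (0%R *: p.2 + p.1)%R * decay p.2))%:E)%E.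
  by apply: eq_integral => p _; rewrite scale0r add0r.
rewrite -[X in (_ * X)%E](EFin_Rintegral i0) -EFinM.
rewrite (Rintegral_prod1 (mF 0) ih iC (fun x y => translation_prod_dominated 0 x y hC)).
rewrite -mulrA; congr (_ * _)%:E.
rewrite mulrC -(RintegralZr _ measurableT (rapid_sqr_integrable rh)).
apply: eq_Rintegral => x _ /=.
rewrite /decay_mass -RintegralZl//; last exact: integrable_decay.
by apply: eq_Rintegral => y _; rewrite scale0r add0r expr2 mulrA.
Qed.

End plancherel.

(** * Fourier multipliers *)

Section multiplier.
Context {R : realType} {n : nat}.
Implicit Types (f m h : 'rV[R]_n -> R).
Local Notation mu := (lebesgue_rV n).
Local Notation intg h := (mu.-integrable setT (EFin \o h)).

Lemma intg_cos f (xi : 'rV[R]_n) : intg f -> intg (fun x => cos (dot x xi) * f x).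
Proof.
move=> ih; apply: (integrable_dominated _ _ ih).
- apply: measurable_funM; last exact: measurable_intg.
  by apply: measurable_cos; under eq_fun do rewrite dotC; exact: measurable_dotl.
- by move=> x; rewrite normrM ler_piMl// norm_cos_le1.
Qed.

Lemma intg_sin f (xi : 'rV[R]_n) : intg f -> intg (fun x => sin (dot x xi) * f x).
Proof.
move=> ih; apply: (integrable_dominated _ _ ih).
- apply: measurable_funM; last exact: measurable_intg.
  by apply: measurable_sin; under eq_fun do rewrite dotC; exact: measurable_dotl.
- by move=> x; rewrite normrM ler_piMl// norm_sin_le1.
Qed.

Lemma hartley_cos_sin f (xi : 'rV[R]_n) : intg f -> hartley f xi =
  \int[mu]_x (cos (dot x xi) * f x) + \int[mu]_x (sin (dot x xi) * f x).
Proof.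
move=> fi; rewrite -RintegralD//; [|exact: intg_cos|exact: intg_sin].
by apply: eq_Rintegral => x _; rewrite mulrDl.
Qed.

Lemma hartleyN_cos_sin f (xi : 'rV[R]_n) : intg f -> hartley f (- xi) =
  \int[mu]_x (cos (dot x xi) * f x) - \int[mu]_x (sin (dot x xi) * f x).
Proof.
move=> fi; rewrite -RintegralB//; [|exact: intg_cos|exact: intg_sin].
by apply: eq_Rintegral => x _; rewrite /cas dotNr cosN sinN mulrDl mulNr.
Qed.

Lemma fourierE f (xi : 'rV[R]_n) : intg f ->
  fourier (fun y => (f y)%:C%C) xi =
  ((Num.sqrt (2 * pi) ^- n * \int[mu]_x (cos (dot x xi) * f x))
   +i* (- (Num.sqrt (2 * pi) ^- n * \int[mu]_x (sin (dot x xi) * f x))))%C.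
Proof.
move=> fi.
rewrite /fourier /cintegral /expi.
have -> : \int[mu]_x complex.Re (((cos (- dot x xi) +i* sin (- dot x xi)) * (f x)%:C)%C)
    = \int[mu]_x (cos (dot x xi) * f x).
  by apply: eq_Rintegral => x _; rewrite /= cosN; ring.
have -> : \int[mu]_x complex.Im (((cos (- dot x xi) +i* sin (- dot x xi)) * (f x)%:C)%C)
    = -1 * \int[mu]_x (sin (dot x xi) * f x).
  rewrite -RintegralZl//; last exact: intg_sin.
  by apply: eq_Rintegral => x _; rewrite /= sinN; ring.
by apply/eqP; rewrite eq_complex /= !mul0r subr0 addr0 mulN1r mulrN !eqxx.
Qed.

Lemma Rintegral_rV_opp h : intg h -> \int[mu]_x h (- x) = \int[mu]_x h x.
Proof.
move=> ih; have := @Rintegral_rV_affine _ _ (-1) 0 h (ltac:(by rewrite oppr_eq0 oner_eq0)) ih.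
rewrite normrN1 expr1n invr1 mul1r => <-.
by apply: eq_Rintegral => x _; rewrite scaleN1r addr0.
Qed.

Lemma integrable_rV_opp h : intg h -> intg (fun x => h (- x)).
Proof.
move=> ih; have := @integrable_rV_affine _ _ (-1) 0 h (ltac:(by rewrite oppr_eq0 oner_eq0)) ih.
by under eq_fun do rewrite scaleN1r addr0.
Qed.

(* The cosine and sine integrals of [f] are the even and odd parts of
   [hartley f]; for even [m] the mixed terms cancel under [xi -> - xi]. *)
Lemma fourier_multiplierE m f (x : 'rV[R]_n) : (forall xi, m (- xi) = m xi) ->
  intg f -> intg (fun xi => m xi * hartley f xi) ->
  fourier_multiplier m f x =
  (Num.sqrt (2 * pi) ^- n) ^+ 2 * hartley (fun xi => m xi * hartley f xi) x.
Proof.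
move=> em fi mfi; rewrite /fourier_multiplier /inv_fourier /cintegral.
rewrite [LHS](_ : _ = Num.sqrt (2 * pi) ^- n * \int[mu]_xi complex.Re
   (expi (dot x xi) * ((m xi)%:C%C * fourier (fun y => (f y)%:C%C) xi))); last first.
  by rewrite [LHS]/= mul0r subr0.
rewrite expr2 -mulrA; congr (_ * _).
set c := _ ^- n.
pose G xi := cas (dot xi x) * (m xi * hartley f xi).
have iG : intg G by exact: intg_cas.
transitivity (\int[mu]_xi (c * 2^-1 * (G xi + G (- xi)))).
  apply: eq_Rintegral => xi _; rewrite fourierE//= /G dotNl hartleyN_cos_sin//.
  rewrite hartley_cos_sin// em /cas cosN sinN -/c (dotC x xi).
  by field.
rewrite RintegralZl//; last first.
  by apply: integrable_RD => //; exact: integrable_rV_opp.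
rewrite RintegralD//; last exact: integrable_rV_opp.
by rewrite (Rintegral_rV_opp iG) /hartley -/G; field.
Qed.

End multiplier.

(** * Schwartz functions *)

Section schwartz.
Context {R : realType} {n : nat}.
Implicit Types (f g m : 'rV[R]_n -> R) (x xi : 'rV[R]_n).
Local Notation mu := (lebesgue_rV n).
Local Notation intg h := (mu.-integrable setT (EFin \o h)).

Lemma dot_ge0 x : 0 <= dot x x.
Proof. by apply: sumr_ge0 => i _; rewrite -expr2 sqr_ge0. Qed.

Lemma enorm_ge0 x : 0 <= enorm x.
Proof. exact: sqrtr_ge0. Qed.

Lemma enorm_sqr x : enorm x ^+ 2 = \sum_(i < n) x ord0 i ^+ 2.
Proof. by rewrite sqr_sqrtr ?dot_ge0//; apply: eq_bigr => i _; rewrite expr2. Qed.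

Lemma normr_coord_le x i : `|x ord0 i| <= enorm x.
Proof.
rewrite -ler_sqr ?nnegrE ?enorm_ge0// enorm_sqr real_normK ?num_real//.
by rewrite (bigD1 i)//= lerDl sumr_ge0// => j _; rewrite sqr_ge0.
Qed.

Lemma prod_decayV x : \prod_(i < n) (1 + x ord0 i ^+ 2) = (decay x)^-1.
Proof. by rewrite /decay prodfV invrK. Qed.

(** Expanding the product of the 1 + x_i^2 produces every x_i^2 and otherwise nonnegative terms. A
    symbol of quadratic growth thus costs one factor [decay]. *)
Lemma enorm_decay x : 1 + enorm x ^+ 2 <= (decay x)^-1.
Proof.
rewrite -prod_decayV enorm_sqr; elim: (index_enum _) => [|i s IH].
  by rewrite !big_nil addr0.
rewrite !big_cons; have H := sqr_ge0 (x ord0 i).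
have H2 : 0 <= \sum_(j <- s) x ord0 j ^+ 2 by apply: sumr_ge0 => j _; rewrite sqr_ge0.
apply: le_trans (_ : (1 + x ord0 i ^+ 2) * (1 + \sum_(j <- s) x ord0 j ^+ 2) <= _).
  by nra.
by rewrite ler_wpM2l// addr_ge0.
Qed.

(** Each factor 1 + x_i^2 is at most (1 + |x|)^2. Hence seminorms of order [2 * n] control quotients
    by [decay]. *)
Lemma decay_pow x : (decay x)^-1 <= (1 + enorm x) ^+ (2 * n).
Proof.
rewrite -prod_decayV exprM -[X in _ ^+ X](card_ord n) -prodr_const.
apply: ler_prod => i _; rewrite addr_ge0 ?sqr_ge0//=.
have := normr_coord_le x i; have := enorm_ge0 x.
have : x ord0 i ^+ 2 = `|x ord0 i| ^+ 2 by rewrite real_normK ?num_real.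
have := normr_ge0 (x ord0 i).
set a := `|_|; set e := enorm x; move=> a0 -> e0 ae; nra.
Qed.

Lemma seminorm_bound k s f x :
  (((1 + enorm x) ^+ k * `|pderiv s f x|)%:E <= schwartz_seminorm k s f)%E.
Proof. by apply: ereal_sup_ubound; exists x. Qed.

Lemma schwartz_pderiv s f : schwartz f -> schwartz (pderiv s f).
Proof.
have E s' : pderiv s' (pderiv s f) = pderiv (s' ++ s) f by rewrite /pderiv foldr_cat.
move=> [df sf]; split => [s' x|k s']; first by rewrite E.
by rewrite /schwartz_seminorm E; exact: sf.
Qed.

Lemma schwartz_bound k s f : schwartz f ->
  exists2 C, 0 <= C & forall x, (1 + enorm x) ^+ k * `|pderiv s f x| <= C.
Proof.
move=> [_ /(_ k s) fin].
have S0 : (0 <= schwartz_seminorm k s f)%E.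
  apply: le_trans (seminorm_bound k s f 0).
  by rewrite lee_fin mulr_ge0 ?exprn_ge0// addr_ge0 ?enorm_ge0.
exists (fine (schwartz_seminorm k s f)); first exact: fine_ge0.
move=> x; rewrite -lee_fin fineK ?ge0_fin_numE//; exact: seminorm_bound.
Qed.

Lemma le_decay (u a : R) x : `|u| <= a / (1 + enorm x) ^+ (2 * n) ->
  `|u| <= a * decay x.
Proof.
have p0 : 0 < (1 + enorm x) ^+ (2 * n) by rewrite exprn_gt0// ltr_wpDr ?enorm_ge0.
move=> H; have a0 : 0 <= a.
  by have := le_trans (normr_ge0 u) H; rewrite pmulr_lge0// invr_gt0.
apply: (le_trans H); rewrite ler_wpM2l//.
by rewrite -[leRHS]invrK lef_pV2 ?posrE ?invr_gt0 ?decay_gt0// decay_pow.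
Qed.

Lemma schwartz_decay k s f : schwartz f ->
  exists2 C, 0 <= C & forall x, (1 + enorm x) ^+ k * `|pderiv s f x| <= C * decay x.
Proof.
move=> /(schwartz_bound (k + 2 * n) s)[C C0 hC]; exists C => // x.
have e0 : 0 < 1 + enorm x by rewrite ltr_wpDr ?enorm_ge0.
rewrite -[leLHS]ger0_norm ?mulr_ge0 ?exprn_ge0 ?(ltW e0)//.
apply: le_decay; rewrite normrM normr_id (@ger0_norm _ (_ ^+ k)) ?exprn_ge0 ?(ltW e0)//.
by rewrite ler_pdivlMr ?exprn_gt0// mulrAC -exprD.
Qed.

Lemma schwartz_rapid s f : schwartz f -> rapid (pderiv s f).
Proof.
move=> sf; split.
  by move=> x; apply: differentiable_continuous; exact: (proj1 sf).
have [C C0 hC] := schwartz_decay 0 s sf; exists C => x.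
by have := hC x; rewrite expr0 mul1r.
Qed.

(** In one coordinate, y^2 <= 2 (y + u)^2 + 2 u^2 gives 1 + y^2 <= 3 (1 + (y + u)^2) for |u| <= 1.
    The factor 3 is spent in every coordinate, moved or not. *)
Lemma decay_translate (i : 'I_n) (t : R) x : `|t| <= 1 ->
  decay (x + t *: delta_mx ord0 i) <= 3 ^+ n * decay x.
Proof.
move=> t1; rewrite -[X in _ ^+ X](card_ord n) -prodr_const -big_split.
apply: ler_prod => j _; rewrite invr_ge0 addr_ge0 ?sqr_ge0//= !mxE eqxx/=.
have [u [-> u1]] : exists u, t * (j == i)%:R = u /\ `|u| <= 1.
  by exists (t * (j == i)%:R); split => //; case: eqP => _; rewrite ?mulr1// mulr0 normr0.
move: u1; rewrite ler_norml => /andP[u1 u2].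
have p a : 0 < 1 + a ^+ 2 :> R by rewrite ltr_pwDl// sqr_ge0.
rewrite ler_pdivlMr// mulrC ler_pdivrMr//.
set y := x ord0 j; have := sqr_ge0 (y + 2 * u); have := sqr_ge0 (y + u).
have : u ^+ 2 <= 1 by nra.
by nra.
Qed.

Lemma is_derive_line s f (i : 'I_n) x (t : R) : schwartz f ->
  is_derive t 1 (fun t => pderiv s f (x + t *: delta_mx ord0 i))
    (pderiv (i :: s) f (x + t *: delta_mx ord0 i)).
Proof.
move=> sf; set d := delta_mx ord0 i.
have D : derivable (pderiv s f) (x + t *: d) d by exact/diff_derivable/(proj1 sf).
have E : (fun h : R => h^-1 *: ((( fun t => pderiv s f (x + t *: d)) \o shift t) (h *: 1) - pderiv s f (x + t *: d)))
  = (fun h : R => h^-1 *: ((pderiv s f \o shift (x + t *: d)) (h *: d) - pderiv s f (x + t *: d))).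
  apply/funext => h /=; congr (_ *: (pderiv s f _ - _)).
  by rewrite scalerDl /GRing.scale/= mulr1 addrCA.
by split; rewrite /derivable /derive E.
Qed.

End schwartz.

(** * The transform of translates and derivatives of Schwartz functions *)

Section hartley_schwartz.
Context {R : realType} {n : nat}.
Implicit Types (f g m : 'rV[R]_n -> R) (x xi : 'rV[R]_n).
Local Notation mu := (lebesgue_rV n).
Local Notation intg h := (mu.-integrable setT (EFin \o h)).

Lemma schwartz_integrable f : schwartz f -> intg f.
Proof. by move=> sf; exact: rapid_integrable (schwartz_rapid [::] sf). Qed.

Lemma hartleyB f g xi : intg f -> intg g ->
  hartley (fun x => f x - g x) xi = hartley f xi - hartley g xi.
Proof.
move=> fi gi; rewrite -RintegralB//; [|exact: intg_cas|exact: intg_cas].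
by apply: eq_Rintegral => x _; rewrite mulrBr.
Qed.

Lemma hartleyD f g xi : intg f -> intg g ->
  hartley (fun x => f x + g x) xi = hartley f xi + hartley g xi.
Proof.
move=> fi gi; rewrite -RintegralD//; [|exact: intg_cas|exact: intg_cas].
by apply: eq_Rintegral => x _; rewrite mulrDr.
Qed.

Lemma hartleyZ (c : R) f xi : intg f ->
  hartley (fun x => c * f x) xi = c * hartley f xi.
Proof.
move=> fi; rewrite -RintegralZl//; last exact: intg_cas.
by apply: eq_Rintegral => x _; rewrite mulrCA.
Qed.

Lemma hartley_decay_le f (C : R) xi : measurable_fun setT f ->
  (forall x, `|f x| <= C * decay x) -> `|hartley f xi| <= 2 * @decay_mass R n * C.
Proof.
move=> mf fC.
have iC : intg (fun x => C * decay x) by apply: integrable_RZl; exact: integrable_decay.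
have fi : intg f.
  by apply: (integrable_dominated _ _ iC) => // x; rewrite (le_trans (fC x))// ler_norm.
rewrite (le_trans (norm_hartley xi fi))// -mulrA ler_wpM2l// mulrC.
rewrite /decay_mass -RintegralZl//; last exact: integrable_decay.
by apply: le_Rintegral => //; exact: (integrable_norm fi).
Qed.

Lemma casB (a b : R) : cas (a - b) = cos b * cas a - sin b * cas (- a).
Proof. by rewrite /cas cosB sinB cosN sinN; ring. Qed.

Lemma dot_delta (i : 'I_n) xi : dot (delta_mx ord0 i) xi = xi ord0 i.
Proof.
rewrite /dot (bigD1 i)//= big1 ?addr0 => [|j /negPf ji]; rewrite mxE eqxx.
  by rewrite eqxx mul1r.
by rewrite ji mul0r.
Qed.

Lemma dotZl (c : R) x xi : dot (c *: x) xi = c * dot x xi.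
Proof. by rewrite /dot mulr_sumr; apply: eq_bigr => i _; rewrite mxE mulrA. Qed.

(** The analogue of the phase factor of the Fourier transform. Since [cas (a - b)] involves both
    [cas a] and [cas (- a)], a translation mixes the values at [xi] and [- xi]. *)
Lemma hartley_translate f (i : 'I_n) (h : R) xi : intg f ->
  hartley (fun x => f (x + h *: delta_mx ord0 i)) xi =
  cos (h * xi ord0 i) * hartley f xi - sin (h * xi ord0 i) * hartley f (- xi).
Proof.
move=> fi; set d := delta_mx ord0 i.
have E x : cas (dot (x - h *: d) xi) * f x =
    cos (h * xi ord0 i) * (cas (dot x xi) * f x) -
    sin (h * xi ord0 i) * (cas (dot x (- xi)) * f x).
  rewrite dotDl dotNl dotZl dot_delta casB dotNr; ring.
have iG : intg (fun x => cas (dot (x - h *: d) xi) * f x).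
  rewrite (_ : (fun x => _) = (fun x => cos (h * xi ord0 i) * (cas (dot x xi) * f x) -
    sin (h * xi ord0 i) * (cas (dot x (- xi)) * f x))); last exact/funext.
  by apply: integrable_RB; apply: integrable_RZl; exact: intg_cas.
have := @Rintegral_rV_affine _ _ 1 (h *: d) _ (oner_neq0 _) iG.
rewrite normr1 expr1n invr1 mul1r => H.
transitivity (\int[mu]_x (cas (dot (x - h *: d) xi) * f x)).
  by rewrite -H; apply: eq_Rintegral => x _; rewrite scale1r addrK.
under eq_Rintegral do rewrite E.
by rewrite RintegralB// ?RintegralZl//; do ?apply: integrable_RZl; exact: intg_cas.
Qed.

Lemma line_continuous s f (i : 'I_n) x (a b : R) : schwartz f ->
  {within `[a, b], continuous (fun t => pderiv s f (x + t *: delta_mx ord0 i))}.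
Proof.
move=> sf; apply: continuous_subspaceT => t.
apply: differentiable_continuous; apply/derivable1_diffP.
by have [] := is_derive_line s i x t sf.
Qed.

(** The mean value theorem twice: the error is [c1] times a second derivative at a point between [x]
    and its translate, with [c1 < h]. The bound by [decay] makes the quotients converge under the
    transform. *)
Lemma difference_quotient_decay s f (i : 'I_n) : schwartz f ->
  exists C : R, forall (h : R) x, 0 < h <= 1 ->
  `|h^-1 * (pderiv s f (x + h *: delta_mx ord0 i) - pderiv s f x)
    - pderiv (i :: s) f x| <= h * C * decay x.
Proof.
move=> sf; have [C C0 hC] := schwartz_decay 0 [:: i, i & s] sf.
exists (C * 3 ^+ n) => h x /andP[h0 h1]; set d := delta_mx ord0 i.
have [c1 c1I E1] := MVT h0 (fun t _ => is_derive_line s i x t sf)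
  (@line_continuous s f i x 0 h sf).
move: c1I; rewrite in_itv/= => /andP[c10 c1h].
have [c2 c2I E2] := MVT c10 (fun t _ => is_derive_line (i :: s) i x t sf)
  (@line_continuous (i :: s) f i x 0 c1 sf).
move: c2I; rewrite in_itv/= => /andP[c20 c2c].
rewrite -/d scale0r addr0 subr0 in E1; rewrite -/d scale0r addr0 subr0 in E2.
rewrite E1 mulrC mulfK ?gt_eqF// E2 normrM mulrC (gtr0_norm c10) -mulrA.
rewrite ler_pM// ?(ltW c10) ?(ltW c1h)//.
have := hC (x + c2 *: d); rewrite expr0 mul1r => /le_trans; apply.
rewrite -mulrA ler_wpM2l// decay_translate// gtr0_norm//.
by rewrite ltW// (lt_le_trans _ h1)// (lt_trans c2c).
Qed.

(* Differentiate [hartley_translate] at [h = 0]: no integration by parts. *)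
Lemma hartley_pderiv s f (i : 'I_n) xi : schwartz f ->
  hartley (pderiv (i :: s) f) xi = - (xi ord0 i * hartley (pderiv s f) (- xi)).
Proof.
move=> sf; pose d : 'rV[R]_n := delta_mx ord0 i; set u := pderiv s f.
have ui : intg u by exact: schwartz_integrable (schwartz_pderiv s sf).
have vi : intg (pderiv (i :: s) f) by exact: schwartz_integrable (schwartz_pderiv _ sf).
have ti h : intg (fun x => u (x + h *: d)).
  have := @integrable_rV_affine _ _ 1 (h *: d) u (oner_neq0 _) ui.
  by under eq_fun do rewrite scale1r.
pose a : R := xi ord0 i.
pose g (h : R) := cos (h * a) * hartley u xi - sin (h * a) * hartley u (- xi).
have dg : is_derive (0 : R) (1 : R) g (- (a * hartley u (- xi))).
  rewrite /g; apply: is_derive_eq.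
  by rewrite /GRing.scale/= !mul0r sin0 cos0; ring.
(* One sequence of quotients has two limits: [L1] differentiates the trigonometric factors of
   [hartley_translate], and [L2] passes to the limit under the integral. *)
have L1 : (harmonic k)^-1 * (g (harmonic k) - g 0) @[k --> \oo] --> - (a * hartley u (- xi)).
  have : (fun h : R => h^-1 * (g h - g 0)) h @[h --> 0^'] --> - (a * hartley u (- xi)).
    have [D E] := dg; rewrite /derivable in D; rewrite /derive in E.
    have Q : (fun h : R => h^-1 *: ((g \o shift 0) (h *: 1) - g 0)) =
        (fun h : R => h^-1 * (g h - g 0)).
      by apply/funext => h /=; rewrite /GRing.scale/= mulr1 addr0.
    by rewrite Q in D E; rewrite -E; exact: D.
  move=> /cvgr_dnbhsP; apply; split; last exact: cvg_harmonic.
  by move=> k; rewrite /harmonic invr_eq0 pnatr_eq0.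
have L2 : (harmonic k)^-1 * (g (harmonic k) - g 0) @[k --> \oo] --> hartley (pderiv (i :: s) f) xi.
  have [C hC] := difference_quotient_decay s i sf.
  have B k : `|(harmonic k)^-1 * (g (harmonic k) - g 0) - hartley (pderiv (i :: s) f) xi|
      <= harmonic k * (2 * @decay_mass R n * C).
    have k0 : 0 < harmonic k :> R by rewrite /harmonic invr_gt0.
    have k1 : harmonic k <= 1 :> R by rewrite /harmonic invf_le1// ler1n.
    have := @hartley_decay_le (fun x => (harmonic k)^-1 * (u (x + harmonic k *: d) - u x)
      - pderiv (i :: s) f x) (harmonic k * C) xi.
    have g0 : g 0 = hartley u xi by rewrite /g mul0r cos0 sin0 mul1r mul0r subr0.
    have iq : intg (fun x => (harmonic k)^-1 * (u (x + harmonic k *: d) - u x)).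
      by apply: integrable_RZl; exact: integrable_RB.
    rewrite hartleyB// hartleyZ//; last exact: integrable_RB.
    rewrite hartleyB// hartley_translate// g0 -/(g _) mulrCA; apply.
      by apply: measurable_intg; exact: integrable_RB.
    by move=> x; apply: hC; rewrite k0.
  apply/subr_cvg0/norm_cvg0P.
  apply: (@squeeze_cvgr _ _ _ _ (cst 0) (fun k => harmonic k * (2 * @decay_mass R n * C))).
  - by apply: nearW => k; rewrite normr_ge0/=; exact: B.
  - exact: cvg_cst.
  - by have := cvgM (@cvg_harmonic R) (cvg_cst (2 * @decay_mass R n * C)); rewrite mul0r; exact.
by have := cvg_unique _ L2 L1; apply; exact: Rhausdorff.
Qed.

End hartley_schwartz.

(** * Decay of the transform and the symbols *)

Section symbols.
Context {R : realType} {n : nat}.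
Implicit Types (f g m : 'rV[R]_n -> R) (x xi : 'rV[R]_n).
Local Notation mu := (lebesgue_rV n).
Local Notation intg h := (mu.-integrable setT (EFin \o h)).

(** One derivative reflects the frequency; the second one undoes the reflection and leaves a genuine
    multiplier. *)
Lemma hartley_pderiv2 s f (i : 'I_n) xi : schwartz f ->
  hartley (pderiv [:: i, i & s] f) xi = - (xi ord0 i ^+ 2 * hartley (pderiv s f) xi).
Proof. by move=> sf; rewrite !hartley_pderiv// !mxE opprK; ring. Qed.

Lemma laplacian_hartley f xi : schwartz f -> intg (laplacian f) /\
  hartley (laplacian f) xi = - (enorm xi ^+ 2 * hartley f xi).
Proof.
move=> sf; rewrite enorm_sqr /laplacian.
have pi i := schwartz_integrable (schwartz_pderiv [:: i; i] sf).
suff H : forall r : seq 'I_n, intg (fun x => \sum_(i <- r) pderiv [:: i; i] f x) /\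
    hartley (fun x => \sum_(i <- r) pderiv [:: i; i] f x) xi =
    - ((\sum_(i <- r) xi ord0 i ^+ 2) * hartley f xi) by exact: H.
elim=> [|i r [ir IH]].
  under eq_fun do rewrite big_nil.
  split; first exact: integrable0.
  rewrite big_nil mul0r oppr0 /hartley.
  by under eq_Rintegral do rewrite mulr0; rewrite Rintegral_cst// mul0r.
have -> : (fun x => \sum_(i <- i :: r) pderiv [:: i; i] f x) =
    (fun x => pderiv [:: i; i] f x + \sum_(i <- r) pderiv [:: i; i] f x).
  by apply/funext => x; rewrite big_cons.
split; first exact: integrable_RD.
rewrite hartleyD// IH hartley_pderiv2// big_cons /=.
by rewrite mulrDl opprD.
Qed.

(* [(1 + xi_j^2) H f = H (f - d_j d_j f)], and transforms are bounded. *)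
Lemma hartley_prod_bound (r : seq 'I_n) s f : schwartz f ->
  exists C : R, forall xi,
  \prod_(j <- r) (1 + xi ord0 j ^+ 2) * `|hartley (pderiv s f) xi| <= C.
Proof.
move=> sf; elim: r s => [|j r IH] s.
  exists (2 * \int[mu]_x `|pderiv s f x|) => xi; rewrite big_nil mul1r.
  by apply: norm_hartley; exact: schwartz_integrable (schwartz_pderiv s sf).
have [C hC] := IH s; have [D hD] := IH [:: j, j & s].
exists (C + D) => xi; rewrite big_cons mulrAC.
have j0 : 0 <= 1 + xi ord0 j ^+ 2 by rewrite addr_ge0// sqr_ge0.
have p0 : 0 <= \prod_(j <- r) (1 + xi ord0 j ^+ 2).
  by apply: prodr_ge0 => k _; rewrite addr_ge0// sqr_ge0.
rewrite -{1}(ger0_norm j0) -normrM mulrDl mul1r.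
apply: le_trans (lerD (hC xi) (hD xi)).
rewrite hartley_pderiv2// -mulrDr mulrC ler_wpM2l// normrN; exact: ler_normD.
Qed.

(** Listing every coordinate twice gives the square: one factor [decay] pays for the growth of the
    symbol, the other keeps the product [rapid]. *)
Lemma hartley_decay_sqr f : schwartz f ->
  exists2 C : R, 0 <= C & forall xi, `|hartley f xi| <= C * decay xi ^+ 2.
Proof.
move=> sf; have [C hC] := hartley_prod_bound (index_enum 'I_n ++ index_enum 'I_n) [::] sf.
have H xi : `|hartley f xi| <= C * decay xi ^+ 2.
  have := hC xi; rewrite big_cat/= prod_decayV -invfM -expr2 mulrC.
  by rewrite ler_pdivrMr// exprn_gt0// decay_gt0.
exists C => //; have := le_trans (normr_ge0 _) (H 0).
by rewrite pmulr_lge0// exprn_gt0// decay_gt0.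
Qed.

Lemma cas_lipschitz (a b : R) : `|cas a - cas b| <= 2 * `|a - b|.
Proof.
wlog ab : a b / b < a => [H|].
  have [ba|ab|->] := ltgtP b a; [exact: H| |by rewrite !subrr normr0 mulr0].
  by rewrite distrC (distrC a); exact: H.
have d (t : R) : is_derive t 1 (@cas R) (cas (- t)).
  rewrite /cas; apply: is_derive_eq.
  by rewrite cosN sinN addrC.
have c : {within `[b, a], continuous (@cas R)}.
  apply: continuous_subspaceT => t; apply: differentiable_continuous.
  by apply/derivable1_diffP; have [] := d t.
have [t _ ->] := MVT ab (fun t _ => d t) c.
by rewrite normrM ler_wpM2r// norm_cas.
Qed.

Lemma norm_dot_le x xi : `|dot x xi| <= n%:R * enorm x * `|xi|.
Proof.
rewrite (le_trans (ler_norm_sum _ _ _))//.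
apply: (@le_trans _ _ (\sum_(i < n) enorm x * `|xi|)).
  apply: ler_sum => i _; rewrite normrM ler_pM// ?normr_coord_le//.
  rewrite [leRHS]/Num.norm/= mx_normrE.
  exact: (le_bigmax _ (fun ij : 'I_1 * 'I_n => `|xi ij.1 ij.2|) (ord0, i)).
by rewrite sumr_const card_ord -mulrA mulr_natl.
Qed.

(** The transform is even Lipschitz: [cas] is Lipschitz, and |x| f(x) is bounded by a multiple of
    [decay], which yields the constant [K]. *)
Lemma continuous_hartley f : schwartz f -> continuous (hartley f).
Proof.
move=> sf; have fi := schwartz_integrable sf.
have [C C0 hC] := schwartz_decay 1 [::] sf.
set K := 2 * n%:R * C * @decay_mass R n.
have K0 : 0 <= K.
  rewrite !mulr_ge0//; apply: Rintegral_ge0 => x _; exact/ltW/decay_gt0.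
have L xi eta : `|hartley f xi - hartley f eta| <= K * `|xi - eta|.
  rewrite /hartley -RintegralB//; [|exact: intg_cas|exact: intg_cas].
  have iB : intg (fun x => cas (dot x xi) * f x - cas (dot x eta) * f x).
    by apply: integrable_RB; exact: intg_cas.
  have iD : intg (fun x => 2 * n%:R * C * `|xi - eta| * decay x).
    by apply: integrable_RZl; exact: integrable_decay.
  apply: (le_trans (le_normr_Rintegral measurableT iB)).
  rewrite /K mulrAC /decay_mass -RintegralZl//; last exact: integrable_decay.
  apply: le_Rintegral => //; first exact: (integrable_norm iB).
  move=> x _; rewrite -mulrBl normrM.
  have h1 := cas_lipschitz (dot x xi) (dot x eta).
  have h2 := norm_dot_le x (xi - eta).
  have h3 := hC x; rewrite expr1 -[pderiv [::] f]/f in h3.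
  have E : dot x (xi - eta) = dot x xi - dot x eta.
    by rewrite dotC dotDl dotNl !(dotC _ x).
  rewrite E in h2.
  apply: (@le_trans _ _ (2 * (n%:R * enorm x * `|xi - eta|) * `|f x|)).
    by rewrite ler_wpM2r// (le_trans h1)// ler_wpM2l.
  rewrite (_ : _ * `|f x| = (2 * n%:R * `|xi - eta|) * (enorm x * `|f x|)); last by ring.
  rewrite (_ : _ * decay x = (2 * n%:R * `|xi - eta|) * (C * decay x)); last by ring.
  rewrite ler_wpM2l ?mulr_ge0// (le_trans _ h3)// ler_wpM2r//.
  by rewrite lerDr.
move=> xi; apply/(@cvgrPdist_le R R _ (nbhs xi) (nbhs_filter xi)) => e e0.
have K1 : 0 < K + 1 by rewrite ltr_wpDl.
near=> eta.
apply: (le_trans (L xi eta)); apply: (@le_trans _ _ ((K + 1) * `|xi - eta|)).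
  by rewrite ler_wpM2r// lerDl.
rewrite mulrC -ler_pdivlMr//; near: eta.
by apply: cvgr_dist_le; [exact: cvg_id|exact: divr_gt0].
Unshelve. all: end_near. Qed.

Lemma rapid_symbol_hartley m f : continuous m ->
  (forall xi, `|m xi| <= 1 + enorm xi ^+ 2) -> schwartz f ->
  rapid (fun xi => m xi * hartley f xi).
Proof.
move=> cm hm sf; have [C C0 hC] := hartley_decay_sqr sf.
split.
  move=> xi; have H2 : {for xi, continuous (hartley f)} by exact: continuous_hartley.
  have H1 : {for xi, continuous m} := cm xi.
  exact: (cvgM H1 H2).
exists C => xi; rewrite normrM.
have d0 := decay_gt0 xi.
apply: (@le_trans _ _ ((decay xi)^-1 * (C * decay xi ^+ 2))).
  by rewrite ler_pM// (le_trans (hm xi))// enorm_decay.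
by rewrite mulrCA expr2 mulKf// gt_eqF.
Qed.

Lemma continuous_sum_sqr (r : seq 'I_n) :
  continuous (fun x : 'rV[R]_n => \sum_(i <- r) x ord0 i * x ord0 i).
Proof.
elim: r => [|i r IH].
  have -> : (fun x : 'rV[R]_n => \sum_(i <- [::]) x ord0 i * x ord0 i) = cst 0.
    by apply/funext => x; rewrite big_nil.
  exact: cst_continuous.
have -> : (fun x : 'rV[R]_n => \sum_(j <- i :: r) x ord0 j * x ord0 j) =
    (fun x => x ord0 i * x ord0 i + \sum_(j <- r) x ord0 j * x ord0 j).
  by apply/funext => x; rewrite big_cons.
move=> x; have H := @coord_continuous R 1 n ord0 i x.
exact: (cvgD (cvgM H H) (IH x)).
Qed.

Lemma continuous_enorm : continuous (@enorm R n).
Proof.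
move=> x; apply: (@continuous_comp _ _ _ (fun x => dot x x) Num.sqrt).
  exact: continuous_sum_sqr.
exact: sqrt_continuous.
Qed.

Lemma continuous_japanese : continuous (@japanese R n).
Proof.
move=> x; apply: (@continuous_comp _ _ _ (fun x => 1 + enorm x ^+ 2) Num.sqrt).
  have H : {for x, continuous (@enorm R n)} by exact: continuous_enorm.
  by have := cvgD (@cvg_cst _ (1 : R) _ (nbhs x) (nbhs_filter x)) (cvgM H H); exact.
exact: sqrt_continuous.
Qed.

Lemma japanese_ge1 xi : 1 <= japanese xi.
Proof. by rewrite -[leLHS]sqrtr1 ler_wsqrtr// lerDl sqr_ge0. Qed.

Lemma japanese_sqr xi : japanese xi ^+ 2 = 1 + enorm xi ^+ 2.
Proof. by rewrite sqr_sqrtr// addr_ge0// sqr_ge0. Qed.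

Lemma continuous_japaneseV : continuous (fun xi : 'rV[R]_n => (japanese xi)^-1).
Proof.
move=> x; have H : {for x, continuous (@japanese R n)} by exact: continuous_japanese.
apply: (cvgV _ H).
by rewrite gt_eqF// (lt_le_trans _ (japanese_ge1 x)).
Qed.

Lemma enormN xi : enorm (- xi) = enorm xi.
Proof. by rewrite /enorm dotNl dotNr opprK. Qed.

Lemma japaneseN xi : japanese (- xi) = japanese xi.
Proof. by rewrite /japanese enormN. Qed.

Lemma enorm_le xi : `|enorm xi| <= 1 + enorm xi ^+ 2.
Proof. by rewrite ger0_norm ?enorm_ge0//; have := enorm_ge0 xi; nra. Qed.

Lemma japanese_le xi : `|japanese xi| <= 1 + enorm xi ^+ 2.
Proof.
have h := japanese_ge1 xi.
by rewrite -japanese_sqr ger0_norm ?(le_trans _ h)//; nra.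
Qed.

Lemma japaneseV_le xi : `|(japanese xi)^-1| <= 1 + enorm xi ^+ 2.
Proof.
have h := japanese_ge1 xi; have h0 : 0 < japanese xi by rewrite (lt_le_trans _ h).
rewrite gtr0_norm ?invr_gt0// (@le_trans _ _ 1)//; first by rewrite invf_le1.
by rewrite lerDl sqr_ge0.
Qed.

End symbols.

(** * Evolution of the transform in time *)

Section time.
Context {R : realType} {n : nat}.
Implicit Types (g : 'rV[R]_n -> R) (u v w : R -> 'rV[R]_n -> R) (xi : 'rV[R]_n).
Local Notation mu := (lebesgue_rV n).

Lemma schwartz_measurable g : schwartz g -> measurable_fun setT g.
Proof. by move=> sg; exact: rapid_measurable (schwartz_rapid [::] sg). Qed.

(** Of the Schwartz topology a single seminorm is used, of order [2 * n] and without derivatives: it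
    dominates a multiple of the transform at every frequency. *)
Lemma hartley_schwartz_cvg0 (F : set_system R) {FF : Filter F} u g xi :
  (\forall t \near F, measurable_fun setT (u t \- g)) -> schwartz_cvg F u g ->
  hartley (u t \- g) xi @[t --> F] --> (0 : R).
Proof.
move=> mu_ /(_ (2 * n)%N [::]) /fine_cvgP[Ffin Fcvg].
apply/norm_cvg0P.
apply: (@squeeze_cvgr _ _ _ _ (cst 0) (fun t => 2 * @decay_mass R n *
  fine (schwartz_seminorm (2 * n) [::] (u t \- g)))).
- near=> t; rewrite normr_ge0/=.
  have fin : schwartz_seminorm (2 * n) [::] (u t \- g) \is a fin_num by near: t.
  apply: hartley_decay_le; first by near: t.
  move=> x; have p0 : 0 < (1 + enorm x) ^+ (2 * n).
    by rewrite exprn_gt0// ltr_wpDr ?enorm_ge0.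
  apply: le_decay; rewrite ler_pdivlMr// mulrC -lee_fin fineK//.
  exact: seminorm_bound.
- exact: cvg_cst.
- rewrite -(mulr0 (2 * @decay_mass R n)); apply: cvgM; [exact: cvg_cst|exact: Fcvg].
Unshelve. all: end_near. Qed.

Lemma hartley_schwartz_continuous u xi (T : R) : schwartz_continuous u ->
  {within `[0, T], continuous (fun t => hartley (u t) xi)}.
Proof.
move=> su; apply/subspace_continuousP => t; rewrite /= in_itv/= => /andP[t0 _].
have [st ct] := su t t0.
have it := schwartz_integrable st.
have H : hartley (u r) xi @[r --> within [set r | 0 <= r] (nbhs t)] --> hartley (u t) xi.
  have near0 : \forall r \near within [set r : R | 0 <= r] (nbhs t), 0 <= r.
    exact: withinT.
  apply/subr_cvg0.
  have mu_ : \forall r \near within [set r : R | 0 <= r] (nbhs t),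
      measurable_fun setT (u r \- u t).
    apply: filterS near0 => r r0; apply: measurable_funB.
      exact: schwartz_measurable (proj1 (su r r0)).
    exact: schwartz_measurable.
  apply: cvg_trans (hartley_schwartz_cvg0 xi mu_ ct); apply: near_eq_cvg.
  apply: filterS near0 => r r0; rewrite -hartleyB//.
  exact: schwartz_integrable (proj1 (su r r0)).
apply: cvg_trans H; apply: cvg_app => A; apply: (@filterS _ (nbhs t)) => r Ar.
by rewrite /= in_itv/= => /andP[/Ar].
Qed.

Lemma is_derive_hartley u w xi (t : R) : 0 < t ->
  (forall t, 0 <= t -> schwartz (u t)) -> (forall t, 0 <= t -> schwartz (w t)) ->
  schwartz_derive u w ->
  is_derive t 1 (fun t => hartley (u t) xi) (hartley (w t) xi).
Proof.
move=> t0 su sw /(_ t (ltW t0)) duw.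
set F := within _ _ in duw.
have FF : Filter F by exact: within_filter.
have iw := schwartz_integrable (sw t (ltW t0)).
have iu := schwartz_integrable (su t (ltW t0)).
have nearF : \forall h \near F, 0 <= t + h by exact: withinT.
have iq h : 0 <= t + h -> (lebesgue_rV n).-integrable setT
    (EFin \o fun x => h^-1 * (u (t + h) x - u t x)).
  by move=> /su /schwartz_integrable ?; apply: integrable_RZl; exact: integrable_RB.
have H : h^-1 * (hartley (u (t + h)) xi - hartley (u t) xi) @[h --> F] --> hartley (w t) xi.
  apply/subr_cvg0.
  have mu_ : \forall h \near F, measurable_fun setT
      ((fun x => h^-1 * (u (t + h) x - u t x)) \- w t).
    apply: filterS nearF => h h0; apply: measurable_intg.
    exact: integrable_RB (iq h h0) iw.
  apply: cvg_trans (hartley_schwartz_cvg0 xi mu_ duw).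
  apply: near_eq_cvg; apply: filterS nearF => h h0.
  rewrite hartleyB ?iq// hartleyZ ?hartleyB//.
  - exact: schwartz_integrable (su _ h0).
  - by apply: integrable_RB => //; exact: schwartz_integrable (su _ h0).
have H' : h^-1 *: (((fun t => hartley (u t) xi) \o shift t) (h *: 1) - hartley (u t) xi)
    @[h --> 0^'] --> hartley (w t) xi.
  have -> : (fun h : R => h^-1 *: (((fun t => hartley (u t) xi) \o shift t) (h *: 1) - hartley (u t) xi))
    = (fun h : R => h^-1 * (hartley (u (t + h)) xi - hartley (u t) xi)).
    by apply/funext => h /=; rewrite /GRing.scale/= mulr1 (addrC h).
  apply: cvg_trans H; apply: cvg_app => A FA.
  (* Since [t > 0], the constraint [0 <= t + h] holds near [h = 0], so the restricted limit is a
     full two-sided one. *)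
  have n0 : \forall h \near (0 : R)^', 0 <= t + h.
    have : \forall h \near (0 : R), - t < h by apply: lt_nbhsr; rewrite oppr_lt0.
    by move=> /(@nbhs_dnbhs R 0); apply: filterS => h; rewrite -subr_gt0 opprK addrC => /ltW.
  by apply: (@filterS2 _ (0 : R)^' _ _ _ _ _ FA n0) => h; apply.
split; first by apply/cvg_ex; exists (hartley (w t) xi).
exact: cvg_lim H'.
Qed.

End time.

(** * The damped oscillator *)

Section within_continuity.
Context {R : realType}.
Implicit Types (f g : R -> R) (A : set R).

Lemma within_continuousD A f g : {within A, continuous f} ->
  {within A, continuous g} -> {within A, continuous (fun t => f t + g t)}.
Proof. by move=> cf cg t; have := cvgD (cf t) (cg t); exact. Qed.

Lemma within_continuousM A f g : {within A, continuous f} ->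
  {within A, continuous g} -> {within A, continuous (fun t => f t * g t)}.
Proof. by move=> cf cg t; have := cvgM (cf t) (cg t); exact. Qed.

Lemma within_continuousN A f : {within A, continuous f} ->
  {within A, continuous (fun t => - f t)}.
Proof. by move=> cf t; have := cvgN (cf t); exact. Qed.

Lemma within_continuousB A f g : {within A, continuous f} ->
  {within A, continuous g} -> {within A, continuous (fun t => f t - g t)}.
Proof. by move=> cf cg; apply: within_continuousD => //; exact: within_continuousN. Qed.

Lemma within_continuous_norm A f : {within A, continuous f} ->
  {within A, continuous (fun t => `|f t|)}.
Proof. by move=> cf t; have := cvg_norm (cf t); exact. Qed.

Lemma within_continuous_cst A (c : R) : {within A, continuous (fun _ => c)}.
Proof. by apply: continuous_subspaceT => t; exact: cvg_cst. Qed.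

Lemma within_continuous_shift A : {within A, continuous (fun t : R => 1 + t)}.
Proof.
by apply: continuous_subspaceT => t; apply: cvgD; [exact: cvg_cst|exact: cvg_id].
Qed.

Lemma nonincreasing_derive (F dF : R -> R) (a b : R) : a <= b ->
  (forall t, a < t < b -> is_derive t 1 F (dF t)) ->
  (forall t, a < t < b -> dF t <= 0) ->
  {within `[a, b], continuous F} -> F b <= F a.
Proof.
move=> ab FdF dF0 cF.
have D t : t \in `]a, b[ -> derivable F t 1 by rewrite in_itv/= => /FdF[].
have D0 t : t \in `]a, b[ -> F^`()%classic t <= 0.
  rewrite in_itv/= => tab; rewrite derive1E.
  by have [_ ->] := FdF t tab; exact: dF0.
by apply: (ler0_derive1_le_cc D D0 cF); rewrite ?in_itv/= ?lexx ?ab.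
Qed.

End within_continuity.

Section ode.
Context {R : realType}.
Implicit Types (mu lam : R) (y z : R -> R).

(* The first-order form of y'' + mu / (1 + t) y' + lam y = 0 on [0, oo[. *)
Definition damped mu lam y z : Prop :=
  [/\ forall t : R, 0 < t -> is_derive t (1 : R) y (z t),
      forall t : R, 0 < t ->
        is_derive t (1 : R) z (- (mu / (1 + t) * z t) - lam * y t),
      forall T : R, {within `[0, T], continuous y} &
      forall T : R, {within `[0, T], continuous z}].

Lemma dampedN mu lam y z : damped mu lam y z ->
  damped mu lam (fun t => - y t) (fun t => - z t).
Proof.
move=> [dy dz cy cz]; split.
- by move=> t t0; have d := dy t t0; apply: is_derive_eq.
- move=> t t0; have d := dz t t0.
  apply: is_derive_eq; ring.
- by move=> T; exact: within_continuousN.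
- by move=> T; exact: within_continuousN.
Qed.

Lemma within_continuous_sub (f : R -> R) (a b : R) : 0 <= a ->
  (forall T : R, {within `[0, T], continuous f}) -> {within `[a, b], continuous f}.
Proof.
by move=> a0 cf; apply: continuous_subspaceW (cf b); apply: subset_itvr; rewrite bnd_simp.
Qed.

Lemma is_derive_powR1 (a t : R) : -1 < t ->
  is_derive t (1 : R) (fun t : R => (1 + t) `^ a) (a * (1 + t) `^ a / (1 + t)).
Proof.
move=> t0; have s0 : 0 < 1 + t by rewrite addrC -ltrBlDr sub0r.
have H1 : is_derive (1 + t) (1 : R) (fun s : R => s `^ a) (a * (1 + t) `^ (a - 1)).
  exact: is_derive1_powR.
have H2 : is_derive t (1 : R) (fun t : R => 1 + t) (1 : R).
  by apply: is_derive_eq; rewrite add0r mulr1.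
have := @is_derive1_comp R (fun s : R => s `^ a) (fun t : R => 1 + t) t _ _ H1 H2.
rewrite mulr1 (_ : _ * _ `^ (a - 1) = a * (1 + t) `^ a / (1 + t))//.
rewrite powRB; last by apply/implyP => _; rewrite gt_eqF.
by rewrite powRr1 ?(ltW s0)// mulrA.
Qed.

Lemma is_derive_ln1 (t : R) : -1 < t ->
  is_derive t (1 : R) (fun t : R => ln (1 + t)) (1 + t)^-1.
Proof.
move=> t0; have s0 : 0 < 1 + t by rewrite addrC -ltrBlDr sub0r.
have H1 : is_derive (1 + t) (1 : R) (@ln R) (1 + t)^-1 by exact: is_derive1_ln.
have H2 : is_derive t (1 : R) (fun t : R => 1 + t) (1 : R).
  by apply: is_derive_eq; rewrite add0r mulr1.
have := @is_derive1_comp R (@ln R) (fun t : R => 1 + t) t _ _ H1 H2.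
by rewrite mulr1.
Qed.

Lemma derive_continuous_within (f df : R -> R) (a b : R) : 0 <= a ->
  (forall t : R, -1 < t -> is_derive t (1 : R) f (df t)) ->
  {within `[a, b], continuous f}.
Proof.
move=> a0 d; apply: continuous_in_subspaceT => t; rewrite inE/= in_itv/= => /andP[ta _].
apply: differentiable_continuous; apply/derivable1_diffP.
by have [] := d t (lt_le_trans (ltrN10 R) (le_trans a0 ta)).
Qed.

Lemma within_continuous_powR1 (c a b : R) : 0 <= a ->
  {within `[a, b], continuous (fun t : R => (1 + t) `^ c)}.
Proof. by move=> a0; apply: derive_continuous_within => // t; exact: is_derive_powR1. Qed.

Lemma energy_nonincreasing mu lam y z (t T : R) : 0 < mu ->
  damped mu lam y z -> 0 <= t <= T ->
  z T ^+ 2 + lam * y T ^+ 2 <= z t ^+ 2 + lam * y t ^+ 2.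
Proof.
move=> mu0 [dy dz cy cz] /andP[t0 tT].
apply: (@nonincreasing_derive R (fun t => z t ^+ 2 + lam * y t ^+ 2)
  (fun t => - (2 * mu / (1 + t) * z t ^+ 2))) => //.
- move=> u /andP[tu uT]; have u0 : 0 < u by exact: le_lt_trans tu.
  have dyu := dy u u0; have dzu := dz u u0.
  apply: is_derive_eq; rewrite /GRing.scale/=; field.
  by rewrite gt_eqF// addr_gt0.
- move=> u /andP[tu uT]; rewrite oppr_le0 mulr_ge0 ?sqr_ge0// divr_ge0// ?mulr_ge0 ?(ltW mu0)//.
  by rewrite addr_ge0// (le_trans t0)// ltW.
- have cy' := within_continuous_sub (b := T) t0 cy.
  have cz' := within_continuous_sub (b := T) t0 cz.
  apply: within_continuousD; first exact: (within_continuousM cz' cz').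
  by apply: within_continuousM; [exact: within_continuous_cst|exact: (within_continuousM cy' cy')].
Qed.

(** With s = 1 + t, the function w = s^(mu/2) y satisfies w'' + (lam + c / s^2) w = 0, where c = mu
    (2 - mu) / 4. The left side is its energy w'^2 + (lam + c / s^2) w^2, whose derivative -2 c w^2
    / s^3 is nonpositive exactly when c >= 0. *)
Lemma weighted_energy_le mu lam y z (t : R) : mu <= 2 -> 0 < mu ->
  damped mu lam y z -> 0 <= t ->
  (1 + t) `^ mu * (z t ^+ 2 + lam * y t ^+ 2 + mu * ((1 + t)^-1 * (y t * z t))
    + mu / 2 * ((1 + t)^-1 ^+ 2 * y t ^+ 2)) <=
  z 0 ^+ 2 + lam * y 0 ^+ 2 + mu * (y 0 * z 0) + mu / 2 * y 0 ^+ 2.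
Proof.
move=> mu2 mu0 [dy dz cy cz] t0.
(* Writing the inverse as a real power lets [is_derive_powR1] differentiate both weights. *)
pose F (t : R) := (1 + t) `^ mu * (z t ^+ 2 + lam * y t ^+ 2 +
   mu * ((1 + t) `^ (-1) * (y t * z t)) + mu / 2 * ((1 + t) `^ (-1) ^+ 2 * y t ^+ 2)).
have FE u : 0 <= u -> F u = (1 + u) `^ mu * (z u ^+ 2 + lam * y u ^+ 2 +
   mu * ((1 + u)^-1 * (y u * z u)) + mu / 2 * ((1 + u)^-1 ^+ 2 * y u ^+ 2)).
  by move=> u0; rewrite /F powR_inv1// addr_ge0.
have := FE 0 (lexx 0); rewrite addr0 powR1 invr1 !mul1r expr1n mul1r => <-.
rewrite -FE//.
apply: (@nonincreasing_derive R F (fun u =>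
  mu * (mu - 2) / 2 * ((1 + u) `^ mu / (1 + u) ^+ 3 * y u ^+ 2))) => //.
- move=> u /andP[u0 ut]; have dyu := dy u u0; have dzu := dz u u0.
  have u1 : -1 < u by rewrite (lt_trans _ u0)// ltrN10.
  have dp := is_derive_powR1 mu u1; have dr := is_derive_powR1 (-1) u1.
  apply: is_derive_eq; rewrite /GRing.scale/= powR_inv1; last by rewrite addr_ge0// ltW.
  by field; rewrite gt_eqF// addr_gt0.
- move=> u /andP[u0 ut]; apply: mulr_le0_ge0.
    by rewrite pmulr_lle0// pmulr_rle0// subr_le0.
  by rewrite mulr_ge0 ?sqr_ge0// divr_ge0 ?powR_ge0// exprn_ge0// addr_ge0// ltW.
- have cy' := cy t; have cz' := cz t; have cr := @within_continuous_powR1 (-1) 0 t (lexx 0).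
  have cc (c : R) : {within `[0, t], continuous (fun _ => c)} by exact: within_continuous_cst.
  apply: within_continuousM; first exact: within_continuous_powR1.
  apply: within_continuousD; [apply: within_continuousD; [apply: within_continuousD|]|].
  + exact: (within_continuousM cz' cz').
  + exact: (within_continuousM (cc _) (within_continuousM cy' cy')).
  + exact: (within_continuousM (cc _) (within_continuousM cr (within_continuousM cy' cz'))).
  + exact: (within_continuousM (cc _) (within_continuousM (within_continuousM cr cr) (within_continuousM cy' cy'))).
Qed.

(** For w = (1 + t) y one has w'' + lam w = (2 - mu) y'. In the derivative of w'^2 + lam w^2 this
    leaves a term in y y', which the summand (mu - 2) y^2 cancels; what remains is a nonpositive
    multiple of y'^2. *)
Lemma quadratic_energy_le mu lam y z (t : R) : 2 <= mu ->
  damped mu lam y z -> 0 <= t ->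
  ((1 + t) * z t + y t) ^+ 2 + (mu - 2) * y t ^+ 2 + lam * ((1 + t) * y t) ^+ 2 <=
  (z 0 + y 0) ^+ 2 + (mu - 2) * y 0 ^+ 2 + lam * y 0 ^+ 2.
Proof.
move=> mu2 [dy dz cy cz] t0.
pose F (t : R) := ((1 + t) * z t + y t) ^+ 2 + (mu - 2) * y t ^+ 2 + lam * ((1 + t) * y t) ^+ 2.
rewrite -/(F t) (_ : _ + lam * y 0 ^+ 2 = F 0); last by rewrite /F addr0 !mul1r.
apply: (@nonincreasing_derive R F (fun u => (4 - 2 * mu) * ((1 + u) * z u ^+ 2))) => //.
- move=> u /andP[u0 ut]; have dyu := dy u u0; have dzu := dz u u0.
  apply: is_derive_eq; rewrite /GRing.scale/=.
  by field; rewrite gt_eqF// addr_gt0.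
- move=> u /andP[u0 ut]; apply: mulr_le0_ge0.
    by rewrite subr_le0 (_ : 4 = 2 * 2)// ?ler_pM2l//; ring.
  by rewrite mulr_ge0 ?sqr_ge0// addr_ge0// ltW.
- have cy' := cy t; have cz' := cz t; have cs := @within_continuous_shift R `[0, t]%classic.
  have cc (c : R) : {within `[0, t], continuous (fun _ => c)} by exact: within_continuous_cst.
  have cA := within_continuousD (within_continuousM cs cz') cy'.
  have cB := within_continuousM cs cy'.
  apply: within_continuousD; first apply: within_continuousD.
  + exact: (within_continuousM cA cA).
  + exact: (within_continuousM (cc _) (within_continuousM cy' cy')).
  + exact: (within_continuousM (cc _) (within_continuousM cB cB)).
Qed.

End ode.

(** * Growth of the oscillator at low frequencies *)

Section growth.
Context {R : realType}.
Implicit Types (mu lam : R) (y z : R -> R).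

Definition dissipation mu (t : R) : R :=
  if mu == 1 then ln (1 + t) else ((1 + t) `^ (1 - mu) - 1) / (1 - mu).

Lemma dissipation0 mu : dissipation mu 0 = 0.
Proof. by rewrite /dissipation addr0 ln1 powR1 subrr mul0r; case: ifP. Qed.

Lemma is_derive_dissipation mu (t : R) : -1 < t ->
  is_derive t (1 : R) (dissipation mu) ((1 + t) `^ (- mu)).
Proof.
move=> t1; have s0 : 0 < 1 + t by rewrite addrC -ltrBlDr sub0r.
rewrite /dissipation; case: eqP => [->|/eqP mu1].
  by rewrite powR_inv1 ?(ltW s0)//; exact: is_derive_ln1.
have m0 : 1 - mu != 0 by rewrite subr_eq0 eq_sym.
have d := is_derive_powR1 (1 - mu) t1.
apply: is_derive_eq; rewrite /GRing.scale/=.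
rewrite powRB; last by apply/implyP => _; rewrite gt_eqF.
rewrite powRr1 ?(ltW s0)// powRN; field.
by rewrite m0 !gt_eqF// powR_gt0.
Qed.

Lemma dissipation_mono mu (s t : R) : 0 <= s <= t -> dissipation mu s <= dissipation mu t.
Proof.
move=> /andP[s0 st]; rewrite -lerN2.
have d (u : R) : -1 < u -> is_derive u (1 : R) (fun t => - dissipation mu t) (- (1 + u) `^ (- mu)).
  by move=> u1; have d := is_derive_dissipation mu u1; apply: is_derive_eq.
apply: (nonincreasing_derive (F := fun t => - dissipation mu t)
  (dF := fun u => - (1 + u) `^ (- mu)) st).
- by move=> u /andP[u0 _]; apply: d; rewrite (lt_trans _ u0)// (lt_le_trans _ s0)// ltrN10.
- by move=> u _; rewrite oppr_le0 powR_ge0.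
- exact: (derive_continuous_within _ d).
Qed.

(** The derivative of (1 + t)^mu z is - lam (1 + t)^mu y, at most lam M (1 + t)^mu. It is compared
    with the derivative of lam M (1 + t)^(mu + 1), larger by the factor mu + 1, which spares a
    division. A second integration bounds [y]. Lower bounds come from the same lemma and
    [dampedN]. *)
Lemma small_frequency_upper mu lam y z (M t u : R) : 0 < mu -> 0 <= lam ->
  damped mu lam y z -> (forall s, 0 <= s <= t -> `|y s| <= M) -> 0 <= u <= t ->
  z u <= `|z 0| * (1 + u) `^ (- mu) + lam * M * (1 + u) /\
  y u <= `|y 0| + `|z 0| * dissipation mu u + lam * M * (1 + u) ^+ 2 / 2.
Proof.
move=> mu0 lam0 [dy dz cy cz] yM /andP[u0 ut].
have M0 : 0 <= M by rewrite (le_trans (normr_ge0 _) (yM u _))// u0 ut.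
have zu s : 0 <= s <= t -> z s <= `|z 0| * (1 + s) `^ (- mu) + lam * M * (1 + s).
  move=> /andP[s0 st].
  pose F (t : R) := (1 + t) `^ mu * z t - lam * M * ((1 + t) `^ mu * (1 + t)).
  have s1 : 0 < 1 + s by rewrite ltr_pwDl.
  have H : F s <= F 0.
    apply: (@nonincreasing_derive R F (fun r => - (lam * (1 + r) `^ mu * (y r + M + mu * M)))) => //.
    - move=> r /andP[r0 rs]; have dyr := dy r r0; have dzr := dz r r0.
      have r1 : -1 < r by rewrite (lt_trans _ r0)// ltrN10.
      have dp := is_derive_powR1 mu r1.
      apply: is_derive_eq; rewrite /GRing.scale/=.
      by field; rewrite gt_eqF// addr_gt0.
    - move=> r /andP[r0 rs]; rewrite oppr_le0 mulr_ge0 ?mulr_ge0 ?powR_ge0//.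
      rewrite addr_ge0// ?mulr_ge0 ?(ltW mu0)//.
      have := yM r; rewrite (ltW r0) (le_trans (ltW rs) st) => /(_ isT).
      by rewrite ler_norml => /andP[+ _]; rewrite -subr_ge0 opprK.
    - have cz' := cz s; have cp := @within_continuous_powR1 R mu 0 s (lexx 0).
      have cs := @within_continuous_shift R `[0, s]%classic.
      apply: within_continuousB; first exact: (within_continuousM cp cz').
      by apply: within_continuousM; [exact: within_continuous_cst|exact: (within_continuousM cp cs)].
  have F0 : F 0 <= `|z 0|.
    rewrite /F addr0 powR1 !mul1r !mulr1 lerBlDr (le_trans (ler_norm _))//.
    by rewrite lerDl mulr_ge0.
  have p0 : 0 < (1 + s) `^ mu by rewrite powR_gt0.
  rewrite powRN (_ : _ + _ = ((1 + s) `^ mu)^-1 *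
    (`|z 0| + lam * M * ((1 + s) `^ mu * (1 + s)))); last by field; rewrite gt_eqF.
  by rewrite ler_pdivlMl// -lerBlDr; exact: le_trans H F0.
split; first by apply: zu; rewrite u0 ut.
pose F (t : R) := y t - `|z 0| * dissipation mu t - lam * M / 2 * ((1 + t) * (1 + t)).
have H : F u <= F 0.
  apply: (@nonincreasing_derive R F (fun r => z r - `|z 0| * (1 + r) `^ (- mu) - lam * M * (1 + r))) => //.
  - move=> r /andP[r0 ru]; have dyr := dy r r0.
    have r1 : -1 < r by rewrite (lt_trans _ r0)// ltrN10.
    have dd := is_derive_dissipation mu r1.
    apply: is_derive_eq; rewrite /GRing.scale/=.
    by field.
  - move=> r /andP[r0 ru]; rewrite -addrA -opprD subr_le0 zu// (ltW r0)/=.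
    by rewrite (le_trans (ltW ru)).
  - have cs := @within_continuous_shift R `[0, u]%classic.
    have cd : {within `[0, u], continuous (dissipation mu)}.
      exact: (derive_continuous_within (lexx 0) (@is_derive_dissipation mu)).
    apply: within_continuousB; first apply: within_continuousB; first exact: cy.
      by apply: within_continuousM; [exact: within_continuous_cst|].
    by apply: within_continuousM; [exact: within_continuous_cst|exact: (within_continuousM cs cs)].
have F0 : F 0 <= `|y 0|.
  rewrite /F dissipation0 mulr0 subr0 lerBlDr (le_trans (ler_norm _))// lerDl.
  by rewrite !mulr_ge0// addr_ge0.
by have := le_trans H F0; rewrite /F; lra.
Qed.

(* At the maximum of [|y|] on [0, t] the last term of [small_frequency_upper] is
   at most half of that maximum and can be absorbed. *)
Lemma small_frequency_bound mu lam y z (t : R) : 0 < mu -> 0 <= lam ->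
  damped mu lam y z -> 0 <= t -> lam * (1 + t) ^+ 2 <= 1 ->
  let M := 2 * (`|y 0| + `|z 0| * dissipation mu t) in
  `|y t| <= M /\ `|z t| <= `|z 0| * (1 + t) `^ (- mu) + lam * M * (1 + t).
Proof.
move=> mu0 lam0 sol t0 lt M; have sol' := dampedN sol.
have [dy dz cy cz] := sol.
have [c] := EVT_max t0 (within_continuous_norm (cy t)).
rewrite in_itv/= => /andP[c0 ct] cM.
have cM' s : 0 <= s <= t -> `|y s| <= `|y c|.
  by move=> st; apply: cM; rewrite in_itv.
have cN' s : 0 <= s <= t -> `|- y s| <= `|y c|.
  by move=> st; rewrite normrN; apply: cM'.
have B s : 0 <= s <= t -> `|y s| <= `|y 0| + `|z 0| * dissipation mu s + lam * `|y c| * (1 + s) ^+ 2 / 2.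
  move=> st; have [_ H1] := small_frequency_upper mu0 lam0 sol cM' st.
  have [_ H2] := small_frequency_upper mu0 lam0 sol' cN' st.
  rewrite !normrN in H2; rewrite ler_norml H1 andbT lerNl; exact: H2.
have ycM : `|y c| <= M.
  have H := B c; rewrite c0 ct in H; have {H} := H isT.
  have : lam * (1 + c) ^+ 2 <= 1.
    by rewrite (le_trans _ lt)// ler_wpM2l// ler_sqr ?nnegrE ?addr_ge0// lerD2l.
  have : `|z 0| * dissipation mu c <= `|z 0| * dissipation mu t.
    by rewrite ler_wpM2l// dissipation_mono// c0.
  rewrite /M; have := normr_ge0 (y c).
  set a := `|y c|; set b := _ * dissipation mu t; set d := _ * dissipation mu c.
  set e := (1 + c) ^+ 2 => a0 db le1.
  have : lam * a * e <= a by rewrite mulrAC ler_piMl.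
  set w := lam * a * e; lra.
have tt : 0 <= t <= t by rewrite t0 lexx.
split; first by rewrite (le_trans _ ycM)// cM'.
have M0 : 0 <= M by rewrite (le_trans _ ycM).
have [H1 _] := small_frequency_upper mu0 lam0 sol cM' tt.
have [H2 _] := small_frequency_upper mu0 lam0 sol' cN' tt.
have L : lam * `|y c| * (1 + t) <= lam * M * (1 + t).
  by rewrite ler_wpM2r ?addr_ge0// ler_wpM2l.
rewrite normrN in H2.
rewrite ler_norml (le_trans H1) ?lerD2l// andbT lerNl (le_trans H2)// lerD2l//.
Qed.

End growth.

(** * Bounds for the oscillator, uniform in the frequency *)

Section pointwise.
Context {R : realType}.
Implicit Types (mu lam : R) (y z : R -> R).

(** [B] stands for any common bound of the two quantities that the low-frequency analysis produces.
    The constant is 80 = 2 * 5 * 8: 8 from squaring [N], 5 from the energy after the switching time,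
    and 2 from 1 + lam <= 2. *)
Lemma solution_pointwise mu lam y z (t B : R) : 0 < mu -> 0 <= lam ->
  damped mu lam y z -> 0 <= t -> 1 <= B ->
  (forall s, 0 <= s <= t -> dissipation mu s <= B) ->
  (forall s, 0 <= s <= t -> (1 + s) `^ (1 - mu) <= B) ->
  y t ^+ 2 <= 80 * B ^+ 2 * (y 0 ^+ 2 + z 0 ^+ 2 / (1 + lam)).
Proof.
move=> mu0 lam0 sol t0 B1 dB pB.
have B0 : 0 < B by rewrite (lt_le_trans _ B1).
have BB : 1 <= B ^+ 2 by rewrite expr2 mulr_ege1.
have l1 : 0 < 1 + lam by rewrite ltr_pwDl.
have Y0 := sqr_ge0 (y 0); have Z0 := sqr_ge0 (z 0).
have q0 : 0 <= z 0 ^+ 2 / (1 + lam) by rewrite divr_ge0// ltW.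
(* For lam > 1 the plain energy suffices: dividing it by lam costs only 1 / lam <= 2 / (1 + lam). *)
have [lam1|lam1] := ltP 1 lam.
  have lp : 0 < lam by rewrite (lt_trans _ lam1).
  have := energy_nonincreasing mu0 sol (t := 0) (T := t) (ltac:(by rewrite lexx t0)).
  move=> E; have {}E : lam * y t ^+ 2 <= z 0 ^+ 2 + lam * y 0 ^+ 2.
    by rewrite (le_trans _ E)// lerDr sqr_ge0.
  rewrite -ler_pdivlMl// mulrDr mulKf ?gt_eqF// in E.
  have H : lam^-1 * z 0 ^+ 2 <= 2 * (z 0 ^+ 2 / (1 + lam)).
    rewrite mulrC mulrCA ler_wpM2l// ler_pdivlMr// ler_pdivrMl//; lra.
  set q := _ / (1 + lam) in q0 H *.
  have : y 0 ^+ 2 + q <= B ^+ 2 * (y 0 ^+ 2 + q) by rewrite ler_peMl// addr_ge0.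
  rewrite -mulrA; set X := B ^+ 2 * _; lra.
suff H : y t ^+ 2 <= 40 * B ^+ 2 * (y 0 ^+ 2 + z 0 ^+ 2).
  apply: (le_trans H).
  have : z 0 ^+ 2 <= 2 * (z 0 ^+ 2 / (1 + lam)).
    by rewrite mulrCA ler_peMr// ler_pdivlMr// mul1r; lra.
  set q := _ / (1 + lam) in q0 * => h.
  rewrite (_ : 80 * _ * _ = 40 * B ^+ 2 * (2 * (y 0 ^+ 2 + q))); last by ring.
  rewrite ler_wpM2l ?mulr_ge0 ?(ltW B0)//; lra.
(* [N] bounds the quantity [M] of [small_frequency_bound] at every time up to [t]. *)
pose N := 2 * (B * (`|y 0| + `|z 0|)).
have N0 : 0 <= N by rewrite !mulr_ge0// ?addr_ge0// ltW.
have NN : N ^+ 2 <= 8 * B ^+ 2 * (y 0 ^+ 2 + z 0 ^+ 2).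
  rewrite -(real_normK (num_real (y 0))) -(real_normK (num_real (z 0))) /N.
  rewrite (_ : _ ^+ 2 = 4 * B ^+ 2 * (`|y 0| + `|z 0|) ^+ 2); last by ring.
  rewrite (_ : 8 * _ * _ = 4 * B ^+ 2 * (2 * (`|y 0| ^+ 2 + `|z 0| ^+ 2))); last by ring.
  rewrite ler_wpM2l ?mulr_ge0 ?(ltW B0)//.
  by have := sqr_ge0 (`|y 0| - `|z 0|); nra.
have MN s : 0 <= s <= t -> 2 * (`|y 0| + `|z 0| * dissipation mu s) <= N.
  move=> st; rewrite /N ler_wpM2l// mulrDr lerD//; first by rewrite ler_peMl.
  by rewrite mulrC ler_wpM2r// dB.
have NE : N = 2 * (B * (`|y 0| + `|z 0|)) by [].
clearbody N; suff H : y t ^+ 2 <= 5 * N ^+ 2.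
  apply: (le_trans H); rewrite (_ : 40 * _ * _ = 5 * (8 * B ^+ 2 * (y 0 ^+ 2 + z 0 ^+ 2))); last by ring.
  by rewrite ler_wpM2l.
have [small|large] := leP (lam * (1 + t) ^+ 2) 1.
  have [H _] := small_frequency_bound mu0 lam0 sol t0 small.
  have tt : 0 <= t <= t by rewrite t0 lexx.
  have {}H := le_trans H (MN t tt).
  have : y t ^+ 2 <= N ^+ 2.
    by rewrite -(real_normK (num_real (y t))) ler_sqr ?nnegrE.
  have := sqr_ge0 N; lra.
have lp : 0 < lam.
  rewrite lt_neqAle lam0 andbT; apply/eqP => l0.
  by move: large; rewrite -l0 mul0r ltr10.
(* The switching time is [s - 1], where lam (1 + time)^2 = 1: the last moment at which
   [small_frequency_bound] applies. *)
pose s := (Num.sqrt lam)^-1.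
have sq0 : 0 < Num.sqrt lam by rewrite sqrtr_gt0.
have s0 : 0 < s by rewrite invr_gt0.
have ls : lam * s ^+ 2 = 1.
  by rewrite /s exprVn sqr_sqrtr// mulfV// gt_eqF.
have s1 : 1 <= s.
  by rewrite /s invf_ge1// -sqrtr1 ler_wsqrtr.
have st : s <= 1 + t.
  rewrite -ler_sqr ?nnegrE ?(ltW s0) ?addr_ge0//.
  by rewrite -(ler_pM2l lp) ls ltW.
have t1 : 0 <= s - 1 <= t by rewrite subr_ge0 s1 lerBlDl.
have t1' : 0 <= s - 1 by case/andP : t1.
have E1 : 1 + (s - 1) = s by ring.
have := small_frequency_bound mu0 lam0 sol t1'; rewrite E1 ls lexx => /(_ isT)[hy hz].
have hM := MN _ t1; have hp := pB _ t1; rewrite E1 in hp.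
have {}hy := le_trans hy hM.
(* One [N] comes from the free velocity, as s * s^(-mu) = s^(1 - mu) <= B, the other from lam N s^2
   = N. *)
have hsz : s * `|z (s - 1)| <= 2 * N.
  apply: (@le_trans _ _ (s * (`|z 0| * s `^ (- mu) + lam * N * s))).
    rewrite ler_pM2l// (le_trans hz)// lerD2l ler_wpM2r ?(ltW s0)// ler_wpM2l//.
  have -> : s * (`|z 0| * s `^ (- mu) + lam * N * s) =
      `|z 0| * (s * s `^ (- mu)) + N * (lam * s ^+ 2) by ring.
  rewrite ls mulr1 -{1}(powRr1 (ltW s0)) -powRD; last by apply/implyP => _; rewrite gt_eqF.
  have : `|z 0| * s `^ (1 - mu) <= N.
    apply: (@le_trans _ _ (`|z 0| * B)); first by rewrite ler_wpM2l.
    rewrite NE; have : 0 <= B * `|y 0| by rewrite mulr_ge0// ltW.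
    have : 0 <= B * `|z 0| by rewrite mulr_ge0// ltW.
    by rewrite mulrC mulrDr; lra.
  lra.
have := energy_nonincreasing mu0 sol t1.
move=> E; have {}E : lam * y t ^+ 2 <= z (s - 1) ^+ 2 + lam * y (s - 1) ^+ 2.
  by rewrite (le_trans _ E)// lerDr sqr_ge0.
have h1 : (s * `|z (s - 1)|) ^+ 2 <= (2 * N) ^+ 2.
  by rewrite ler_sqr ?nnegrE ?mulr_ge0// ltW.
have h2 : `|y (s - 1)| ^+ 2 <= N ^+ 2 by rewrite ler_sqr ?nnegrE.
rewrite real_normK ?num_real// in h2.
rewrite !exprMn real_normK ?num_real// in h1.
have lsx (x : R) : s ^+ 2 * (lam * x) = x by rewrite mulrA [s ^+ 2 * lam]mulrC ls mul1r.
(* Multiplying the energy inequality by s^2 = 1 / lam bounds y(t)^2 by (s z)^2 + y^2 at the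
   switching time, that is by 4 N^2 + N^2. *)
have := ler_wpM2l (sqr_ge0 s) E; rewrite mulrDr !lsx; lra.
Qed.

Definition solution_gain mu (t : R) : R :=
  if mu < 1 then (1 + t) `^ (1 - mu) else if mu == 1 then ln (expR 1 + t) else 1.

(** For mu < 1 and mu > 1 the constant contains 1 / |1 - mu| from integrating a power; it blows up
    at mu = 1, where the logarithm takes over. *)
Lemma solution_gain_bound mu : 0 < mu ->
  exists2 K : R, 0 < K & forall t : R, 0 <= t ->
  [/\ 1 <= K * solution_gain mu t,
    forall s, 0 <= s <= t -> dissipation mu s <= K * solution_gain mu t &
    forall s, 0 <= s <= t -> (1 + s) `^ (1 - mu) <= K * solution_gain mu t].
Proof.
move=> mu0; rewrite /solution_gain /dissipation.
have [mu1|mu1|->] := ltgtP mu 1.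
- have m0 : 0 < 1 - mu by rewrite subr_gt0.
  have k1 : 1 <= (1 - mu)^-1 by rewrite invf_ge1// gerBl ltW.
  exists (1 - mu)^-1; first by rewrite invr_gt0.
  move=> t t0; have p1 : 1 <= (1 + t) `^ (1 - mu).
    by rewrite -[leLHS](powRr0 (1 + t)) ler_powR ?lerDl// ltW.
  have pm s : 0 <= s <= t -> (1 + s) `^ (1 - mu) <= (1 + t) `^ (1 - mu).
    move=> /andP[s0 st]; apply: ge0_ler_powR; rewrite ?nnegrE ?(ltW m0) ?addr_ge0//.
    by rewrite lerD2l.
  split; first by rewrite mulr_ege1.
  + move=> s st; rewrite mulrC ler_wpM2l ?invr_ge0 ?(ltW m0)//.
    by rewrite (le_trans _ (pm s st))// gerBl.
  + move=> s st; rewrite (le_trans (pm s st))// ler_peMl// (le_trans _ p1)//.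
- have m0 : 0 < mu - 1 by rewrite subr_gt0.
  have pm s : 0 <= s -> (1 + s) `^ (1 - mu) <= 1.
    by move=> s0; rewrite -[leRHS](powRr0 (1 + s)) ler_powR ?lerDl// subr_le0 ltW.
  have k0 : 0 < (mu - 1)^-1 by rewrite invr_gt0.
  exists (1 + (mu - 1)^-1); first by rewrite addr_gt0.
  move=> t t0; rewrite mulr1; split.
  + by rewrite lerDl ltW.
  + move=> s /andP[s0 st]; rewrite -mulrNN opprB -invrN opprB.
    apply: (@le_trans _ _ (mu - 1)^-1); last by rewrite lerDr.
    by rewrite ler_piMl ?(ltW k0)// gerBl powR_ge0.
  + by move=> s /andP[s0 st]; rewrite (le_trans (pm s s0))// lerDl ltW.
- have e1 : 1 <= expR 1 :> R by rewrite -[leLHS](@expR0 R) ler_expR.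
  exists 1 => // t t0; rewrite mul1r subrr.
  have g1 : 1 <= ln (expR 1 + t).
    rewrite -[leLHS](@expRK R) ler_ln ?posrE ?expR_gt0//; last by rewrite ltr_pwDl ?expR_gt0.
    by rewrite lerDl.
  split => //.
  + move=> s /andP[s0 st]; rewrite ler_ln ?posrE ?ltr_pwDl ?expR_gt0//.
    by rewrite lerD.
  + by move=> s _; rewrite powRr0.
Qed.

Lemma solution_pointwise_gain mu : 0 < mu ->
  exists2 K : R, 0 < K & forall lam y z (t : R), 0 <= lam ->
  damped mu lam y z -> 0 <= t ->
  y t ^+ 2 <= K * solution_gain mu t ^+ 2 * (y 0 ^+ 2 + z 0 ^+ 2 / (1 + lam)).
Proof.
move=> mu0; have [K K0 HK] := solution_gain_bound mu0.
exists (80 * K ^+ 2); first by rewrite mulr_gt0// exprn_gt0.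
move=> lam y z t lam0 sol t0; have [B1 dB pB] := HK t t0.
have := solution_pointwise mu0 lam0 sol t0 B1 dB pB.
by rewrite exprMn mulrA.
Qed.

Definition energy_gain mu (t : R) : R :=
  if mu <= 2 then (1 + t) `^ (- (mu / 2)) else (1 + t)^-1.

(** Completing the square in the weighted energy leaves c (y / s)^2 with c = mu (2 - mu) / 4.
    Positivity of this coefficient allows z to be recovered from z + mu y / (2 s), whence the strict
    bound on [mu]. *)
Lemma energy_pointwise_lt2 mu : 0 < mu < 2 ->
  exists2 K : R, 0 < K & forall lam y z (t : R), 0 <= lam ->
  damped mu lam y z -> 0 <= t ->
  (1 + t) `^ mu * (z t ^+ 2 + lam * y t ^+ 2) <=
  K * ((1 + lam) * y 0 ^+ 2 + z 0 ^+ 2).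
Proof.
move=> /andP[mu0 mu2]; have c0 : 0 < mu / 4 * (2 - mu).
  by rewrite !mulr_gt0// ?subr_gt0// invr_gt0.
set c := mu / 4 * (2 - mu) in c0.
(* Chosen for z^2 <= 2 a^2 + (mu^2 / 2) b^2, with a = z + mu b / 2 and b = y / s: it needs k >= 2
   and k c >= mu^2 / 2. *)
pose k := 2 + mu ^+ 2 / 2 / c.
have k2 : 2 <= k by rewrite lerDl !mulr_ge0 ?invr_ge0 ?(ltW c0) ?(ltW mu0).
have k0 : 0 < k by rewrite (lt_le_trans _ k2).
have kc : mu ^+ 2 / 2 <= k * c.
  by rewrite mulrDl divfK ?gt_eqF// lerDr mulr_ge0// ltW.
exists (k * (1 + mu)); first by rewrite mulr_gt0// addr_gt0.
move=> lam y z t lam0 sol t0.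
have := weighted_energy_le (ltW mu2) mu0 sol t0.
set r := (1 + t)^-1; set Q := (X in _ * X <= _) => H.
have QE : Q = (z t + mu / 2 * (r * y t)) ^+ 2 + lam * y t ^+ 2 + c * (r * y t) ^+ 2.
  by rewrite /Q /c; field.
have H1 : z t ^+ 2 + lam * y t ^+ 2 <= k * Q.
  rewrite QE; have L : 0 <= lam * y t ^+ 2 by rewrite mulr_ge0// sqr_ge0.
  have := sqr_ge0 (r * y t); set b := r * y t => b0.
  set a := z t + mu / 2 * b.
  have Z : z t ^+ 2 <= 2 * a ^+ 2 + mu ^+ 2 / 2 * b ^+ 2.
    rewrite (_ : z t = a - mu / 2 * b); last by rewrite /a; ring.
    by have := sqr_ge0 (a + mu / 2 * b); nra.
  have A0 := sqr_ge0 a.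
  have h1 := ler_wpM2r b0 kc; have h2 := ler_wpM2r A0 k2; have h3 := ler_wpM2r L k2.
  clear QE H; clearbody a b c k; lra.
have p0 := powR_ge0 (1 + t) mu.
apply: (le_trans (ler_wpM2l p0 H1)).
rewrite mulrCA -mulrA ler_wpM2l ?(ltW k0)// (le_trans H)//.
have Y := sqr_ge0 (y 0); have Z := sqr_ge0 (z 0).
have YZ := sqr_ge0 (y 0 - z 0).
have LY : 0 <= lam * y 0 ^+ 2 by rewrite mulr_ge0.
have h : y 0 * z 0 <= (y 0 ^+ 2 + z 0 ^+ 2) / 2 by nra.
have := ler_wpM2l (ltW mu0) h.
have : 0 <= mu * (lam * y 0 ^+ 2) by rewrite mulr_ge0// ltW.
have : 0 <= mu * z 0 ^+ 2 by rewrite mulr_ge0// ltW.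
have : 0 <= mu * y 0 ^+ 2 by rewrite mulr_ge0// ltW.
nra.
Qed.

(** To extract s z from s z + y one needs a bound on y alone, and (mu - 2) y^2 provides none at mu =
    2. It is taken from [solution_pointwise], with [B = 1] because [dissipation] is at most 1 / (mu
    - 1) <= 1. Its constant 80, doubled, accounts for most of 166. *)
Lemma energy_pointwise_ge2 mu lam y z (t : R) : 2 <= mu -> 0 <= lam ->
  damped mu lam y z -> 0 <= t ->
  (1 + t) ^+ 2 * (z t ^+ 2 + lam * y t ^+ 2) <=
  (166 + 3 * mu) * ((1 + lam) * y 0 ^+ 2 + z 0 ^+ 2).
Proof.
move=> mu2 lam0 sol t0; have mu0 : 0 < mu by rewrite (lt_le_trans _ mu2).
have H := quadratic_energy_le mu2 sol t0.
have pm s : 0 <= s -> (1 + s) `^ (1 - mu) <= 1.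
  by move=> s0; rewrite -[leRHS](powRr0 (1 + s)) ler_powR ?lerDl// subr_le0; lra.
have dm s : 0 <= s <= t -> dissipation mu s <= 1.
  move=> /andP[s0 _]; rewrite /dissipation ifF; last by apply/eqP; lra.
  rewrite -mulrNN opprB -invrN opprB ler_pdivrMr ?mul1r; last by lra.
  by have := powR_ge0 (1 + s) (1 - mu); lra.
have := solution_pointwise mu0 lam0 sol t0 (lexx 1) dm
  (fun s st => pm s (proj1 (andP st))).
rewrite expr1n mulr1 => Yt.
have q : z 0 ^+ 2 / (1 + lam) <= z 0 ^+ 2.
  by rewrite ler_pdivrMr ?ltr_pwDl// ler_peMr ?sqr_ge0// lerDl.
have Y := sqr_ge0 (y 0); have Z := sqr_ge0 (z 0).
have YZ := sqr_ge0 (y 0 - z 0).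
have LY : 0 <= lam * y 0 ^+ 2 by rewrite mulr_ge0.
(* This square equals 2 (s z + y)^2 + 2 y^2 - s^2 z^2. *)
have S := sqr_ge0 ((1 + t) * z t + 2 * y t).
have M1 : 0 <= (mu - 2) * y t ^+ 2 by rewrite mulr_ge0 ?sqr_ge0// subr_ge0.
have M2 : 0 <= mu * (lam * y 0 ^+ 2) by rewrite mulr_ge0// ltW.
have M3 : 0 <= mu * z 0 ^+ 2 by rewrite mulr_ge0// ltW.
have M4 : 0 <= mu * y 0 ^+ 2 by rewrite mulr_ge0// ltW.
have M5 : 0 <= lam * ((1 + t) * y t) ^+ 2 by rewrite mulr_ge0// sqr_ge0.
set q0 := z 0 ^+ 2 / _ in Yt q.
have H1 : (1 + t) ^+ 2 * (z t ^+ 2 + lam * y t ^+ 2) <=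
    2 * ((z 0 + y 0) ^+ 2 + (mu - 2) * y 0 ^+ 2 + lam * y 0 ^+ 2) + 2 * y t ^+ 2.
  apply: (@le_trans _ _ (2 * (((1 + t) * z t + y t) ^+ 2 + (mu - 2) * y t ^+ 2 +
    lam * ((1 + t) * y t) ^+ 2) + 2 * y t ^+ 2)); last by rewrite lerD2r ler_wpM2l.
  by clear - S M1 M5; nra.
clear H; apply: (le_trans H1); clear H1; clearbody q0.
have H2 : (z 0 + y 0) ^+ 2 <= 2 * z 0 ^+ 2 + 2 * y 0 ^+ 2 by nra.
lra.
Qed.

Lemma energy_gain_gt0 mu (t : R) : 0 <= t -> 0 < energy_gain mu t.
Proof.
move=> t0; have t1 : 0 < 1 + t by rewrite ltr_pwDl.
by rewrite /energy_gain; case: ifP => _; rewrite ?powR_gt0// invr_gt0.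
Qed.

Lemma energy_pointwise_gain mu : 0 < mu ->
  exists2 K : R, 0 < K & forall lam y z (t : R), 0 <= lam ->
  damped mu lam y z -> 0 <= t ->
  z t ^+ 2 + lam * y t ^+ 2 <=
  K * energy_gain mu t ^+ 2 * ((1 + lam) * y 0 ^+ 2 + z 0 ^+ 2).
Proof.
move=> mu0; have [mu2|mu2] := ltP mu 2.
  have [K K0 HK] := energy_pointwise_lt2 (ltac:(by rewrite mu0 mu2) : 0 < mu < 2).
  exists K => // lam y z t lam0 sol t0; have := HK lam y z t lam0 sol t0.
  have p0 : 0 < (1 + t) `^ mu by rewrite powR_gt0// ltr_pwDl.
  rewrite /energy_gain (ltW mu2) -ler_pdivlMl// => /le_trans; apply.
  have -> : ((1 + t) `^ (- (mu / 2))) ^+ 2 = ((1 + t) `^ mu)^-1.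
    rewrite -(powR_mulrn 2 (powR_ge0 _ _)) -powRrM -powRN.
    by congr (_ `^ _); field.
  by rewrite mulrA (mulrC K).
exists (166 + 3 * mu); first by rewrite addr_gt0// mulr_gt0.
move=> lam y z t lam0 sol t0; have := energy_pointwise_ge2 mu2 lam0 sol t0.
have t1 : 0 < 1 + t by rewrite ltr_pwDl.
(* At mu = 2 the other branch of [energy_gain] is selected, but the two formulas agree there. *)
have -> : energy_gain mu t = (1 + t)^-1.
  rewrite /energy_gain; case: ifP => // mu2'.
  have -> : mu = 2 by apply/eqP; rewrite eq_le mu2' mu2.
  by rewrite mulfV// powR_inv1// ltW.
rewrite -ler_pdivlMl ?exprn_gt0// => /le_trans; apply.
by rewrite exprVn mulrA (mulrC (_^-1)).
Qed.

End pointwise.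

(** * Operator norms *)

Section sqnorm.
Context {R : realType} {n : nat}.
Local Notation mu := (@lebesgue_rV R n).

(** The square of [L2norm]: an additive quantity that matches Plancherel's identity, with
    [L2norm_leP] translating back. *)
Definition sqnorm k (f : 'rV[R]_n -> 'rV[R]_k) : \bar R :=
  (\int[mu]_x (enorm (f x) ^+ 2)%:E)%E.

Lemma sqnorm_ge0 k (f : 'rV[R]_n -> 'rV[R]_k) : (0 <= sqnorm f)%E.
Proof. by apply: integral_ge0 => x _; rewrite lee_fin sqr_ge0. Qed.

Lemma L2norm_sqnorm k (f : 'rV[R]_n -> 'rV[R]_k) : (L2norm f `^ 2 = sqnorm f)%E.
Proof.
rewrite /L2norm poweR_Lnorm//; apply: eq_integral => x _.
by rewrite abse_EFin poweR_EFin powR_mulrn// real_normK ?num_real.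
Qed.

Lemma L2normE k (f : 'rV[R]_n -> 'rV[R]_k) : (L2norm f = sqnorm f `^ 2^-1)%E.
Proof.
by rewrite -L2norm_sqnorm -poweRrM mulfV// poweRe1// /L2norm Lnorm_ge0.
Qed.

Lemma L2norm_leP k (f : 'rV[R]_n -> 'rV[R]_k) (c : R) : 0 <= c ->
  (L2norm f <= c%:E)%E <-> (sqnorm f <= (c ^+ 2)%:E)%E.
Proof.
move=> c0; split => H.
  rewrite -L2norm_sqnorm -(powR_mulrn 2 c0) -poweR_EFin.
  by apply: gt0_ler_poweR => //; rewrite in_itv/= ?lee_fin ?leey ?andbT ?Lnorm_ge0.
rewrite L2normE -(ger0_norm c0) -sqrtr_sqr -powR12_sqrt ?sqr_ge0// -poweR_EFin.
by apply: gt0_ler_poweR => //; rewrite in_itv/= ?lee_fin ?leey ?andbT ?sqr_ge0 ?sqnorm_ge0.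
Qed.

Definition vmeasurable k (f : 'rV[R]_n -> 'rV[R]_k) : Prop :=
  forall i, measurable_fun setT (fun x => f x ord0 i).

Lemma L2_vmeasurable k (f : 'rV[R]_n -> 'rV[R]_k) : L2 f -> vmeasurable f.
Proof. by move=> Lf i; have /sub_Lfun_mfun := Lf i; rewrite inE. Qed.

Lemma vmeasurableB k (f g : 'rV[R]_n -> 'rV[R]_k) :
  vmeasurable f -> vmeasurable g -> vmeasurable (f \- g).
Proof.
move=> mf mg i; rewrite (_ : (fun x => _) = fun x => f x ord0 i - g x ord0 i).
  exact: measurable_funB.
by apply/funext => x; rewrite !mxE.
Qed.

Lemma measurable_enorm_sqr k (f : 'rV[R]_n -> 'rV[R]_k) : vmeasurable f ->
  measurable_fun setT (fun x => (enorm (f x) ^+ 2)%:E).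
Proof.
move=> mf; apply/measurable_EFinP; under eq_fun do rewrite enorm_sqr.
by apply: measurable_sum => i; exact: measurable_funX.
Qed.

Lemma sqnorm_split k (f g : 'rV[R]_n -> 'rV[R]_k) :
  vmeasurable f -> vmeasurable g ->
  (sqnorm g <= 2%:E * sqnorm (f \- g)%R + 2%:E * sqnorm f)%E.
Proof.
move=> mf mg; have mB := measurable_enorm_sqr (vmeasurableB mf mg).
have mF := measurable_enorm_sqr mf.
rewrite /sqnorm -!ge0_integralZl_EFin//; first last.
- by move=> x _; rewrite lee_fin sqr_ge0.
- by move=> x _; rewrite lee_fin sqr_ge0.
rewrite -ge0_integralD//; first last.
- exact: measurable_funeM.
- by move=> x _; rewrite -EFinM lee_fin mulr_ge0// sqr_ge0.
- exact: measurable_funeM.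
- by move=> x _; rewrite -EFinM lee_fin mulr_ge0// sqr_ge0.
apply: ge0_le_integral => //.
- by move=> x _; rewrite lee_fin sqr_ge0.
- exact: measurable_enorm_sqr.
- by apply: emeasurable_funD; exact: measurable_funeM.
- move=> x _; rewrite -!EFinM -EFinD lee_fin !enorm_sqr !mulr_sumr -big_split/=.
  apply: ler_sum => i _; rewrite !mxE.
  set a := f x ord0 i; set b := g x ord0 i.
  by have := sqr_ge0 (2 * a - b); nra.
Qed.

Lemma near_ereal_le (u : nat -> \bar R) (c : R) : 0 < c ->
  u j @[j --> \oo] --> 0%E -> \forall j \near \oo, (u j <= c%:E)%E.
Proof.
move=> c0 /fine_cvgP[fin cv]; near=> j.
have fj : u j \is a fin_num by near: j.
rewrite -(fineK fj) lee_fin; near: j.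
exact: (cvgr_le _ cv).
Unshelve. all: end_near. Qed.

(* The operator norm is only wanted up to a constant, so the passage to the
   closure may cost a factor [4]: one good approximation suffices. *)
Lemma L2_extension_opnorm k l (G : graph k l) (C : R) : 0 < C ->
  (forall p, G p -> [/\ vmeasurable p.1, vmeasurable p.2 &
     (sqnorm p.2 <= (C ^+ 2)%:E * sqnorm p.1)%E]) ->
  (L2_opnorm (L2_extension G) <= (4 * C)%:E)%E.
Proof.
move=> C0 HG; apply: ge_ereal_sup => _ [[a b] /= [[/= La Lb [q [Gq q1 q2]]] a1] <-].
have near1 := near_ereal_le ltr01 q1.
have near2 := near_ereal_le C0 q2.
have [j [s1 s2]] : exists j, (L2norm ((q j).1 \- a)%R <= 1%:E)%E /\
    (L2norm ((q j).2 \- b)%R <= C%:E)%E.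
  by apply: (@filter_ex _ \oo); apply: filterS2 near1 near2.
have [m1 m2 Hq] := HG _ (Gq j).
move: s1 s2 a1 => /(L2norm_leP _ ler01) s1 /(L2norm_leP _ (ltW C0)) s2.
move=> /(L2norm_leP _ ler01) a1.
have C4 : 0 <= 4 * C by rewrite mulr_ge0// ltW.
apply/(L2norm_leP _ C4).
have B1 := sqnorm_split m2 (L2_vmeasurable Lb).
have s1' : (sqnorm (a \- (q j).1)%R <= (1 ^+ 2)%:E)%E.
  suff -> : sqnorm (a \- (q j).1)%R = sqnorm ((q j).1 \- a)%R by [].
  apply: eq_integral => x _; congr (_%:E); rewrite !enorm_sqr.
  by apply: eq_bigr => i _; rewrite !mxE; ring.
have B2 := sqnorm_split (L2_vmeasurable La) m1.
(* Squared norms: 2 + 2 = 4 for the input of the approximation, hence 4 C^2 for its output and 2 C^2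
   + 8 C^2 <= (4 C)^2 for the limit. *)
have Q1 : (sqnorm (q j).1 <= 4%:E)%E.
  apply: (le_trans B2).
  apply: (@le_trans _ _ (2%:E * (1 ^+ 2)%:E + 2%:E * (1 ^+ 2)%:E)%E).
    by apply: leeD; apply: lee_wpmul2l => //; rewrite lee_fin.
  by rewrite -!EFinM -EFinD lee_fin expr1n; lra.
have Q2 : (sqnorm (q j).2 <= (4 * C ^+ 2)%:E)%E.
  apply: (le_trans Hq).
  have -> : (4 * C ^+ 2)%:E = ((C ^+ 2)%:E * 4%:E)%E by rewrite -EFinM (mulrC 4).
  by apply: lee_wpmul2l => //; rewrite lee_fin sqr_ge0.
apply: (le_trans B1).
apply: (@le_trans _ _ (2%:E * (C ^+ 2)%:E + 2%:E * (4 * C ^+ 2)%:E)%E).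
  by apply: leeD; apply: lee_wpmul2l => //; rewrite lee_fin.
by rewrite -!EFinM -EFinD lee_fin exprMn; have := sqr_ge0 C; lra.
Qed.

Lemma sqnorm_row1 (f : 'rV[R]_n -> R) :
  (sqnorm (Defs.row1 f) = \int[mu]_x (f x ^+ 2)%:E)%E.
Proof.
apply: eq_integral => x _; congr (_%:E).
by rewrite enorm_sqr big_ord1 /Defs.row1 mxE eqxx mulr1n.
Qed.

Lemma row2_0 (f g : 'rV[R]_n -> R) x : row2 f g x ord0 ord0 = f x.
Proof.
rewrite /row2 (_ : ord0 = lshift 1 (ord0 : 'I_1)); last exact/val_inj.
by rewrite [LHS](row_mxEl (f x)%:M (g x)%:M ord0) mxE eqxx mulr1n.
Qed.

Lemma row2_1 (f g : 'rV[R]_n -> R) x : row2 f g x ord0 (lift ord0 ord0) = g x.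
Proof.
rewrite /row2 (_ : lift ord0 ord0 = rshift 1 (ord0 : 'I_1)); last exact/val_inj.
by rewrite [LHS](row_mxEr (f x)%:M (g x)%:M ord0) mxE eqxx mulr1n.
Qed.

Lemma sqnorm_row2 (f g : 'rV[R]_n -> R) :
  measurable_fun setT f -> measurable_fun setT g ->
  (sqnorm (row2 f g) = \int[mu]_x (f x ^+ 2)%:E + \int[mu]_x (g x ^+ 2)%:E)%E.
Proof.
move=> mf mg; rewrite -ge0_integralD//; first last.
- by apply/measurable_EFinP; exact: measurable_funX.
- by move=> x _; rewrite lee_fin sqr_ge0.
- by apply/measurable_EFinP; exact: measurable_funX.
- by move=> x _; rewrite lee_fin sqr_ge0.
apply: eq_integral => x _; rewrite -EFinD; congr (_%:E).
by rewrite enorm_sqr big_ord_recl big_ord1 row2_0 row2_1.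
Qed.

Lemma vmeasurable_row1 (f : 'rV[R]_n -> R) : measurable_fun setT f ->
  vmeasurable (Defs.row1 f).
Proof.
by move=> mf i; rewrite (ord1 i); under eq_fun do rewrite /Defs.row1 mxE eqxx mulr1n.
Qed.

Lemma vmeasurable_row2 (f g : 'rV[R]_n -> R) :
  measurable_fun setT f -> measurable_fun setT g -> vmeasurable (row2 f g).
Proof.
move=> mf mg i; case: (unliftP ord0 i) => [j ->|->].
  by rewrite (ord1 j); under eq_fun do rewrite row2_1.
by under eq_fun do rewrite row2_0.
Qed.

End sqnorm.

(** * The estimates *)

Section estimates.
Context {R : realType} {n : nat}.
Implicit Types (f h m : 'rV[R]_n -> R) (v vt : R -> 'rV[R]_n -> R) (xi : 'rV[R]_n).
Local Notation mu := (@lebesgue_rV R n).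
Local Notation intg h := (mu.-integrable setT (EFin \o h)).

(** This is (2 pi)^n, the integral of 1 / (1 + s^2) being pi. *)
Definition plancherel_const : R := 2 ^+ n * @decay_mass R n.

Lemma plancherel_const_gt0 : 0 < plancherel_const.
Proof.
rewrite mulr_gt0 ?exprn_gt0//.
have g0 (s : R) : 0 <= (oneDsqr s)^-1 by rewrite invr_ge0.
have cg : continuous (fun s : R => (oneDsqr s)^-1) by exact: continuous_oneDsqrV.
have I1 : (\int[lebesgue_measure]_s ((oneDsqr s)^-1)%:E = (pi : R)%:E)%E.
  rewrite (@ge0_symfun_integralT _ (fun s => (oneDsqr s)^-1))//; last first.
    by move=> s; rewrite /oneDsqr/= sqrrN.
  by rewrite -set_itvcy integral0y_oneDsqr -EFinM mulrCA mulfV ?mulr1.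
have i1 : lebesgue_measure.-integrable setT (EFin \o fun s : R => (oneDsqr s)^-1).
  apply/integrableP; split.
    by apply/measurable_EFinP; exact: continuous_measurable_fun.
  by under eq_integral do rewrite /= ger0_norm//; rewrite I1 ltry.
have E := @integral_rV_prod R n (fun s => (oneDsqr s)^-1) g0 i1.
by rewrite /decay_mass /Rintegral [X in fine X]E /= exprn_gt0// /Rintegral I1 pi_gt0.
Qed.

Lemma hartley_sqr_integrable h : rapid h -> intg (fun xi => hartley h xi ^+ 2).
Proof.
move=> rh; apply/integrableP; split.
  apply/measurable_EFinP; apply: measurable_funX.
  exact: measurable_hartley (rapid_integrable rh).
under eq_integral do rewrite /= ger0_norm ?sqr_ge0//.
by rewrite plancherel// ltry.
Qed.

Lemma Rplancherel h : rapid h ->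
  \int[mu]_xi hartley h xi ^+ 2 = plancherel_const * \int[mu]_x h x ^+ 2.
Proof. by move=> rh; rewrite {1}/Rintegral plancherel. Qed.

(** Plancherel's identity for the function [m xi * hartley f xi], of which the multiplier is a
    transform. The fourth power squares the normalisation in [fourier_multiplierE]. *)
Lemma fourier_multiplier_sqr m f : continuous m -> (forall xi, m (- xi) = m xi) ->
  (forall xi, `|m xi| <= 1 + enorm xi ^+ 2) -> schwartz f ->
  measurable_fun setT (fourier_multiplier m f) /\
  (\int[mu]_x (fourier_multiplier m f x ^+ 2)%:E =
   ((Num.sqrt (2 * pi) ^- n) ^+ 4 * plancherel_const *
    \int[mu]_xi (m xi * hartley f xi) ^+ 2)%:E)%E.
Proof.
move=> cm em hm sf; have rg := rapid_symbol_hartley cm hm sf.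
have ig := rapid_integrable rg.
set c := Num.sqrt (2 * pi) ^- n.
have E : fourier_multiplier m f = fun x => c ^+ 2 * hartley (fun xi => m xi * hartley f xi) x.
  by apply/funext => x; apply: fourier_multiplierE => //; exact: schwartz_integrable.
split; first by rewrite E; apply: measurable_funM => //; exact: measurable_hartley.
have -> : (\int[mu]_x (fourier_multiplier m f x ^+ 2)%:E =
    \int[mu]_x (c ^+ 4 * hartley (fun xi => m xi * hartley f xi) x ^+ 2)%:E)%E.
  by apply: eq_integral => x _; rewrite E exprMn -exprM.
rewrite -EFin_Rintegral; last by apply: integrable_RZl; exact: hartley_sqr_integrable.
rewrite RintegralZl//; last exact: hartley_sqr_integrable.
by rewrite Rplancherel// mulrA.
Qed.

Lemma cauchy_solution_damped (mu0 : R) (v1 v2 : 'rV[R]_n -> R) v vt xi :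
  cauchy_solution mu0 v1 v2 v vt ->
  damped mu0 (enorm xi ^+ 2) (fun t => hartley (v t) xi) (fun t => hartley (vt t) xi).
Proof.
move=> [vtt [[cv cvt cvtt] [dv dvt eq _ _]]].
have sv t : 0 <= t -> schwartz (v t) by move=> /cv[].
have svt t : 0 <= t -> schwartz (vt t) by move=> /cvt[].
have svtt t : 0 <= t -> schwartz (vtt t) by move=> /cvtt[].
split.
- by move=> t t0; exact: is_derive_hartley.
- move=> t t0; have t0' := ltW t0.
  have -> : - (mu0 / (1 + t) * hartley (vt t) xi) - enorm xi ^+ 2 * hartley (v t) xi
      = hartley (vtt t) xi; last exact: is_derive_hartley.
  have il : intg (laplacian (v t)).
    by have [] := laplacian_hartley xi (sv t t0').
  have it := schwartz_integrable (svt t t0').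
  have -> : vtt t = fun x => laplacian (v t) x + (- (mu0 / (1 + t))) * vt t x.
    by apply/funext => x; have := eq t x t0'; lra.
  rewrite hartleyD//; last exact: integrable_RZl.
  by have [_ ->] := laplacian_hartley xi (sv t t0'); rewrite hartleyZ// addrC mulNr.
- by move=> T; exact: hartley_schwartz_continuous.
- by move=> T; exact: hartley_schwartz_continuous.
Qed.

Lemma cauchy_solution_schwartz (mu0 : R) (v1 v2 : 'rV[R]_n -> R) v vt (t : R) :
  cauchy_solution mu0 v1 v2 v vt -> 0 <= t -> schwartz (v t) /\ schwartz (vt t).
Proof. by move=> [vtt [[cv cvt _] _]] t0; have [] := cv t t0; have [] := cvt t t0. Qed.

Lemma cauchy_solution_init (mu0 : R) (v1 v2 : 'rV[R]_n -> R) v vt :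
  cauchy_solution mu0 v1 v2 v vt -> v 0 = v1 /\ vt 0 = v2.
Proof. by move=> [vtt [_ []]]. Qed.

Lemma schwartz_rapid0 f : schwartz f -> rapid f.
Proof. exact: (@schwartz_rapid R n [::]). Qed.

Lemma rapid_sqr_EFin h : rapid h ->
  (\int[mu]_x (h x ^+ 2)%:E = (\int[mu]_x h x ^+ 2)%:E)%E.
Proof. by move=> rh; rewrite EFin_Rintegral//; exact: rapid_sqr_integrable. Qed.

Let kappa : R := (Num.sqrt (2 * pi) ^- n) ^+ 4.

Let kappa_gt0 : 0 < kappa.
Proof. by rewrite exprn_gt0// invr_gt0 exprn_gt0// sqrtr_gt0 mulr_gt0// pi_gt0. Qed.

Lemma solution_sqnorm_le (mu0 : R) : 0 < mu0 ->
  exists2 K : R, 0 < K & forall (t : R) (v1 v2 : 'rV[R]_n -> R) v vt, 0 <= t ->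
  schwartz v1 -> schwartz v2 -> cauchy_solution mu0 v1 v2 v vt ->
  [/\ vmeasurable (row2 v1 (inv_japaneseD v2)), vmeasurable (Defs.row1 (v t)) &
    (sqnorm (Defs.row1 (v t)) <= ((K * solution_gain mu0 t) ^+ 2)%:E *
      sqnorm (row2 v1 (inv_japaneseD v2)))%E].
Proof.
move=> mu00; have [K0 K00 HK] := solution_pointwise_gain mu00.
have c0 := plancherel_const_gt0; set c := plancherel_const in c0.
(* In truth [kappa * c ^+ 2] is 1. With this [d], positivity alone gives c A + B <= c d (A + kappa c
   B), by keeping one product for each summand. *)
pose d := 1 + (kappa * c ^+ 2)^-1.
have kc0 : 0 < kappa * c ^+ 2 by rewrite mulr_gt0// exprn_gt0.
have d0 : 0 < d by rewrite addr_gt0// invr_gt0.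
have Kd0 : 0 < K0 * d by rewrite mulr_gt0.
exists (Num.sqrt (K0 * d)); first by rewrite sqrtr_gt0.
move=> t v1 v2 v vt t0 sv1 sv2 sol.
have [svt _] := cauchy_solution_schwartz sol t0.
have [v0 vt0] := cauchy_solution_init sol.
have [mJ EJ] := fourier_multiplier_sqr (@continuous_japaneseV R n)
  (fun xi => congr1 (fun a => a^-1) (japaneseN xi)) (@japaneseV_le R n) sv2.
have rJ := rapid_symbol_hartley (@continuous_japaneseV R n) (@japaneseV_le R n) sv2.
have mv1 := schwartz_measurable sv1; have mvt := schwartz_measurable svt.
split; [exact: vmeasurable_row2|exact: vmeasurable_row1|].
rewrite sqnorm_row1 sqnorm_row2// [X in (_ + X)%E]EJ -/kappa -/c.
have rv := schwartz_rapid0 svt; have rv1 := schwartz_rapid0 sv1.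
rewrite !rapid_sqr_EFin// -EFinD -EFinM lee_fin exprMn sqr_sqrtr ?(ltW Kd0)//.
set g := solution_gain mu0 t.
set A := \int[mu]_x v1 x ^+ 2; set B := \int[mu]_xi (_ * hartley v2 xi) ^+ 2.
have A0 : 0 <= A by apply: Rintegral_ge0 => x _; exact: sqr_ge0.
have B0 : 0 <= B by apply: Rintegral_ge0 => x _; exact: sqr_ge0.
(* The pointwise bound integrated over frequencies: lam = |xi|^2 turns z^2 / (1 + lam) into the
   squared transform with symbol [(japanese xi)^-1]. *)
have H : c * \int[mu]_x v t x ^+ 2 <= K0 * g ^+ 2 * (c * A + B).
  rewrite -Rplancherel// -Rplancherel// -RintegralD//; first last.
  - exact: (rapid_sqr_integrable rJ).
  - exact: hartley_sqr_integrable.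
  have iR : intg (fun xi => hartley v1 xi ^+ 2 + ((japanese xi)^-1 * hartley v2 xi) ^+ 2).
    by apply: integrable_RD; [exact: hartley_sqr_integrable|exact: (rapid_sqr_integrable rJ)].
  rewrite -RintegralZl//.
  apply: le_Rintegral => //; [exact: hartley_sqr_integrable|exact: integrable_RZl|].
  move=> xi _; have := HK _ _ _ t (sqr_ge0 (enorm xi)) (cauchy_solution_damped xi sol) t0.
  by rewrite v0 vt0 exprMn exprVn japanese_sqr [X in _ + X]mulrC.
rewrite -(ler_pM2l c0) (le_trans H)//.
have -> : c * (K0 * d * g ^+ 2 * (A + kappa * c * B)) =
    K0 * g ^+ 2 * (c * (d * (A + kappa * c * B))) by ring.
apply: ler_wpM2l; first exact: mulr_ge0 (ltW K00) (sqr_ge0 _).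
have -> : c * (d * (A + kappa * c * B)) = c * A + B + c * (A / (kappa * c ^+ 2) + kappa * c * B).
  by rewrite /d; field; rewrite !gt_eqF.
rewrite lerDl; rewrite mulr_ge0 ?(ltW c0)// addr_ge0//.
  by rewrite divr_ge0// ltW.
exact: mulr_ge0 (mulr_ge0 (ltW kappa_gt0) (ltW c0)) B0.
Qed.

Lemma energy_sqnorm_le (mu0 : R) : 0 < mu0 ->
  exists2 K : R, 0 < K & forall (t : R) (v1 v2 : 'rV[R]_n -> R) v vt, 0 <= t ->
  schwartz v1 -> schwartz v2 -> cauchy_solution mu0 v1 v2 v vt ->
  [/\ vmeasurable (row2 (japaneseD v1) v2), vmeasurable (row2 (vt t) (absD (v t))) &
    (sqnorm (row2 (vt t) (absD (v t))) <= ((K * energy_gain mu0 t) ^+ 2)%:E *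
      sqnorm (row2 (japaneseD v1) v2))%E].
Proof.
move=> mu00; have [K0 K00 HK] := energy_pointwise_gain mu00.
have c0 := plancherel_const_gt0; set c := plancherel_const in c0.
(* [d1] and [d2] absorb the normalisations of the output and of the input: A + kappa c B <= d1 (c A
   + B) and B1 + c A2 <= d2 (kappa c B1 + A2). *)
pose d1 := c^-1 + kappa * c.
pose d2 := (kappa * c)^-1 + c.
have kc0 : 0 < kappa * c by rewrite mulr_gt0.
have d10 : 0 < d1 by rewrite addr_gt0// invr_gt0.
have d20 : 0 < d2 by rewrite addr_gt0// invr_gt0.
have Kd0 : 0 < K0 * (d1 * d2) by rewrite !mulr_gt0.
exists (Num.sqrt (K0 * (d1 * d2))); first by rewrite sqrtr_gt0.
move=> t v1 v2 v vt t0 sv1 sv2 sol.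
have [sv svt] := cauchy_solution_schwartz sol t0.
have [v0 vt0] := cauchy_solution_init sol.
have := fourier_multiplier_sqr (@continuous_japanese R n)
  (@japaneseN R n) (@japanese_le R n) sv1.
rewrite -/(japaneseD v1) => -[mJ EJ].
have := fourier_multiplier_sqr (@continuous_enorm R n)
  (@enormN R n) (@enorm_le R n) sv.
rewrite -/(absD (v t)) => -[mD ED].
have rJ := rapid_symbol_hartley (@continuous_japanese R n) (@japanese_le R n) sv1.
have rD := rapid_symbol_hartley (@continuous_enorm R n) (@enorm_le R n) sv.
have mv2 := schwartz_measurable sv2; have mvt := schwartz_measurable svt.
split; [exact: vmeasurable_row2 mJ mv2|exact: vmeasurable_row2 mvt mD|].
have rvt := schwartz_rapid0 svt; have rv2 := schwartz_rapid0 sv2.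
rewrite -/kappa -/c in EJ ED; set g := energy_gain mu0 t.
pose A := \int[mu]_x vt t x ^+ 2; pose A2 := \int[mu]_x v2 x ^+ 2.
pose B := \int[mu]_xi (enorm xi * hartley (v t) xi) ^+ 2.
pose B1 := \int[mu]_xi (japanese xi * hartley v1 xi) ^+ 2.
have EL : (sqnorm (row2 (vt t) (absD (v t))) = (A + kappa * c * B)%:E)%E.
  by rewrite (sqnorm_row2 mvt mD) (rapid_sqr_EFin rvt) ED EFinD.
have ER : (sqnorm (row2 (japaneseD v1) v2) = (kappa * c * B1 + A2)%:E)%E.
  by rewrite (sqnorm_row2 mJ mv2) (rapid_sqr_EFin rv2) EJ EFinD.
rewrite EL ER -EFinM lee_fin exprMn sqr_sqrtr ?(ltW Kd0)//.
have A0 : 0 <= A by apply: Rintegral_ge0 => x _; exact: sqr_ge0.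
have A20 : 0 <= A2 by apply: Rintegral_ge0 => x _; exact: sqr_ge0.
have B0 : 0 <= B by apply: Rintegral_ge0 => x _; exact: sqr_ge0.
have B10 : 0 <= B1 by apply: Rintegral_ge0 => x _; exact: sqr_ge0.
have H : c * A + B <= K0 * g ^+ 2 * (B1 + c * A2).
  rewrite -Rplancherel// -Rplancherel// -!RintegralD//; first last.
  - exact: (rapid_sqr_integrable rD).
  - exact: hartley_sqr_integrable.
  - exact: hartley_sqr_integrable.
  - exact: (rapid_sqr_integrable rJ).
  have iR : intg (fun xi => (japanese xi * hartley v1 xi) ^+ 2 + hartley v2 xi ^+ 2).
    by apply: integrable_RD; [exact: (rapid_sqr_integrable rJ)|exact: hartley_sqr_integrable].
  have iL : intg (fun xi => hartley (vt t) xi ^+ 2 + (enorm xi * hartley (v t) xi) ^+ 2).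
    by apply: integrable_RD; [exact: hartley_sqr_integrable|exact: (rapid_sqr_integrable rD)].
  rewrite -RintegralZl//.
  apply: le_Rintegral => //; first exact: integrable_RZl.
  move=> xi _; have := HK _ _ _ t (sqr_ge0 (enorm xi)) (cauchy_solution_damped xi sol) t0.
  by rewrite v0 vt0 !exprMn japanese_sqr.
apply: (@le_trans _ _ (d1 * (c * A + B))).
  have -> : d1 * (c * A + B) = A + kappa * c * B + (kappa * c * (c * A) + B / c).
    by rewrite /d1; field; rewrite gt_eqF.
  rewrite lerDl addr_ge0//; last exact: divr_ge0 B0 (ltW c0).
  exact: mulr_ge0 (ltW kc0) (mulr_ge0 (ltW c0) A0).
apply: (@le_trans _ _ (d1 * (K0 * g ^+ 2 * (B1 + c * A2)))).
  by rewrite ler_pM2l.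
have -> : d1 * (K0 * g ^+ 2 * (B1 + c * A2)) = K0 * d1 * g ^+ 2 * (B1 + c * A2) by ring.
have -> : K0 * (d1 * d2) * g ^+ 2 * (kappa * c * B1 + A2) =
    K0 * d1 * g ^+ 2 * (d2 * (kappa * c * B1 + A2)) by ring.
apply: ler_wpM2l; first exact: mulr_ge0 (mulr_ge0 (ltW K00) (ltW d10)) (sqr_ge0 _).
have -> : d2 * (kappa * c * B1 + A2) = B1 + c * A2 + (A2 / (kappa * c) + c * (kappa * c * B1)).
  by rewrite /d2; field; rewrite !gt_eqF.
rewrite lerDl addr_ge0//; first exact: divr_ge0 A20 (ltW kc0).
exact: mulr_ge0 (ltW c0) (mulr_ge0 (ltW kc0) B10).
Qed.

End estimates.

Theorem theorem3p4 (R : realType) (n : nat) (mu : R)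
    (n_ge1 : (1 <= n)%N) (mu_gt0 : 0 < mu) :
  (exists2 C : R, 0 < C & forall t : R, 0 <= t ->
     (L2_opnorm (@solution_operator R n mu t) <=
      (C * (if mu < 1 then (1 + t) `^ (1 - mu)
            else if mu == 1 then ln (expR 1 + t)
            else 1))%:E)%E)
  /\
  (exists2 C : R, 0 < C & forall t : R, 0 <= t ->
     (L2_opnorm (@energy_operator R n mu t) <=
      (C * (if mu <= 2 then (1 + t) `^ (- (mu / 2))
            else (1 + t)^-1))%:E)%E).
Proof.
split.
- have [K K0 HK] := @solution_sqnorm_le R n mu mu_gt0.
  have [K' K'0 HK'] := solution_gain_bound mu_gt0.
  exists (4 * K); first by rewrite mulr_gt0.
  move=> t t0; rewrite -/(solution_gain mu t) -mulrA.
  (* Read off from [1 <= K' * solution_gain mu t], which covers the three ranges of [mu] at once. *)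
  have g0 : 0 < solution_gain mu t.
    by rewrite -(pmulr_rgt0 _ K'0); have [h _ _] := HK' t t0; exact: lt_le_trans h.
  apply: L2_extension_opnorm; first by rewrite mulr_gt0.
  by move=> _ [v1 [v2 [v [vt [s1 s2 sol ->]]]]]; exact: HK sol.
- have [K K0 HK] := @energy_sqnorm_le R n mu mu_gt0.
  exists (4 * K); first by rewrite mulr_gt0.
  move=> t t0; rewrite -/(energy_gain mu t) -mulrA.
  have g0 := energy_gain_gt0 mu t0.
  apply: L2_extension_opnorm; first by rewrite mulr_gt0.
  by move=> _ [v1 [v2 [v [vt [s1 s2 sol ->]]]]]; exact: HK sol.
Qed.
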